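(* Let $\lambda$ and $\gamma$ be partitions, let $\alpha$ be a composition and let $\mu=sort(\alpha)$ be the partition obtained by sorting the parts of $\alpha$ in weakly decreasing order. Then the coefficient of $\tilde s_\gamma$ in the expansion of $\tilde h_\mu\,\tilde s_\lambda$ in the basis $\{\tilde s_\nu\}_\nu$ equals the number of tableaux $T\in\mathcal{MCT}_\gamma(\lambda,\alpha)$ whose labels are sets containing at most one unbarred letter (and at most one barred letter) and which are lattice tableaux.
   Context: For $\mu\vdash n$, $\Xi_\mu$ is the multiset of $n$ complex numbers consisting, for each part $\mu_i$, of all $\mu_i$-th roots of unity; $f[\Xi_\mu]$ is the evaluation of the symmetric function $f$ at these values (other variables $0$). For a partition $\lambda$, $\tilde s_\lambda$ is the symmetric function characterized by $\tilde s_\lambda[\Xi_\nu]=\chi^{(n-|\lambda|,\lambda)}(\nu)$ for all $n\ge|\lambda|+\lambda_1$, $\nu\vdash n$ ($\chi^\rho$ the irreducible $S_n$-character), and $\tilde h_\lambda$ is characterized by $\tilde h_\lambda[\Xi_\nu]=\langle h_{(n-|\lambda|,\lambda)},p_\nu\rangle$ for all such $n,\nu$ (Hall inner product, $h$ complete homogeneous, $p$ power sums). The $\tilde s_\lambda$ form a basis of the symmetric functions. Tableaux conventions: French notation (row 1 at the bottom). Alphabet $\bar1<\bar2<\cdots<1<2<\cdots$. Multisets over it with at most one barred letter are ordered by reverse lex order: compare largest elements, then second largest, etc.; $M<N$ if at the first difference $M$'s element is smaller, or if all compared agree and $M$ has fewer elements. For a partition $\gamma$ and $r\ge\gamma_1$,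 shape $(r,\gamma)/(\gamma_1)$ has cells $(1,j)$, $\gamma_1<j\le r$, and $(i+1,j)$, $i\ge1$, $1\le j\le\gamma_i$. $\mathcal{MCT}_\gamma(\lambda,\alpha)$ is the set of fillings of some shape $(r,\gamma)/(\gamma_1)$ by nonempty multisets with at most one barred letter each, weakly increasing along rows and strictly increasing up columns in reverse lex order, with multiset union of labels $\{\bar1^{\lambda_1},\bar2^{\lambda_2},\ldots,1^{\alpha_1},2^{\alpha_2},\ldots\}$, and with no row-1 cell labeled only by a barred letter. Reading order: bottom row to top row, right to left within rows. For a multiset $S$ of unbarred letters, $read(T|_S)$ is the word of barred letters $\bar j$ (in reading order) of cells labeled $\{\bar j\}\cup S$; $read(T|_-)$ is the case $S=\emptyset$. With $S_1<\cdots<S_d$ the distinct nonempty unbarred parts of labels of $T$, $T$ is a lattice tableau if $read(T|_-)read(T|_{S_1})\cdots read(T|_{S_d})$ (reading $\bar j$ as $j$) is lattice: every prefix has at least as many $j$'s as $(j+1)$'s for all $j\ge1$. *)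

(* Defs.v *)
From HB Require Import structures.
From mathcomp Require Import all_boot all_order all_fingroup all_algebra.
From mathcomp Require Import all_solvable all_field all_character.
From mathcomp Require Import finmap mpoly.
From mathcomp Require Import boolp.

Set Implicit Arguments.
Unset Strict Implicit.
Unset Printing Implicit Defensive.

Import Order.TTheory GRing.Theory Num.Theory.

Local Open Scope ring_scope.

Definition is_part (s : seq nat) : bool := sorted geq s && (0%N \notin s).

Record intpart := IntPart { part_val :> seq nat; _ : is_part part_val }.
HB.instance Definition _ := [isSub for part_val].
HB.instance Definition _ := [Choice of intpart by <:].

Definition conj_part (s : seq nat) : seq nat :=
  mkseq (fun j => count (leq j.+1) s) (head 0%N s).

(* Symmetric functions over algC: the projective limit, in the category of
   graded rings, of the rings of symmetric polynomials in n variables, the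
   transition maps setting the last variable to 0. *)

Definition kill_last n (p : {mpoly algC[n.+1]}) : {mpoly algC[n]} :=
  p \mPo [tuple of rcons [tuple 'X_i | i < n] 0].

Definition sf_axiom (F : forall n, {mpoly algC[n]}) : Prop :=
  [/\ forall n, F n \is symmetric,
      forall n, kill_last (F n.+1) = F n
    & exists d, forall n, (msize (F n) <= d)%N].

Record symfun := SymFun {
  sf_poly :> forall n, {mpoly algC[n]};
  sf_poly_axiom : sf_axiom sf_poly
}.

HB.instance Definition _ := gen_eqMixin symfun.
HB.instance Definition _ := gen_choiceMixin symfun.

Lemma sf_ext (f g : symfun) : (forall n, f n = g n) -> f = g.
Proof.
case: f g => [f fP] [g gP] /= fg.
have E : f = g by apply: functional_extensionality_dep.
by subst g; congr SymFun; apply: Prop_irrelevance.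
Qed.

Fact sf_zero_subproof : sf_axiom (fun=> 0).
Proof.
split=> [n|n|]; [exact: rpred0|exact: comp_mpoly0|].
by exists 0%N => n; rewrite msize0.
Qed.
Definition sf_zero := SymFun sf_zero_subproof.

Fact sf_one_subproof : sf_axiom (fun=> 1).
Proof.
split=> [n|n|]; [exact: rpred1|exact: comp_mpoly1|].
by exists 1%N => n; rewrite msize1.
Qed.
Definition sf_one := SymFun sf_one_subproof.

Fact sf_opp_subproof (f : symfun) : sf_axiom (fun n => - f n).
Proof.
case: f => f [f1 f2 [d f3]] /=; split=> [n|n|].
- by rewrite rpredN f1.
- by rewrite /kill_last comp_mpolyN -(f2 n).
- by exists d => n; rewrite -scaleN1r (leq_trans (msizeZ_le _ _)).
Qed.
Definition sf_opp f := SymFun (sf_opp_subproof f).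

Fact sf_add_subproof (f g : symfun) : sf_axiom (fun n => f n + g n).
Proof.
case: f g => f [f1 f2 [d f3]] [g [g1 g2 [e g3]]] /=; split=> [n|n|].
- by rewrite rpredD ?f1 ?g1.
- by rewrite /kill_last comp_mpolyD -(f2 n) -(g2 n).
- exists (maxn d e) => n; rewrite (leq_trans (msizeD_le _ _)) //.
  by rewrite geq_max !leq_max f3 g3 orbT.
Qed.
Definition sf_add f g := SymFun (sf_add_subproof f g).

Fact sf_mul_subproof (f g : symfun) : sf_axiom (fun n => f n * g n).
Proof.
case: f g => f [f1 f2 [d f3]] [g [g1 g2 [e g3]]] /=; split=> [n|n|].
- by rewrite rpredM ?f1 ?g1.
- by rewrite /kill_last rmorphM -(f2 n) -(g2 n).
- exists (d + e).+1 => n; rewrite (leq_trans (msizeM_le _ _)) //.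
  by rewrite ltnS leq_add.
Qed.
Definition sf_mul f g := SymFun (sf_mul_subproof f g).

Fact sf_scale_subproof (k : algC) (f : symfun) : sf_axiom (fun n => k *: f n).
Proof.
case: f => f [f1 f2 [d f3]] /=; split=> [n|n|].
- by rewrite rpredZ ?f1.
- by rewrite /kill_last comp_mpolyZ -(f2 n).
- by exists d => n; rewrite (leq_trans (msizeZ_le _ _)).
Qed.
Definition sf_scale k f := SymFun (sf_scale_subproof k f).

Fact sf_addA : associative sf_add.
Proof. by move=> f g h; apply: sf_ext => n; rewrite /= addrA. Qed.
Fact sf_addC : commutative sf_add.
Proof. by move=> f g; apply: sf_ext => n; rewrite /= addrC. Qed.
Fact sf_add0 : left_id sf_zero sf_add.
Proof. by move=> f; apply: sf_ext => n; rewrite /= add0r. Qed.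
Fact sf_addN : left_inverse sf_zero sf_opp sf_add.
Proof.
by move=> f; apply: sf_ext => n; rewrite /= addNr.
Qed.
HB.instance Definition _ :=
  GRing.isZmodule.Build symfun sf_addA sf_addC sf_add0 sf_addN.

Fact sf_mulA : associative sf_mul.
Proof. by move=> f g h; apply: sf_ext => n; rewrite /= mulrA. Qed.
Fact sf_mulC : commutative sf_mul.
Proof. by move=> f g; apply: sf_ext => n; rewrite /= mulrC. Qed.
Fact sf_mul1 : left_id sf_one sf_mul.
Proof. by move=> f; apply: sf_ext => n; rewrite /= mul1r. Qed.
Fact sf_mulDl : left_distributive sf_mul sf_add.
Proof.
by move=> f g h; apply: sf_ext => n; rewrite /= mulrDl.
Qed.
Fact sf_one_neq0 : sf_one != 0.
Proof.
apply/eqP => /(congr1 (fun f : symfun => f 0%N)).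
by rewrite /=; apply/eqP; rewrite oner_eq0.
Qed.
HB.instance Definition _ := GRing.Zmodule_isComNzRing.Build symfun
  sf_mulA sf_mulC sf_mul1 sf_mulDl sf_one_neq0.

Fact sf_scaleA a b f : sf_scale a (sf_scale b f) = sf_scale (a * b) f.
Proof. by apply: sf_ext => n; rewrite /= scalerA. Qed.
Fact sf_scale1 : left_id 1 sf_scale.
Proof. by move=> f; apply: sf_ext => n; rewrite /= scale1r. Qed.
Fact sf_scaleDr : right_distributive sf_scale +%R.
Proof.
by move=> a f g; apply: sf_ext => n; rewrite /= scalerDr.
Qed.
Fact sf_scaleDl f : {morph sf_scale^~ f : a b / a + b}.
Proof.
by move=> a b; apply: sf_ext => n; rewrite /= scalerDl.
Qed.
HB.instance Definition _ := GRing.Zmodule_isLmodule.Build algC symfun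
  sf_scaleA sf_scale1 sf_scaleDr sf_scaleDl.

Fact sf_scaleAl (a : algC) (f g : symfun) : a *: (f * g) = (a *: f) * g.
Proof. by apply: sf_ext => n; rewrite /= scalerAl. Qed.
HB.instance Definition _ :=
  GRing.Lmodule_isLalgebra.Build algC symfun sf_scaleAl.
HB.instance Definition _ := GRing.Lalgebra_isComAlgebra.Build algC symfun.

(* [sf_poly f n] is f with all variables but the first n set to 0, so this is
   f evaluated at the entries of X and at 0 for every other variable. *)
Definition sf_eval (f : symfun) (X : seq algC) : algC :=
  (f (size X)).@[fun i : 'I_(size X) => X`_i].

Definition psum_poly k n : {mpoly algC[n]} := \sum_(i < n) 'X_i ^+ k.+1.

Fact psum_subproof k : sf_axiom (psum_poly k).
Proof.
split=> [n|n|].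
- apply/issymP => s; rewrite /psum_poly raddf_sum /=.
  rewrite (reindex_inj (@perm_inj _ s^-1%g)) /=; apply: eq_bigr => i _.
  rewrite rmorphXn /=; congr (_ ^+ _); rewrite msymX; congr 'X_[_].
  apply/mnmP => j; rewrite !mnmE; congr (nat_of_bool _).
  by apply: (inj_eq perm_inj).
- rewrite /psum_poly /kill_last raddf_sum big_ord_recr /=.
  rewrite rmorphXn /= comp_mpolyXU /= nth_rcons size_map size_enum_ord ltnn.
  rewrite eqxx expr0n /= addr0; apply: eq_bigr => i _.
  rewrite rmorphXn /= comp_mpolyXU /= nth_rcons size_map size_enum_ord.
  by rewrite ltn_ord (nth_map i) ?size_enum_ord // nth_ord_enum.
- exists k.+2 => n; rewrite /psum_poly (leq_trans (msize_sum _ _ _)) //.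
  apply/bigmax_leqP_seq => i _ _.
  by rewrite mpolyXn msizeX mdegMn mdeg1 mul1n.
Qed.

(* The power sum of exponent k.+1. *)
Definition psumS k := SymFun (psum_subproof k).

Definition psym (nu : intpart) : symfun := \prod_(k <- nu) psumS k.-1.

Definition monos_poly (P : pred (seq nat)) d n : {mpoly algC[n]} :=
  \sum_(m : 'X_{1..n < d} | P (m : 'X_{1..n})) 'X_[m].

Lemma monos_polyE P d n (m : 'X_{1..n}) :
  (monos_poly P d n)@_m = (P m && (mdeg m < d)%N)%:R.
Proof.
rewrite /monos_poly raddf_sum /=; case: (ltnP (mdeg m) d) => lt_md; last first.
  rewrite andbF big1 // => k _; rewrite mcoeffX.
  by case: eqP => // km; move: (valP k); rewrite /= km ltnNge lt_md.
rewrite andbT; case Pm: (P m).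
  rewrite (bigD1 (BMultinom lt_md)) //= mcoeffX eqxx big1 ?addr0 // => k.
  case/andP=> _ /negbTE; rewrite -val_eqE /= => neq; by rewrite mcoeffX neq.
rewrite big1 // => k Pk; rewrite mcoeffX.
by case: eqP => // km; rewrite km Pm in Pk.
Qed.

Lemma kill_lastX n (m : 'X_{1..n.+1}) (k : 'X_{1..n}) :
  (kill_last 'X_[m])@_k = (m == mnmwiden k)%:R.
Proof.
rewrite /kill_last comp_mpolyX big_ord_recr /= (tnth_nth 0) /= nth_rcons.
rewrite size_map size_enum_ord ltnn eqxx expr0n.
have -> : \prod_(i < n) tnth [tuple of rcons [tuple 'X_j | j < n] 0]
    (widen_ord (leqnSn n) i) ^+ m (widen_ord (leqnSn n) i) =
    'X_[[multinom m (widen_ord (leqnSn n) i) | i < n]] :> {mpoly algC[n]}.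
  rewrite mpolyXE_id; apply: eq_bigr => i _; rewrite mnmE.
  rewrite (tnth_nth 0) /= nth_rcons size_map size_enum_ord ltn_ord.
  by rewrite (nth_map i) ?size_enum_ord // nth_ord_enum.
rewrite mulr_natr mcoeffMn mcoeffX -mulrnA mulnb; congr (nat_of_bool _)%:R.
apply/andP/eqP => [[/eqP E /eqP m0]|->].
  apply/mnmP => i; have [ltin|] := ltnP i n; last first.
    move=> leni; have -> : i = ord_max.
      by apply/val_inj/eqP; rewrite /= eqn_leq leni -ltnS ltn_ord.
    by rewrite mnmwiden_ordmax m0.
  have -> : i = widen_ord (leqnSn n) (Ordinal ltin) by apply: val_inj.
  by rewrite mnmwiden_widen -E mnmE.
rewrite mnmwiden_ordmax; split=> //; apply/eqP/mnmP => i.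
by rewrite mnmE mnmwiden_widen.
Qed.

(* [P], read on exponent vectors, must not depend on the order of the
   variables nor on how many of them are unused. *)
Definition monos_pred (P : pred (seq nat)) :=
  (forall s t, perm_eq s t -> P s = P t) /\ (forall s, P (rcons s 0%N) = P s).

Fact monos_subproof P d : monos_pred P -> sf_axiom (monos_poly P d).
Proof.
case=> Pperm P0; split=> [n|n|].
- apply/issymP => s; apply/mpolyP => m; rewrite mcoeff_sym !monos_polyE.
  have pm : perm_eq [multinom m (s i) | i < n] m.
    apply/tuple_permP; exists s; apply: (@eq_from_nth _ 0%N).
      by rewrite !size_tuple.
    move=> i; rewrite size_tuple => lti.
    by rewrite -!(tnth_nth 0%N _ (Ordinal lti)) !tnth_mktuple.
  congr (nat_of_bool (_ && _))%:R; first exact: Pperm.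
  congr (_ < _)%N; rewrite !mdegE [RHS](reindex_inj (@perm_inj _ s)) /=.
  by apply: eq_bigr => i _; rewrite mnmE.
- apply/mpolyP => k.
  transitivity ((monos_poly P d n.+1)@_(mnmwiden k)).
    rewrite /monos_poly /kill_last (raddf_sum (comp_mpoly _)) !raddf_sum /=.
    by apply: eq_bigr => m _; rewrite kill_lastX mcoeffX.
  rewrite !monos_polyE P0; congr (nat_of_bool (_ && (_ < _)%N))%:R.
  rewrite !mdegE big_ord_recr /= mnmwiden_ordmax addn0.
  by apply: eq_bigr => i _; rewrite mnmwiden_widen.
- exists d => n; rewrite /monos_poly (leq_trans (msize_sum _ _ _)) //.
  by apply/bigmax_leqP_seq => m _ _; rewrite msizeX; apply: valP m.
Qed.

Definition hom_pred k : pred (seq nat) := fun s => sumn s == k.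

Fact hom_predP k : monos_pred (hom_pred k).
Proof.
split=> [s t st|s]; last by rewrite /hom_pred sumn_rcons addn0.
by rewrite /hom_pred; congr (_ == _); apply: perm_sumn.
Qed.

Definition hom k := SymFun (monos_subproof k.+1 (hom_predP k)).

Definition hsym (s : seq nat) : symfun := \prod_(k <- s) hom k.

Definition mono_pred (ka : seq nat) : pred (seq nat) :=
  fun s => perm_eq (filter (leq 1) s) ka.

Fact mono_predP ka : monos_pred (mono_pred ka).
Proof.
split=> [s t st|s]; last by rewrite /mono_pred filter_rcons.
by apply: (permPl _ ka); apply: perm_filter.
Qed.

Definition monomial (ka : intpart) :=
  SymFun (monos_subproof (sumn ka).+1 (mono_predP ka)).

Definition is_hall (B : {bilinear symfun -> symfun -> algC | *%R & *%R}) :=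
  forall ka la : intpart, B (hsym ka) (monomial la) = (ka == la)%:R.

Definition roots_of_unity (d : nat) : seq algC :=
  sval (closed_field_poly_normal ('X^d - 1 : {poly algC})).

Definition Xi (nu : seq nat) : seq algC := flatten (map roots_of_unity nu).

Definition cycle_type n (s : 'S_n) : seq nat :=
  sort geq [seq #|pred_of_set c| | c <- enum (porbits s)].

(* The stabiliser of the partition of 'I_n into consecutive intervals of
   lengths given by rho. *)
Definition young_set n (rho : seq nat) : {set 'S_n} :=
  [set s : 'S_n | [forall i : 'I_n,
    reshape_index rho (s i) == reshape_index rho i]].

Fact young_group_set n rho : group_set (young_set n rho).
Proof.
apply/group_setP; split=> [|s t]; first by rewrite inE; apply/forallP=> i; rewrite perm1.
rewrite !inE => /forallP sP /forallP tP; apply/forallP => i.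
by rewrite permM (eqP (tP _)).
Qed.
Canonical young n rho := Group (young_group_set n rho).

Fact sign_subproof n :
  is_class_fun <<[set: 'S_n]>>%g [ffun s : 'S_n => (-1) ^+ odd_perm s : algC].
Proof.
rewrite genGid; apply: intro_class_fun => [s t _ _|s]; last by rewrite inE.
by rewrite odd_permJ.
Qed.
Definition sign_char n : 'CF([set: 'S_n]) := Cfun 0 (sign_subproof n).

(* The irreducible character labelled by rho is the unique common irreducible
   constituent of the representations of S_n induced from the trivial
   representation of the Young subgroup of rho and from the sign representation
   of the Young subgroup of the conjugate of rho.  The value is 0 when no such
   constituent exists (which does not happen for a partition rho of n). *)
Definition chi n (rho : seq nat) : 'CF([set: 'S_n]) :=
  if [pick i : Iirr [set: 'S_n] |
        (i \in irr_constt ('Ind[[set: 'S_n]] (1 : 'CF(young n rho)))) &&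
        (i \in irr_constt ('Ind[[set: 'S_n]]
                 ('Res[young n (conj_part rho)] (sign_char n))))]
  is Some i then 'chi_i else 0.

(* In the two characterisations, (n - |la|, la) is a partition of n (written
   with a zero part when n = 0, which changes neither side). *)
Definition is_stilde (la : intpart) (f : symfun) : Prop :=
  forall (n : nat) (nu : intpart) (s : 'S_n),
    (sumn la + head 0%N la <= n)%N -> cycle_type s = nu ->
    sf_eval f (Xi nu) = chi n ((n - sumn la)%N :: la) s.

Definition is_htilde (hall : symfun -> symfun -> algC)
    (la : intpart) (f : symfun) : Prop :=
  forall (n : nat) (nu : intpart),
    (sumn la + head 0%N la <= n)%N -> sumn nu = n ->
    sf_eval f (Xi nu) = hall (hsym ((n - sumn la)%N :: la)) (psym nu).

(* [a] is the coefficient of [b ga] in an expansion of [f] as a finite linear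
   combination of the family [b]. *)
Definition coef_in (b : intpart -> symfun) (f : symfun) (ga : intpart)
    (a : algC) : Prop :=
  exists c : {fsfun intpart -> algC with 0},
    f = \sum_(nu <- finsupp c) c nu *: b nu /\ c ga = a.

(* (false, j) is the barred letter j and (true, j) the unbarred letter j, for
   j >= 1, so the lexicographic order on pairs is the order of the alphabet.
   A multiset of letters is the weakly decreasing sequence of its elements; the
   reverse lex order on multisets is the lexicographic order on these sequences
   (a proper prefix being smaller). *)
Definition letter := (bool *l nat)%type.
Definition label := seqlexi letter.

Definition letter_ge : rel letter := fun x y => (y <= x)%O.
Definition label_le : rel label := fun M N => (M <= N)%O.
Definition label_lt : rel label := fun M N => (M < N)%O.

Definition barred (x : letter) : bool := ~~ x.1.
Definition unbarred (x : letter) : bool := x.1.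

Definition is_label (M : label) : bool :=
  [&& M != [::], sorted letter_ge M & (count barred M <= 1)%N].

(* Row 1 (bottom) first, each row from left to right.  The row 1 of the shape
   (r, ga)/(ga_1) is stored without its ga_1 missing cells, so that its length
   is r - ga_1; it has no cell in a common column with the rows above it. *)
Definition tableau := seq (seq label).

Definition letters (b : bool) (al : seq nat) : seq letter :=
  flatten (mkseq (fun i => nseq (nth 0%N al i) ((b, i.+1) : letter)) (size al)).

Record is_mct (ga la al : seq nat) (T : tableau) : Prop := IsMCT {
  mct_nonempty : T != [::];
  mct_shape : shape (behead T) = ga;
  mct_labels : all (all is_label) T;
  mct_rows : all (sorted label_le) T;
  mct_cols : forall i j, (j < nth 0%N ga i.+1)%N ->
    label_lt (nth [::] (nth [::] (behead T) i) j)
             (nth [::] (nth [::] (behead T) i.+1) j);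
  mct_content :
    perm_eq (flatten (flatten T)) (letters false la ++ letters true al);
  mct_row1 : all (has unbarred) (head [::] T)
}.

Definition reading (T : tableau) : seq label := flatten (map rev T).

Definition unbarred_part (M : label) : label := filter unbarred M.

(* Each label contributes at most one letter, having at most one barred one. *)
Definition read_word (T : tableau) (S : label) : seq nat :=
  flatten [seq [seq x.2 | x <- filter barred M]
          | M <- reading T & unbarred_part M == S].

Definition unbarred_parts (T : tableau) : seq label :=
  sort label_le (undup [seq S <- map unbarred_part (reading T) | S != [::]]).

Definition lattice_word (w : seq nat) : Prop :=
  forall k j : nat, (0 < j)%N ->
    (count_mem j.+1 (take k w) <= count_mem j (take k w))%N.

Definition is_lattice (T : tableau) : Prop :=
  lattice_word (flatten (map (read_word T) ([::] :: unbarred_parts T))).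

Definition set_label (M : label) : bool :=
  [&& uniq M, (count unbarred M <= 1)%N & (count barred M <= 1)%N].

(* Main.v *)
Require Import Defs.
From mathcomp Require Import all_boot all_order all_fingroup all_algebra.
From mathcomp Require Import all_solvable all_field all_character.
From mathcomp Require Import finmap mpoly boolp zify.

Set Implicit Arguments.
Unset Strict Implicit.
Unset Printing Implicit Defensive.

Import Order.TTheory GRing.Theory Num.Theory.

(* A symmetric function is determined by its values at the multisets [Xi nu] for
   large [|nu|], so it suffices to compare characters of S_n for n large.  Let
   [Fc th s] count the functions from {1..n} to an alphabet that are constant on
   the cycles of s and have content th (this is [<h_th, p_nu>]), and let
   [Xc (shift la)] be the Jacobi-Trudi alternating sum of such counts.  The product of
   [Fc nu] and [Xc (shift la)] is an alternating sum of counts of functions to pairs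
   of letters (k, i), of which the k-content is nu and the i-content is alternated;
   each of these counts is the sum of the [Xc (shift rho)] over the semistandard
   tableaux of shape rho in the alphabet of pairs ordered lexicographically.  A
   Bender-Knuth involution acting after the first violation of the lattice
   condition cancels every tableau that is not a lattice tableau.  For n large the
   first row of a surviving tableau begins with many pairs (0, 0), which stand for
   the empty label; erasing them leaves the tableaux of the theorem.

   The same involution shows that the [Xc] are orthonormal and that [Fc th] is the
   sum of the [Xc] over the tableaux of content th.  Hence each [Xc (shift rho)]
   is an irreducible character, and [chi n rho] is this one: a common constituent
   [Xc (shift si)] of the two induced characters that define [chi n rho] satisfies
   [\sum_i i * si_i = \sum_i i * rho_i], which forces [si = rho]. *)

(** * Toggling a row of a Gelfand-Tsetlin pattern *)

(** A tableau is stored as the array of its multiplicities, the number of entries j in row r. Rows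
    are then weakly increasing by construction, column strictness and the lattice condition are
    inequalities between partial sums, and the Bender-Knuth involution reflects numbers in
    intervals, with no matching of cells. The part of the word up to the first violation must stay
    fixed, and it may end in the middle of a row, whence the parameter [E].

    In a pair (k, i) the value 0 means an absent letter. The theorem imposes nothing on absent
    letters, whereas the array identities treat 0 like any other letter. The bound [3 * s0 < n],
    with s0 the total number of letters, reconciles the two: at most s0 cells lie above the first
    row and at most s0 cells of the first row carry letters, so more than s0 empty labels remain
    there, and the inequalities involving the letter 0 hold by size. The exception is the start of
    the word, where nothing has been read: there the lattice condition forbids the pairs (0, i) with
    i > 0 in the first row, which is the condition on row 1 in the theorem. *)

Section Toggle.

Variables (R : nat) (al be ga : nat -> nat).

(** Read [al r], [be r], [ga r] as the numbers of entries of row r below j, j + 1 and j + 2. Then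
    [tlo r] and [thi r] are the extreme values of [be r] that column strictness allows when the
    other two are fixed; the last row has no row above it and row 0 none below. *)
Definition tlo r := if r.+1 < R then maxn (al r) (ga r.+1) else al r.
Definition thi r := if r is r'.+1 then minn (ga r) (al r') else ga 0.

Definition interlaced (b : nat -> nat) := forall r, r < R -> tlo r <= b r <= thi r.

(** The Bender-Knuth reflection of [be r] in [[tlo r, thi r]], applied to the rows from [t] on. In
    row [t] the last [E] letters j + 1 are held fixed, so the interval of reflection there ends at
    [ga t - E]; [toggle_ok] says that it contains [be t] and does not pass [thi t]. *)
Definition toggle (t E r : nat) :=
  if r < t then be r
  else if r == t then ga t + tlo t - E - be t
  else tlo r + thi r - be r.

Definition toggle_ok (t E : nat) :=
  [/\ t < R, be t + E <= ga t & ga t <= thi t + E].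

Lemma thi_ga r : thi r <= ga r.
Proof. by case: r => //= r; apply: geq_minl. Qed.

Lemma al_tlo r : al r <= tlo r.
Proof. by rewrite /tlo; case: ifP => // _; apply: leq_maxl. Qed.

Lemma toggle_interlaced t E :
  interlaced be -> toggle_ok t E -> interlaced (toggle t E).
Proof.
move=> bP [tR h1 h2] r rR; have := bP _ rR; have := bP _ tR.
rewrite /toggle; case: ltnP => // _; case: eqP => [->|_]; lia.
Qed.

(** The sum telescopes because [tlo r + thi r.+1] is a maximum plus a minimum of the same two
    numbers [al r] and [ga r.+1]. *)
Lemma tlo_thi_sum t : t < R ->
  \sum_(t <= r < R) (tlo r + thi r) + ga t =
  thi t + \sum_(t <= r < R) (al r + ga r).
Proof.
move=> tR; move eqd: (R - t.+1) => d.
elim: d t tR eqd => [|d IH] t tR eqd.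
  have -> : R = t.+1 by lia.
  by rewrite !big_nat1 /tlo; case: ifP; lia.
have tR' : t.+1 < R by lia.
have := IH _ tR'; rewrite !(big_ltn tR).
set S1 := \sum_(t.+1 <= r < R) _; set S2 := \sum_(t.+1 <= r < R) _.
rewrite [tlo t]/tlo [thi t.+1]/= tR' => /(_ ltac:(lia)); lia.
Qed.

(** Subtracting the sum of [al] and that of [be]: from row [t] on, the letters j after the toggle
    are as many as the letters j + 1 before it, less [E]. *)
Lemma toggle_sum t E : interlaced be -> toggle_ok t E ->
  \sum_(t <= r < R) toggle t E r + \sum_(t <= r < R) be r + E =
  \sum_(t <= r < R) (al r + ga r).
Proof.
move=> bP [tR h1 h2]; rewrite -big_split /= !(big_ltn tR).
rewrite [in toggle _ _ t]/toggle ltnn eqxx.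
have -> : \sum_(t.+1 <= r < R) (toggle t E r + be r) =
  \sum_(t.+1 <= r < R) (tlo r + thi r).
  apply: eq_big_nat => r /andP[tr rR]; rewrite /toggle.
  by rewrite ltnNge (ltnW tr) gtn_eqF //=; have := bP _ rR; lia.
have bt := bP _ tR.
have [tR'|tR'] := ltnP t.+1 R; last first.
  rewrite !big_geq // /tlo ltnNge tR' /=; move: bt; rewrite /tlo ltnNge tR' /=; lia.
have := tlo_thi_sum tR'.
set S1 := \sum_(t.+1 <= r < R) _; set S2 := \sum_(t.+1 <= r < R) _.
move: bt; rewrite [tlo t]/tlo [thi t.+1]/= tR'; lia.
Qed.

End Toggle.

Lemma toggleK R al be ga t E : interlaced R al ga be ->
  toggle_ok R al be ga t E ->
  forall r, r < R ->
  toggle R al (toggle R al be ga t E) ga t E r = be r.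
Proof.
move=> bP [tR h1 h2] r rR; have := bP _ rR; have := bP _ tR.
rewrite {1}/toggle; case: ltnP => [rt|tr]; first by rewrite /toggle rt.
case: eqP => [->|neq]; rewrite /toggle.
  rewrite ltnn eqxx; lia.
by rewrite ltnNge tr /=; case: eqP => // _; lia.
Qed.

Lemma toggle_okK R al be ga t E : interlaced R al ga be ->
  toggle_ok R al be ga t E ->
  toggle_ok R al (toggle R al be ga t E) ga t E.
Proof.
move=> bP [tR h1 h2]; split=> //; have := bP _ tR.
by rewrite /toggle ltnn eqxx; lia.
Qed.

Lemma mul_add_lt L N k i : k < L -> i < N -> k * N + i < L * N.
Proof.
move=> kL iN; have : k.+1 * N <= L * N by rewrite leq_mul2r kL orbT.
by rewrite mulSn; lia.
Qed.

Lemma col_split L N j : j < L * N ->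
  exists k i, [/\ k < L, i < N & j = k * N + i].
Proof.
move=> jM; have N0 : 0 < N by case: N jM => //; rewrite muln0.
exists (j %/ N), (j %% N); rewrite -divn_eq ltn_mod N0; split=> //.
by rewrite ltn_divLR.
Qed.

(** * The lattice condition on multiplicities, and the flip of two adjacent letters *)

Section Patterns.

Variables (R L N : nat) (v : nat -> nat -> nat).

(** With [v r j] the multiplicity of j in row r, this counts the entries of row r smaller than j;
    these counts form a Gelfand-Tsetlin pattern. *)
Definition pre r j := \sum_(0 <= j' < j) v r j'.

Definition ssyt_fun := forall r j, r.+1 < R -> j < L * N -> pre r.+1 j.+1 <= pre r j.

(** The letter [k * N + i] codes the pair (k, i). The word is read group by group (k), inside a
    group from the bottom row up; this is the number of letters i met before row r of group k. *)
Definition lat_height k r i :=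
  \sum_(0 <= k' < k) \sum_(0 <= r' < R) v r' (k' * N + i)
  + \sum_(0 <= r' < r) v r' (k * N + i).

(** A row is read from right to left, so its letters i + 1 precede its letters i. The critical
    prefix ends after the last i + 1 of row r, when no i of that row has been read. *)
Definition lat_bad k r i := lat_height k r i < lat_height k r.+1 i.+1.

Lemma preS r j : pre r j.+1 = pre r j + v r j.
Proof. by rewrite /pre big_nat_recr. Qed.

Lemma pre_mono r j j' : j <= j' -> pre r j <= pre r j'.
Proof.
move=> jj'; rewrite /pre (@big_cat_nat _ _ _ j 0 j') //=; exact: leq_addr.
Qed.

Lemma lat_heightS k r i :
  lat_height k r.+1 i = lat_height k r i + v r (k * N + i).
Proof. by rewrite /lat_height big_nat_recr //= addnA. Qed.

Lemma lat_height_next k i : lat_height k R i = lat_height k.+1 0 i.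
Proof. by rewrite /lat_height big_nat_recr //= [in RHS]big_nil addn0. Qed.

Lemma pre_group r k :
  pre r (k * N) + \sum_(0 <= i < N) v r (k * N + i) = pre r (k.+1 * N).
Proof.
rewrite /pre (@big_cat_nat _ _ _ (k * N) 0 (k.+1 * N)) //= ?leq_mul2r ?leqnSn ?orbT //.
congr (_ + _); rewrite -{2}[k * N]addn0 mulSn addnC big_addn.
by rewrite addnK; apply: eq_bigr => i _; rewrite addnC.
Qed.

Lemma sum_groups r K :
  \sum_(0 <= k < K) \sum_(0 <= i < N) v r (k * N + i) = pre r (K * N).
Proof.
elim: K => [|K IHK]; first by rewrite /pre !big_nil.
by rewrite big_nat_recr //= IHK pre_group.
Qed.

Definition pal i0 k r := pre r (k * N + i0).
Definition pbe i0 k r := pre r (k * N + i0).+1.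
Definition pga i0 k r := pre r (k * N + i0).+2.

Lemma ssyt_interlaced i0 k : ssyt_fun -> i0.+1 < N -> k < L ->
  interlaced R (pal i0 k) (pga i0 k) (pbe i0 k).
Proof.
move=> sP i0N kL r rR; have jM : (k * N + i0).+1 < L * N.
  have : k.+1 * N <= L * N by rewrite leq_mul2r kL orbT.
  by rewrite mulSn; lia.
have m1 := @pre_mono r _ _ (leqnSn (k * N + i0)).
have m2 := @pre_mono r _ _ (leqnSn (k * N + i0).+1).
apply/andP; split.
  rewrite /tlo; case: ifP => // rR'; rewrite geq_max m1 /=.
  exact: sP.
case: r rR m1 m2 => [|r] rR m1 m2 //=; rewrite leq_min m2 /=.
by apply: sP => //; exact: ltnW.
Qed.

Variables (k0 r0 i0 E : nat).

(** Only the boundary between [i0] and [i0.+1] moves, in every group. Groups read before [k0] stay,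
    group [k0] is toggled from row [r0] on with [E] letters kept, and later groups are toggled
    entirely. *)
Definition flip_row k r :=
  if k < k0 then pbe i0 k r
  else if k == k0 then toggle R (pal i0 k) (pbe i0 k) (pga i0 k) r0 E r
  else toggle R (pal i0 k) (pbe i0 k) (pga i0 k) 0 0 r.

Definition flip_pre r j :=
  if j %% N == i0.+1 then flip_row (j %/ N) r else pre r j.

Definition flip r j := flip_pre r j.+1 - flip_pre r j.

Hypothesis i0N : i0.+1 < N.

Lemma flip_preE r k i : i < N -> flip_pre r (k * N + i) =
  if i == i0.+1 then flip_row k r else pre r (k * N + i).
Proof.
by move=> iN; rewrite /flip_pre modnMDl modn_small // divnMDl ?divn_small ?addn0 //; lia.
Qed.

Lemma flip_preSE r k i : i < N -> flip_pre r (k * N + i).+1 =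
  if i == i0 then flip_row k r else pre r (k * N + i).+1.
Proof.
move=> iN; rewrite -addnS; have [iN'|iN'] := ltnP i.+1 N.
  by rewrite flip_preE // eqSS.
have -> : k * N + i.+1 = k.+1 * N + 0 by rewrite mulSn; lia.
rewrite flip_preE; last by lia.
by have -> : i == i0 = false by lia.
Qed.

Hypotheses (vP : ssyt_fun) (k0L : k0 < L)
  (ok0 : toggle_ok R (pal i0 k0) (pbe i0 k0) (pga i0 k0) r0 E).

Lemma toggle_ok00 k : toggle_ok R (pal i0 k) (pbe i0 k) (pga i0 k) 0 0.
Proof.
by split=> //=; rewrite ?addn0 //; [case: ok0 => h _ _; exact: leq_ltn_trans h | apply: pre_mono].
Qed.

Lemma flip_row_interlaced k : k < L ->
  interlaced R (pal i0 k) (pga i0 k) (flip_row k).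
Proof.
move=> kL r rR; have iP := ssyt_interlaced vP i0N kL.
rewrite /flip_row; case: ltnP => _; first exact: iP.
case: eqP => [e|_]; apply: toggle_interlaced => //; first by rewrite e.
exact: toggle_ok00.
Qed.

Lemma flip_row_bounds k r : k < L -> r < R ->
  pal i0 k r <= flip_row k r <= pga i0 k r.
Proof.
move=> kL rR; have /andP[h1 h2] := flip_row_interlaced kL rR.
rewrite (leq_trans (al_tlo _ _ _ _) h1) /=.
exact: leq_trans h2 (thi_ga _ _ _).
Qed.

Lemma flip_pre_mono r j : r < R -> j < L * N -> flip_pre r j <= flip_pre r j.+1.
Proof.
move=> rR /col_split[k [i [kL iN ->]]].
rewrite flip_preE // flip_preSE //; have := flip_row_bounds kL rR.
rewrite /pal /pga; case: eqP => [->|ne1]; case: eqP => [e|ne2].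
- lia.
- by move=> /andP[_]; rewrite addnS.
- by subst i => /andP[].
- by move=> _; apply: pre_mono.
Qed.

Lemma pre_flip r j : r < R -> j <= L * N ->
  \sum_(0 <= j' < j) flip r j' = flip_pre r j.
Proof.
move=> rR; elim: j => [|j IH] jM.
  by rewrite big_nil /flip_pre mod0n /= /pre big_nil.
rewrite big_nat_recr //= IH ?(ltnW jM) // /flip.
by rewrite subnKC // flip_pre_mono.
Qed.

Lemma flip_same r k i : i < N -> i != i0 -> i != i0.+1 ->
  flip r (k * N + i) = v r (k * N + i).
Proof.
move=> iN /negbTE n1 /negbTE n2.
by rewrite /flip flip_preE // flip_preSE // n1 n2 preS addKn.
Qed.

Lemma flip_i0 r k : k < L -> r < R ->
  flip r (k * N + i0) + pre r (k * N + i0) = flip_row k r.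
Proof.
move=> kL rR; rewrite /flip flip_preE ?flip_preSE; try lia.
have := flip_row_bounds kL rR; rewrite eqxx /pal.
have -> : i0 == i0.+1 = false by lia.
lia.
Qed.

Lemma flip_i1 r k : k < L -> r < R ->
  flip r (k * N + i0.+1) + flip_row k r = pre r (k * N + i0).+2.
Proof.
move=> kL rR; rewrite /flip flip_preE ?flip_preSE; try lia.
have := flip_row_bounds kL rR; rewrite eqxx /pga.
have -> : i0.+1 == i0 = false by lia.
by rewrite addnS; lia.
Qed.

Lemma flip_pair r k : k < L -> r < R ->
  flip r (k * N + i0) + flip r (k * N + i0.+1) =
  v r (k * N + i0) + v r (k * N + i0.+1).
Proof.
move=> kL rR; have := flip_i0 kL rR; have := flip_i1 kL rR.
by rewrite !preS addnS; lia.
Qed.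

Lemma flip_before k r i : i < N -> k < L -> r < R ->
  (k < k0) || (k == k0) && (r < r0) ->
  flip r (k * N + i) = v r (k * N + i).
Proof.
move=> iN kL rR h.
have e : flip_row k r = pre r (k * N + i0).+1.
  rewrite /flip_row; case: ltnP h => //= _ /andP[/eqP -> rr0].
  by rewrite eqxx /toggle rr0.
have [->|n0] := eqVneq i i0.
  by have := flip_i0 kL rR; rewrite e preS; lia.
have [->|n1] := eqVneq i i0.+1; last exact: flip_same.
by have := flip_i1 kL rR; rewrite e [pre r (k * N + i0).+2]preS addnS; lia.
Qed.

Lemma sum_flip_after k : k < L -> k0 < k ->
  \sum_(0 <= r < R) flip r (k * N + i0) =
  \sum_(0 <= r < R) v r (k * N + i0.+1).
Proof.
move=> kL kk0; have iP := ssyt_interlaced vP i0N kL.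
have := toggle_sum iP (toggle_ok00 k).
have -> : \sum_(0 <= r < R) toggle R (pal i0 k) (pbe i0 k) (pga i0 k) 0 0 r =
  \sum_(0 <= r < R) (flip r (k * N + i0) + pal i0 k r).
  apply: eq_big_nat => r /andP[_ rR]; rewrite flip_i0 // /flip_row.
  by rewrite ltnNge (ltnW kk0) gtn_eqF.
have -> : \sum_(0 <= r < R) (pal i0 k r + pga i0 k r) =
  \sum_(0 <= r < R) (pal i0 k r + (pbe i0 k r + v r (k * N + i0.+1))).
  apply: eq_bigr => r _; rewrite /pga preS addnS //.
by rewrite !big_split /=; lia.
Qed.

Lemma sum_flip_at :
  \sum_(r0 <= r < R) flip r (k0 * N + i0) + E =
  \sum_(r0 <= r < R) v r (k0 * N + i0.+1).
Proof.
have iP := ssyt_interlaced vP i0N k0L.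
have := toggle_sum iP ok0.
have -> : \sum_(r0 <= r < R) toggle R (pal i0 k0) (pbe i0 k0) (pga i0 k0) r0 E r =
  \sum_(r0 <= r < R) (flip r (k0 * N + i0) + pal i0 k0 r).
  apply: eq_big_nat => r /andP[_ rR]; rewrite flip_i0 // /flip_row.
  by rewrite ltnn eqxx.
have -> : \sum_(r0 <= r < R) (pal i0 k0 r + pga i0 k0 r) =
  \sum_(r0 <= r < R) (pal i0 k0 r + (pbe i0 k0 r + v r (k0 * N + i0.+1))).
  by apply: eq_bigr => r _; rewrite /pga preS addnS.
by rewrite !big_split /=; lia.
Qed.

End Patterns.

Lemma eq_pre v v' r j : (forall j', j' < j -> v r j' = v' r j') ->
  pre v r j = pre v' r j.
Proof. by move=> h; apply: eq_big_nat => j' /andP[_]; apply: h. Qed.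

Lemma eq_toggle R al be ga al' be' ga' t E r : t < R -> r < R ->
  (forall s, s < R -> [/\ al s = al' s, be s = be' s & ga s = ga' s]) ->
  toggle R al be ga t E r = toggle R al' be' ga' t E r.
Proof.
move=> tR rR h.
have elo s : s < R -> tlo R al ga s = tlo R al' ga' s.
  move=> sR; rewrite /tlo; have [-> _ _] := h _ sR.
  by case: ltnP => // sR'; have [_ _ ->] := h _ sR'.
have ehi s : s < R -> thi al ga s = thi al' ga' s.
  case: s => [|s] sR /=; have [_ _ ->] := h _ sR => //.
  by have [-> _ _] := h _ (ltnW sR).
rewrite /toggle elo // elo // ehi //.
by have [_ -> _] := h _ rR; have [_ -> ->] := h _ tR.
Qed.

(** The order of reading; within a row the larger letters come first, hence [i0 < i]. *)
Definition lat_earlier (k0 r0 i0 k r i : nat) :=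
  (k < k0) || ((k == k0) && ((r < r0) || ((r == r0) && (i0 < i)))).

(** * The flip at the first violation of the lattice condition *)

Section FirstViolation.

Variables (R L N : nat) (v : nat -> nat -> nat) (k0 r0 i0 : nat).

Record lat_first : Prop := LatFirst {
  lat_first_k : k0 < L;
  lat_first_r : r0 < R;
  lat_first_i : i0.+1 < N;
  lat_first_bad : lat_bad R N v k0 r0 i0;
  lat_first_min : forall k r i, k < L -> r < R -> i.+1 < N ->
    lat_earlier k0 r0 i0 k r i -> ~~ lat_bad R N v k r i
}.

(** The number of letters [i0.+1] of row [r0] that are read until [i0.+1] leads [i0] by exactly one.
    These are the letters that the flip keeps. *)
Definition lat_gap :=
  (lat_height R N v k0 r0 i0).+1 - lat_height R N v k0 r0 i0.+1.

Hypotheses (vP : ssyt_fun R L N v) (vF : lat_first).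

Let k0L := lat_first_k vF.
Let r0R := lat_first_r vF.
Let i0N := lat_first_i vF.
Let bad := lat_first_bad vF.
Let mini := lat_first_min vF.

Lemma lat_first_prev r : r0 = r.+1 ->
  lat_height R N v k0 r0 i0.+1 <= lat_height R N v k0 r i0.
Proof.
move=> er; rewrite er leqNgt; apply: mini => //; try lia.
by rewrite /lat_earlier; lia.
Qed.

(** It makes the subtraction in [lat_gap] exact and the gap positive. For [r0 = 0] the preceding
    place in the reading is the last row of the preceding group. *)
Lemma lat_first_le : lat_height R N v k0 r0 i0.+1 <= lat_height R N v k0 r0 i0.
Proof.
case er: r0 => [|r]; last first.
  rewrite -er; apply: leq_trans (lat_first_prev er) _.
  by rewrite er lat_heightS leq_addr.
case ek: k0 => [|k]; first by rewrite /lat_height !big_nil.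
rewrite -!lat_height_next; have RE : R = R.-1.+1 by lia.
have : ~~ lat_bad R N v k R.-1 i0.
  by apply: mini => //; try lia; rewrite /lat_earlier; lia.
rewrite /lat_bad -leqNgt -RE => /leq_trans; apply.
by have := lat_heightS R N v k R.-1 i0; rewrite -RE => ->; apply: leq_addr.
Qed.

Lemma lat_first_ok :
  toggle_ok R (pal N v i0 k0) (pbe N v i0 k0) (pga N v i0 k0) r0 lat_gap.
Proof.
have le := lat_first_le; have iP := ssyt_interlaced vP i0N k0L.
split=> //; rewrite /lat_gap.
  rewrite /pbe /pga [X in _ <= X]preS -addnS.
  by move: bad; rewrite /lat_bad lat_heightS; lia.
case er: r0 => [|r]; first by rewrite /= leq_addr.
have h1 := lat_first_prev er.
have h2 : lat_height R N v k0 r0 i0 =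
    lat_height R N v k0 r i0 + v r (k0 * N + i0) by rewrite er lat_heightS.
have h3 : pbe N v i0 k0 r = pal N v i0 k0 r + v r (k0 * N + i0).
  by rewrite /pbe preS.
(* Column strictness bounds [pga] in row [r0] by [pbe] in row r, which is [pal] there plus the
   number of letters [i0] of that row. Since row r is not a violation, the gap exceeds this number,
   which is what [toggle_ok] asks. *)
have h4 : pga N v i0 k0 r0 <= pbe N v i0 k0 r.
  rewrite er; apply: vP; first by rewrite -er.
  have : k0.+1 * N <= L * N by rewrite leq_mul2r k0L orbT.
  by rewrite mulSn; lia.
by rewrite /= -er; lia.
Qed.

Let E := lat_gap.
Let v' := flip R N v k0 r0 i0 E.
Let okE := lat_first_ok.

Lemma flip_pre_correct r j : r < R -> j <= L * N ->
  pre v' r j = flip_pre R N v k0 r0 i0 E r j.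
Proof. exact: (pre_flip i0N vP k0L okE). Qed.

Lemma flip_ssyt : ssyt_fun R L N v'.
Proof.
move=> r j rR jM; rewrite !flip_pre_correct //; try lia.
case: (col_split jM) => k [i [kL iN ej]]; subst j.
rewrite flip_preSE // flip_preE //.
have := flip_row_interlaced i0N vP okE kL.
case: eqP => [->|ni0].
  have -> : i0 == i0.+1 = false by lia.
  by move/(_ _ rR) => /= ; rewrite leq_min => /andP[_ /andP[]].
case: eqP => [->|ni1].
  move=> /(_ _ (ltnW rR)) /andP[+ _]; rewrite /tlo rR geq_max => /andP[_].
  by rewrite /pga -addnS.
by move=> _; apply: vP.
Qed.

Lemma flip_pre_mul r k : r < R -> k <= L -> pre v' r (k * N) = pre v r (k * N).
Proof.
move=> rR kL; rewrite flip_pre_correct ?leq_mul2r ?kL ?orbT //.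
by rewrite -[k * N]addn0 flip_preE //; lia.
Qed.

Lemma flip_group r k : r < R -> k < L ->
  \sum_(0 <= i < N) v' r (k * N + i) = \sum_(0 <= i < N) v r (k * N + i).
Proof.
move=> rR kL; have := pre_group N v' r k; rewrite !flip_pre_mul // 1?ltnW //.
by rewrite -pre_group; lia.
Qed.

Lemma flip_bound r j : r < R -> j < L * N -> v' r j <= pre v r (L * N).
Proof.
move=> rR jM; rewrite -flip_pre_mul //.
apply: leq_trans (pre_mono v' r jM); rewrite preS; exact: leq_addl.
Qed.

Lemma flip_height k r i : i < N -> r <= R ->
  (k < k0) || (k == k0) && (r <= r0) ->
  lat_height R N v' k r i = lat_height R N v k r i.
Proof.
move=> iN rR h; rewrite /lat_height; congr (_ + _).
  apply: eq_big_nat => k' /andP[_ kk]; apply: eq_big_nat => r' /andP[_ rr].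
  by apply: (flip_before i0N vP k0L okE) => //; lia.
apply: eq_big_nat => r' /andP[_ rr].
by apply: (flip_before i0N vP k0L okE) => //; lia.
Qed.

(** The gap depends only on what is read before row [r0] of group [k0], which the flip leaves alone;
    a second flip thus uses the same [E]. *)
Lemma flip_gap : 
  (lat_height R N v' k0 r0 i0).+1 - lat_height R N v' k0 r0 i0.+1 = E.
Proof. by rewrite !flip_height //; lia. Qed.

Definition xcont (w : nat -> nat -> nat) i :=
  \sum_(0 <= k < L) \sum_(0 <= r < R) w r (k * N + i).

Lemma xcont_height w k r i : k < L -> r <= R ->
  xcont w i = lat_height R N w k r i + \sum_(r <= r' < R) w r' (k * N + i)
  + \sum_(k.+1 <= k' < L) \sum_(0 <= r' < R) w r' (k' * N + i).
Proof.
move=> kL rR; rewrite /xcont (@big_cat_nat _ _ _ k 0 L) ?(ltnW kL) //=.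
rewrite (big_ltn kL) (@big_cat_nat _ _ _ r 0 R) //= /lat_height.
by rewrite !addnA.
Qed.

Lemma flip_xcont_other i : i < N -> i != i0 -> i != i0.+1 ->
  xcont v' i = xcont v i.
Proof.
by move=> iN n0 n1; apply: eq_bigr => k _; apply: eq_bigr => r _; apply: flip_same.
Qed.

(** Through the violation [i0.+1] leads [i0] by one, and after it the flip exchanges the numbers of
    the two letters. Together with [flip_xcont1], this exchanges two consecutive entries of the
    content shifted by delta. *)
Lemma flip_xcont0 : (xcont v' i0).+1 = xcont v i0.+1.
Proof.
rewrite !(xcont_height _ _ k0L (ltnW r0R)) flip_height; try lia.
have e1 := sum_flip_at i0N vP k0L okE.
have e2 : \sum_(k0.+1 <= k < L) \sum_(0 <= r < R) v' r (k * N + i0) =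
  \sum_(k0.+1 <= k < L) \sum_(0 <= r < R) v r (k * N + i0.+1).
  apply: eq_big_nat => k /andP[kk kL].
  exact: (sum_flip_after i0N vP k0L okE).
rewrite e2 -e1 -/v' /E /lat_gap; have := lat_first_le; lia.
Qed.

Lemma flip_xcont1 : xcont v' i0.+1 = (xcont v i0).+1.
Proof.
have : xcont v' i0 + xcont v' i0.+1 = xcont v i0 + xcont v i0.+1.
  rewrite /xcont -!big_split /=; apply: eq_big_nat => k /andP[_ kL].
  rewrite -!big_split /=; apply: eq_big_nat => r /andP[_ rR].
  exact: (flip_pair i0N vP k0L okE).
by have := flip_xcont0; lia.
Qed.

Lemma flip_first : lat_bad R N v' k0 r0 i0 /\
  (forall k r i, k < L -> r < R -> i.+1 < N ->
    lat_earlier k0 r0 i0 k r i -> ~~ lat_bad R N v' k r i).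
Proof.
split=> [|k r i kL rR iN]; rewrite /lat_bad.
  rewrite lat_heightS !flip_height //; try lia.
  have [_ + _] := toggle_okK (ssyt_interlaced vP i0N k0L) okE.
  have := flip_i1 i0N vP k0L okE k0L r0R.
  rewrite -/v' /flip_row ltnn eqxx /pga.
  have : E = (lat_height R N v k0 r0 i0).+1 - lat_height R N v k0 r0 i0.+1 by [].
  rewrite -/E; lia.
rewrite /lat_earlier => h.
have := mini kL rR iN h; rewrite /lat_bad.
rewrite (flip_height (ltnW iN) (ltnW rR)); last lia.
case: (boolP ((k < k0) || (k == k0) && (r < r0))) => [h'|nh].
  by rewrite flip_height //; lia.
(* At the place of the violation itself only larger letters remain: the row contributes its letters
   [i.+1], and [i.+1 > i0.+1], so their number has not changed. *)
have [ek er ii] : [/\ k = k0, r = r0 & i0 < i] by split; lia.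
rewrite !lat_heightS flip_height ?(ltnW rR) //; last lia.
by rewrite /v' flip_same //; lia.
Qed.

Lemma flipK r j : r < R -> j < L * N -> flip R N v' k0 r0 i0 E r j = v r j.
Proof.
have K s l : s < R -> l <= L * N -> flip_pre R N v' k0 r0 i0 E s l = pre v s l.
  move=> sR; rewrite leq_eqVlt => /orP[/eqP->|lM].
    have N0 : 0 < N by lia.
    by rewrite -[L * N]addn0 flip_preE //= addn0 flip_pre_mul.
  case: (col_split lM) => k [i [kL iN el]]; subst l.
  rewrite flip_preE //.
  have al s' : s' < R -> pal N v' i0 k s' = pal N v i0 k s'.
    move=> s'R; rewrite /pal flip_pre_correct ?flip_preE //; try lia.
      by have -> : i0 == i0.+1 = false by lia.
    by have := mul_add_lt kL i0N; lia.
  have ga s' : s' < R -> pga N v' i0 k s' = pga N v i0 k s'.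
    move=> s'R; rewrite /pga -addnS flip_pre_correct ?flip_preSE //.
      by have -> : i0.+1 == i0 = false by lia.
    by have := mul_add_lt kL i0N; lia.
  have be s' : s' < R -> pbe N v' i0 k s' = flip_row R N v k0 r0 i0 E k s'.
    move=> s'R; rewrite /pbe flip_pre_correct ?flip_preSE ?eqxx //; first lia.
    by have := mul_add_lt kL i0N; lia.
  case: eqP => [->|ni]; last first.
    by rewrite flip_pre_correct ?flip_preE ?(ltnW lM) //; case: eqP.
  have iP := ssyt_interlaced vP i0N kL.
  have ok00 := toggle_ok00 okE k.
  rewrite addnS -[pre v s _]/(pbe N v i0 k s) /flip_row.
  have [kk|kk] := ltnP k k0; first by rewrite be // /flip_row kk.
  have R0 : 0 < R by lia.
  case: eqP => [ek|nk].
    rewrite (eq_toggle (al' := pal N v i0 k) (ga' := pga N v i0 k)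
      (be' := flip_row R N v k0 r0 i0 E k)) //; last by move=> s' s'R; split; auto.
    rewrite (eq_toggle (al' := pal N v i0 k) (ga' := pga N v i0 k)
      (be' := toggle R (pal N v i0 k) (pbe N v i0 k) (pga N v i0 k) r0 E)) //.
      by apply: toggleK => //; rewrite ek.
    by move=> s' s'R; rewrite /flip_row ltnNge kk /= ek eqxx.
  rewrite (eq_toggle (al' := pal N v i0 k) (ga' := pga N v i0 k)
    (be' := flip_row R N v k0 r0 i0 E k)) //; last by move=> s' s'R; split; auto.
  rewrite (eq_toggle (al' := pal N v i0 k) (ga' := pga N v i0 k)
    (be' := toggle R (pal N v i0 k) (pbe N v i0 k) (pga N v i0 k) 0 0)) //.
    exact: toggleK.
  by move=> s' s'R; rewrite /flip_row ltnNge kk /=; case: eqP nk.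
move=> rR jM; rewrite {1}/flip !K ?(ltnW jM) // preS; lia.
Qed.

End FirstViolation.

(** * Finite arrays of multiplicities and the sign-reversing involution on them *)

Section Arrays.

Variables R M B : nat.

(** The bound [B] on the entries makes this a finite type, so that sums over tableaux are finite
    sums. *)
Definition arr := {ffun 'I_R * 'I_M -> 'I_B.+1}.

Definition av (c : arr) (r j : nat) : nat :=
  if insub r is Some r' then if insub j is Some j' then c (r', j') else 0 else 0.

Definition mkarr (v : nat -> nat -> nat) : arr :=
  [ffun p => inord (v (val p.1) (val p.2))].

Lemma avE (c : arr) (r : 'I_R) (j : 'I_M) : av c r j = c (r, j).
Proof. by rewrite /av !valK. Qed.

Lemma av_mkarr v r j : r < R -> j < M -> v r j <= B -> av (mkarr v) r j = v r j.
Proof.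
move=> rR jM vB; rewrite (avE _ (Ordinal rR) (Ordinal jM)) ffunE /=.
by rewrite inordK.
Qed.

Lemma av_leB c r j : av c r j <= B.
Proof.
rewrite /av; case: insubP => // r' _ _; case: insubP => // j' _ _.
by rewrite -ltnS ltn_ord.
Qed.

Lemma av_out_col c r j : M <= j -> av c r j = 0.
Proof. by move=> jM; rewrite /av; case: insub => // r'; rewrite insubN // -leqNgt. Qed.

Lemma av_out_row c r j : R <= r -> av c r j = 0.
Proof. by move=> rR; rewrite /av insubN // -leqNgt. Qed.

Lemma arr_ext (c d : arr) :
  (forall r j, r < R -> j < M -> av c r j = av d r j) -> c = d.
Proof.
move=> h; apply/ffunP => -[r j]; apply: val_inj => /=.
by rewrite -!avE; apply: h.
Qed.

Definition ssyt (c : arr) :=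
  [forall r : 'I_R, forall j : 'I_M,
    (r.+1 < R) ==> (pre (av c) r.+1 j.+1 <= pre (av c) r j)].

Lemma ssytP c : reflect (forall r j, r.+1 < R -> j < M ->
  pre (av c) r.+1 j.+1 <= pre (av c) r j) (ssyt c).
Proof.
apply: (iffP forallP) => [h r j rR jM|h r].
  by have /forallP/(_ (Ordinal jM))/implyP/(_ rR) := h (Ordinal (ltnW rR)).
by apply/forallP => j; apply/implyP => rR; apply: h.
Qed.

Definition rowsum (c : arr) r := pre (av c) r M.
Definition colsum (c : arr) j := \sum_(0 <= r < R) av c r j.

End Arrays.

Section LatticeArrays.

Variables R L N B : nat.
Implicit Type c : arr R (L * N) B.

Definition latt c := [forall k : 'I_L, forall r : 'I_R, forall i : 'I_N,
  (i.+1 < N) ==> ~~ lat_bad R N (av c) k r i].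

Lemma lattP c : reflect (forall k r i, k < L -> r < R -> i.+1 < N ->
  lat_height R N (av c) k r.+1 i.+1 <= lat_height R N (av c) k r i) (latt c).
Proof.
apply: (iffP forallP) => [h k r i kL rR iN|h k].
  have /forallP/(_ (Ordinal rR))/forallP/(_ (Ordinal (ltnW iN))) := h (Ordinal kL).
  by move/implyP/(_ iN); rewrite /lat_bad -leqNgt.
apply/forallP => r; apply/forallP => i; apply/implyP => iN.
by rewrite /lat_bad -leqNgt; apply: h.
Qed.

Definition zcont c k := \sum_(0 <= r < R) \sum_(0 <= i < N) av c r (k * N + i).
Definition xcnt c i := xcont R L N (av c) i.

Definition firstb c (x : 'I_L * 'I_R * 'I_N) :=
  [&& x.2.+1 < N, lat_bad R N (av c) x.1.1 x.1.2 x.2 &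
   [forall k : 'I_L, forall r : 'I_R, forall i : 'I_N,
     ((i.+1 < N) && lat_earlier x.1.1 x.1.2 x.2 k r i) ==>
     ~~ lat_bad R N (av c) k r i]].

Lemma firstP c (x : 'I_L * 'I_R * 'I_N) :
  reflect (lat_first R L N (av c) x.1.1 x.1.2 x.2) (firstb c x).
Proof.
case: x => [[k0 r0] i0] /=; apply: (iffP and3P) => [[h1 h2 h3]|[_ _ h1 h2 h3]].
  split=> // k r i kL rR iN e.
  move/forallP/(_ (Ordinal kL))/forallP/(_ (Ordinal rR)): h3.
  by move/forallP/(_ (Ordinal (ltnW iN)))/implyP; apply; rewrite iN.
split=> //; apply/forallP => k; apply/forallP => r; apply/forallP => i.
by apply/implyP => /andP[iN e]; apply: h3.
Qed.

Lemma first_uniq c x y : firstb c x -> firstb c y -> x = y.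
Proof.
move=> /firstP[] kx rx ix bx mx /firstP[] ky ry iy by_ my.
have ex : lat_earlier y.1.1 y.1.2 y.2 x.1.1 x.1.2 x.2 = false.
  by apply/negbTE/negP => e; have := my _ _ _ kx rx ix e; rewrite bx.
have ey : lat_earlier x.1.1 x.1.2 x.2 y.1.1 y.1.2 y.2 = false.
  by apply/negbTE/negP => e; have := mx _ _ _ ky ry iy e; rewrite by_.
case: x y ex ey {kx rx ix bx mx ky ry iy by_ my} => [[k r] i] [[k' r'] i'] /=.
rewrite /lat_earlier => ex ey.
have ek : k = k' by apply: val_inj => /=; lia.
have er : r = r' by apply: val_inj => /=; lia.
have ei : i = i' by apply: val_inj => /=; lia.
by rewrite ek er ei.
Qed.

Lemma first_ex c : ~~ latt c -> exists x, firstb c x.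
Proof.
move=> nl.
pose bad (x : 'I_L * 'I_R * 'I_N) := (x.2.+1 < N) && lat_bad R N (av c) x.1.1 x.1.2 x.2.
(* A numbering of the triples that increases along the reading: by group, then by row, then by
   decreasing letter. *)
pose code (x : 'I_L * 'I_R * 'I_N) := (x.1.1 * R + x.1.2) * N + (N - x.2.+1).
have [x0 bx0] : exists x, bad x.
  case/forallPn: nl => k /forallPn[r /forallPn[i]]; rewrite negb_imply negbK.
  by move=> h; exists (k, r, i).
have [x bx mx] := arg_minnP code bx0; exists x; move: bx => /andP[ix bx].
apply/and3P; split=> //; apply/forallP => k; apply/forallP => r; apply/forallP => i.
apply/implyP => /andP[iN e]; apply/negP => b.
have := mx (k, r, i); rewrite /bad /= iN b => /(_ isT); rewrite /code /= leqNgt.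
case/negP; case: x ix e {bx mx} => [[k1 r1] i1] /= ix.
rewrite /lat_earlier => /orP[kk|/andP[/eqP -> h]].
  have h1 : k.+1 * R <= k1 * R by rewrite leq_mul2r kk orbT.
  have h2 : (k * R + r).+1 * N <= (k1 * R + r1) * N.
    rewrite leq_mul2r; apply/orP; right.
    by have := ltn_ord r; move: h1; rewrite mulSn; lia.
  by move: h2; rewrite mulSn; lia.
case/orP: h => [rr|/andP[/eqP -> ii]]; last by lia.
have h2 : (k1 * R + r).+1 * N <= (k1 * R + r1) * N.
  by rewrite leq_mul2r; apply/orP; right; lia.
by move: h2; rewrite mulSn; lia.
Qed.

Definition flip_arr c (x : 'I_L * 'I_R * 'I_N) : arr R (L * N) B :=
  mkarr R (L * N) B (flip R N (av c) x.1.1 x.1.2 x.2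
    (lat_gap R N (av c) x.1.1 x.1.2 x.2)).

Definition lat_invol c := if [pick x | firstb c x] is Some x then flip_arr c x else c.

Lemma lat_involE c x : firstb c x -> lat_invol c = flip_arr c x.
Proof.
move=> fx; rewrite /lat_invol; case: pickP => [y fy|/(_ x)]; last by rewrite fx.
by rewrite (first_uniq fx fy).
Qed.

End LatticeArrays.

Lemma eq_pre_in R M v v' r j : r < R -> j <= M ->
  (forall r j, r < R -> j < M -> v r j = v' r j) -> pre v r j = pre v' r j.
Proof.
move=> rR jM h; apply: eq_pre => j' jj; apply: h => //.
exact: leq_trans jj jM.
Qed.

Lemma eq_lat_height R L N v v' k r i : k < L -> r <= R -> i < N ->
  (forall r j, r < R -> j < L * N -> v r j = v' r j) ->
  lat_height R N v k r i = lat_height R N v' k r i.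
Proof.
move=> kL rR iN h; rewrite /lat_height; congr (_ + _).
  apply: eq_big_nat => k' /andP[_ kk]; apply: eq_big_nat => r' /andP[_ rr].
  by apply: h => //; apply: mul_add_lt => //; lia.
apply: eq_big_nat => r' /andP[_ rr].
by apply: h; [lia|apply: mul_add_lt].
Qed.

Lemma eq_xcont R L N v v' i : i < N ->
  (forall r j, r < R -> j < L * N -> v r j = v' r j) ->
  xcont R L N v i = xcont R L N v' i.
Proof.
move=> iN h.
apply: eq_big_nat => k' /andP[_ kk]; apply: eq_big_nat => r' /andP[_ rr].
by apply: h => //; apply: mul_add_lt.
Qed.

Section FlipArr.

Variables (R L N B : nat) (c : arr R (L * N) B) (x : 'I_L * 'I_R * 'I_N).
Hypotheses (cP : ssyt c) (cF : firstb c x)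
  (cB : forall r, r < R -> rowsum c r <= B).

Let vP : ssyt_fun R L N (av c).
Proof. exact/ssytP. Qed.
Let vF := firstP _ _ cF.
Let E := lat_gap R N (av c) x.1.1 x.1.2 x.2.
Let v' := flip R N (av c) x.1.1 x.1.2 x.2 E.

Lemma av_flip_arr r j : r < R -> j < L * N -> av (flip_arr c x) r j = v' r j.
Proof.
move=> rR jM; apply: av_mkarr => //; apply: leq_trans (cB rR).
exact: (flip_bound vP vF).
Qed.

Lemma flip_arr_ssyt : ssyt (flip_arr c x).
Proof.
apply/ssytP => r j rR jM.
rewrite !(eq_pre_in (M := L * N) _ _ av_flip_arr) //; try lia.
exact: (flip_ssyt vP vF).
Qed.

Lemma flip_arr_rowsum r : rowsum (flip_arr c x) r = rowsum c r.
Proof.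
have [rR|rR] := ltnP r R; last first.
  by apply: eq_bigr => j _; rewrite !av_out_row.
rewrite /rowsum (eq_pre_in (M := L * N) _ _ av_flip_arr) //.
exact: (flip_pre_mul vP vF).
Qed.

Lemma flip_arr_zcont k : k < L -> zcont (flip_arr c x) k = zcont c k.
Proof.
move=> kL; apply: eq_big_nat => r /andP[_ rR].
rewrite -(flip_group vP vF) //; apply: eq_big_nat => i /andP[_ iN].
by apply: av_flip_arr => //; apply: mul_add_lt.
Qed.

Lemma flip_arr_first : firstb (flip_arr c x) x.
Proof.
have [k0L r0R i0N _ _] := vF; have [h1 h2] := flip_first vP vF.
apply/firstP; split=> //.
  rewrite /lat_bad !(eq_lat_height (L := L) _ _ _ av_flip_arr) //; lia.
move=> k r i kL rR iN e.
rewrite /lat_bad !(eq_lat_height (L := L) _ _ _ av_flip_arr) //; try lia.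
exact: h2.
Qed.

Lemma flip_arrK : flip_arr (flip_arr c x) x = c.
Proof.
have [k0L r0R i0N _ _] := vF.
apply: arr_ext => r j rR jM.
have gE : lat_gap R N (av (flip_arr c x)) x.1.1 x.1.2 x.2 = E.
  rewrite /lat_gap !(eq_lat_height (L := L) _ _ _ av_flip_arr) //; try lia.
  exact: (flip_gap vP vF).
have eF : flip R N (av (flip_arr c x)) x.1.1 x.1.2 x.2 E r j = av c r j.
  rewrite -(flipK vP vF) // -/E -/v'.
  have ep s l : s < R -> l <= L * N ->
      flip_pre R N (av (flip_arr c x)) x.1.1 x.1.2 x.2 E s l =
      flip_pre R N v' x.1.1 x.1.2 x.2 E s l.
    move=> sR lM; rewrite /flip_pre; case: eqP => [el|_]; last first.
      exact: (eq_pre_in _ _ av_flip_arr).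
    have lM' : l < L * N.
      rewrite ltn_neqAle lM andbT; apply/eqP => e; move: el.
      by rewrite e modnMl.
    case: (col_split lM') => k [i [kL iN el']]; move: el.
    rewrite el' modnMDl modn_small // => ei; rewrite ei in el' iN *.
    rewrite divnMDl ?divn_small ?addn0 //; last lia.
    have eqs : forall s, s < R ->
      [/\ pal N (av (flip_arr c x)) x.2 k s = pal N v' x.2 k s,
          pbe N (av (flip_arr c x)) x.2 k s = pbe N v' x.2 k s
        & pga N (av (flip_arr c x)) x.2 k s = pga N v' x.2 k s].
      move=> t tR; rewrite /pal /pbe /pga.
      by split; apply: (eq_pre_in (R := R) (M := L * N) _ _ av_flip_arr) => //; lia.
    rewrite /flip_row; case: ltnP => _; first by have [] := eqs _ sR.
    by case: eqP => _; apply: eq_toggle => //; lia.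
  by rewrite /flip !ep // ltnW.
rewrite av_mkarr // gE eF //; exact: av_leB.
Qed.

Definition swp i (u : nat -> nat) j :=
  if j == i then u i.+1 else if j == i.+1 then u i else u j.

Lemma flip_arr_xcnt i : i < N ->
  xcnt (flip_arr c x) i + (N - i) = swp x.2 (fun i => xcnt c i + (N - i)) i.
Proof.
have [k0L r0R i0N _ _] := vF.
move=> iN; rewrite /xcnt (eq_xcont iN av_flip_arr) /swp.
case: eqP => [->|n0].
  by have := flip_xcont0 vP vF; rewrite -/E -/v'; lia.
case: eqP => [->|n1].
  by have := flip_xcont1 vP vF; rewrite -/E -/v'; lia.
by congr (_ + _); apply: flip_xcont_other => //; apply/eqP.
Qed.

End FlipArr.

Local Open Scope ring_scope.

Lemma sum_sign_reversing (T : finType) (P : pred T) (A : T -> algC) (phi : T -> T) :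
  (forall c, P c -> [/\ P (phi c), phi (phi c) = c & A (phi c) = - A c]) ->
  \sum_(c | P c) A c = 0.
Proof.
move=> h; set S := \sum_(c | P c) A c.
have e : S = - S.
  rewrite {1}/S (reindex_onto phi phi) /=; last by move=> c /h[].
  rewrite -sumrN; apply: eq_big => [c|c].
    apply/andP/idP => [[h1 /eqP h2]|Pc]; last by have [-> -> _] := h _ Pc.
    by have [+ _ _] := h _ h1; rewrite h2.
  case/andP=> h1 /eqP h2; have [+ _ _] := h _ h1.
  by rewrite h2 => /h[].
have : S *+ 2 = 0 by rewrite mulr2n {1}e addNr.
by move/eqP; rewrite mulrn_eq0 => /eqP.
Qed.

(* Only lattice arrays survive an alternating sum (Stembridge, Bender-Knuth):
   at the first violation of the lattice condition, toggling the rest of the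
   pattern exchanges two consecutive entries of [xcnt c + delta]. *)
Lemma sum_lattice R L N B (nu : nat -> nat) (A : (nat -> nat) -> (nat -> nat) -> algC) :
  (\sum_(0 <= k < L) nu k <= B)%N ->
  (forall a u u', (forall i, (i < N)%N -> u i = u' i) -> A a u = A a u') ->
  (forall a u i, (i.+1 < N)%N -> A a (swp i u) = - A a u) ->
  \sum_(c : arr R (L * N) B | ssyt c && [forall k : 'I_L, zcont c k == nu k])
     A (rowsum c) (fun i => xcnt c i + (N - i))%N =
  \sum_(c : arr R (L * N) B |
       [&& ssyt c, [forall k : 'I_L, zcont c k == nu k] & latt c])
     A (rowsum c) (fun i => xcnt c i + (N - i))%N.
Proof.
move=> nuB Aext Aanti; rewrite (bigID (@latt R L N B)) /=.
rewrite [X in _ + X](_ : _ = 0) ?addr0.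
  by apply: eq_bigl => c; rewrite andbA.
apply: (@sum_sign_reversing _ _ _ (@lat_invol R L N B)) => c.
case/andP=> /andP[cs /forallP cz] nl; have [x fx] := first_ex nl.
(* The entries number at most [B] in all, so no row exceeds [B] and the flipped multiplicities still
   fit in an array. *)
have cB r : (r < R)%N -> (rowsum c r <= B)%N.
  move=> rR; apply: leq_trans nuB.
  have -> : (\sum_(0 <= k < L) nu k = \sum_(0 <= s < R) rowsum c s)%N.
    transitivity (\sum_(0 <= k < L) zcont c k)%N.
      apply: eq_big_nat => k /andP[_ kL].
      by rewrite (eqP (cz (Ordinal kL))).
    rewrite exchange_big /=; apply: eq_bigr => s _; rewrite /rowsum.
    exact: sum_groups.
  rewrite big_mkord (bigD1 (Ordinal rR)) //=; exact: leq_addr.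
rewrite (lat_involE fx).
have f' := flip_arr_first cs fx cB.
split.
- rewrite flip_arr_ssyt //=; apply/andP; split.
    by apply/forallP => k; rewrite flip_arr_zcont.
  apply/negP => /lattP h; case/firstP: f' => k0L r0R i0N + _.
  by rewrite /lat_bad ltnNge h.
- by rewrite (lat_involE f') flip_arrK.
- have [_ _ i0N _ _] := firstP _ _ fx.
  rewrite -(Aanti _ _ _ i0N).
  have -> : rowsum (flip_arr c x) = rowsum c.
    by apply: functional_extensionality_dep => r; apply: flip_arr_rowsum.
  by apply: Aext => i iN; apply: flip_arr_xcnt.
Qed.

(** * Counting functions fixed by a permutation *)

Section Content.

Variables n M : nat.
Implicit Types (f g : {ffun 'I_n -> 'I_M}) (s t : 'S_n).

Definition cnt f (i : nat) : nat := (\sum_(x < n) (f x == i :> nat))%N.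

Definition fixd f s := [forall x, f (s x) == f x].

Definition fperm f t : {ffun 'I_n -> 'I_M} := [ffun x => f (t x)].

Lemma cnt_fperm f t i : cnt (fperm f t) i = cnt f i.
Proof.
rewrite /cnt [RHS](reindex_inj (@perm_inj _ t)) /=.
by apply: eq_bigr => x _; rewrite ffunE.
Qed.

Lemma cnt_le f i : (cnt f i <= n)%N.
Proof.
apply: (leq_trans (n := \sum_(x < n) 1)%N); last by rewrite sum1_card card_ord.
by apply: leq_sum => x _; case: (_ == _).
Qed.

Lemma sum_cnt f : (\sum_(0 <= i < M) cnt f i)%N = n.
Proof.
rewrite big_mkord exchange_big /= -[RHS](card_ord n) -sum1_card.
apply: eq_bigr => x _; rewrite (bigD1 (f x)) //= eqxx big1 // => i.
by rewrite eq_sym => /negbTE; rewrite -val_eqE /= => ->.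
Qed.

Lemma count_mktuple f (i : 'I_M) : count_mem i [tuple f x | x < n] = cnt f i.
Proof.
rewrite -sum1_count big_mkcond /= big_map big_enum /cnt; apply: eq_bigr => x _.
by rewrite /= -val_eqE /=; case: eqP.
Qed.

Lemma cnt_eq_fperm f g : (forall i, (i < M)%N -> cnt f i = cnt g i) ->
  exists t, g = fperm f t.
Proof.
move=> fg; have : perm_eq [tuple g x | x < n] [tuple f x | x < n].
  by apply/allP => i _ /=; rewrite !count_mktuple fg.
case/tuple_permP => t et; exists t; apply/ffunP => x; rewrite ffunE.
have -> : g x = tnth [tuple tnth [tuple f x | x < n] (t i) | i < n] x.
  have -> : [tuple tnth [tuple f x | x < n] (t i) | i < n] = [tuple g x | x < n].
    exact/esym/val_inj.
  by rewrite tnth_mktuple.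
by rewrite !tnth_mktuple.
Qed.

Lemma cnt_exists (ka : nat -> nat) : (\sum_(0 <= i < M) ka i)%N = n ->
  exists f, forall i, (i < M)%N -> cnt f i = ka i.
Proof.
move=> sk; pose w := flatten [seq nseq (ka (val i)) i | i <- enum 'I_M].
have sw : size w == n.
  rewrite size_flatten /shape -map_comp sumnE big_map big_enum /=.
  rewrite -sk big_mkord; apply/eqP; apply: eq_bigr => i _.
  by rewrite size_nseq.
pose f := [ffun x => tnth (Tuple sw) x]; exists f => i iM.
pose i' := Ordinal iM; rewrite -[i]/(val i') -count_mktuple.
have -> : [tuple f x | x < n] = Tuple sw.
  by apply: eq_from_tnth => x; rewrite tnth_mktuple ffunE.
rewrite /= count_flatten -map_comp sumnE big_map big_enum /=.
rewrite (bigD1 i') //= count_nseq /= eqxx mul1n big1 ?addn0 // => j.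
by rewrite count_nseq /= => /negbTE ->.
Qed.

(** Contents are stored as arrays with one row so that they range over a finite type and the
    cancellation theorem for arrays applies to them. *)
Definition content f : arr 1 M n := mkarr 1 M n (fun _ i => cnt f i).

Lemma av_content f i : (i < M)%N -> av (content f) 0 i = cnt f i.
Proof. by move=> iM; rewrite av_mkarr // cnt_le. Qed.

Lemma rowsum_content f : rowsum (content f) 0 = n.
Proof.
rewrite -[RHS](sum_cnt f); apply: eq_big_nat => i /andP[_ iM].
exact: av_content.
Qed.

Lemma content_eq f c : reflect (forall i, (i < M)%N -> cnt f i = av c 0 i)
  (content f == c).
Proof.
apply: (iffP eqP) => [<- i iM|h]; first by rewrite av_content.
by apply: arr_ext => -[|r] j // _ jM; rewrite av_content // h.
Qed.

(** The map [fperm f0], for one function [f0] of content c, sends the permutations onto the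
    functions of this content, and its fibre over f is a coset of the stabiliser of f. *)
Lemma sum_stabilisers c : rowsum c 0 = n ->
  (\sum_(f | content f == c) #|[set s | fixd f s]| = n`!)%N.
Proof.
move=> cn; have [f0 f0P] := cnt_exists cn.
have -> : (n`! = \sum_(t : 'S_n) 1)%N by rewrite sum1_card card_Sn.
rewrite (partition_big (fperm f0) (fun f => content f == c)) /=; last first.
  move=> t _; apply/content_eq => i iM; rewrite cnt_fperm; exact: f0P.
apply: eq_bigr => f /content_eq fc.
have fe i : (i < M)%N -> cnt f0 i = cnt f i by move=> iM; rewrite f0P // fc.
have [t0 ft] := cnt_eq_fperm fe.
rewrite (_ : (\sum_(i | fperm f0 i == f) 1)%N = #|[set s | fperm f0 s == f]|);
  last by rewrite -sum1_card; apply: eq_bigl => t; rewrite inE.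
rewrite -(card_imset [set s | fixd f s] (mulIg t0)); apply: eq_card => t.
rewrite [RHS]inE; apply/imsetP/idP => [[s]|].
  rewrite inE => /forallP h ->; apply/eqP/ffunP => x.
  by rewrite ffunE permM -[RHS](eqP (h x)) ft ffunE.
move=> /eqP h; exists (t * t0^-1)%g; last by rewrite mulgKV.
rewrite inE; apply/forallP => x; rewrite ft !ffunE permM permKV.
by move/ffunP/(_ x): h; rewrite ft !ffunE => ->.
Qed.

(** After exchanging the sums each function is weighted by the order of its stabiliser, and the
    stabilisers belonging to one content add up to n!. An average over the group thus becomes a sum
    over contents. *)
Lemma burnside (Phi : (nat -> nat) -> algC) :
  (forall u u', (forall i, (i < M)%N -> u i = u' i) -> Phi u = Phi u') ->
  \sum_s \sum_(f | fixd f s) Phi (cnt f) =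
  (n`!)%:R * \sum_(c : arr 1 M n | rowsum c 0 == n) Phi (av c 0).
Proof.
move=> Pext; rewrite (exchange_big_dep xpredT) //=.
rewrite (partition_big content (fun c => rowsum c 0 == n)) /=; last first.
  by move=> f _; rewrite rowsum_content.
rewrite big_distrr /=; apply: eq_bigr => c /eqP cn.
rewrite -(sum_stabilisers cn) natr_sum big_distrl /=.
apply: eq_bigr => f /content_eq fc; rewrite sumr_const mulr_natl.
congr (_ *+ _); first exact: Pext.
by apply: eq_card => s; rewrite !inE.
Qed.

Definition Fc (th : nat -> nat) (s : 'S_n) : algC :=
  \sum_(f | fixd f s && [forall i : 'I_M, cnt f i == th i]) 1.

Lemma eq_Fc th th' s : (forall i, (i < M)%N -> th i = th' i) -> Fc th s = Fc th' s.
Proof.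
move=> h; apply: eq_bigl => f; congr (_ && _); apply: eq_forallb => i.
by rewrite h.
Qed.

Lemma sum_fixd_content (Phi : (nat -> nat) -> algC) s :
  (forall u u', (forall i, (i < M)%N -> u i = u' i) -> Phi u = Phi u') ->
  \sum_(f | fixd f s) Phi (cnt f) =
  \sum_(c : arr 1 M n | rowsum c 0 == n) Phi (av c 0) * Fc (av c 0) s.
Proof.
move=> Pext.
rewrite (partition_big content (fun c => rowsum c 0 == n)) /=; last first.
  by move=> f _; rewrite rowsum_content.
apply: eq_bigr => c _; rewrite /Fc big_distrr /=; apply: eq_big => f.
  congr (_ && _); apply/content_eq/forallP => [h i|h i iM]; first by rewrite h.
  exact/eqP/(h (Ordinal iM)).
by case/andP => _ /content_eq h; rewrite mulr1; apply: Pext.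
Qed.

Lemma Fc_relabel (w : 'S_M) th s :
  Fc (fun i => if insub i is Some i' then th (val (w i')) else 0%N) s = Fc th s.
Proof.
rewrite /Fc (reindex_onto (fun f => [ffun x => w^-1%g (f x)] : {ffun 'I_n -> 'I_M})
  (fun f => [ffun x => w (f x)])) /=; last first.
  by move=> f _; apply/ffunP => x; rewrite !ffunE permK.
apply: eq_bigl => f.
have -> : [ffun x => w ([ffun x0 => (w^-1)%g (f x0)] x)] == f.
  by apply/eqP/ffunP => x; rewrite !ffunE permKV.
rewrite andbT; congr (_ && _).
  by apply: eq_forallb => x; rewrite !ffunE (inj_eq perm_inj).
apply/forallP/forallP => h i.
  have := h (w^-1%g i); rewrite valK permKV; congr (_ == _).
  by apply: eq_bigr => x _; rewrite !ffunE !val_eqE (inj_eq perm_inj).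
rewrite valK -(eqP (h (w i))); apply/eqP; apply: eq_bigr => x _.
by rewrite !ffunE !val_eqE (can2_eq (permKV w) (permK w)).
Qed.

End Content.

Definition altc N (v u : nat -> nat) : algC :=
  \det (\matrix_(i < N, j < N) (u i == v j)%:R).

Definition shift N (th : nat -> nat) i := (th i + (N - i))%N.

Definition Xc n N (v : nat -> nat) (s : 'S_n) : algC :=
  \sum_(f : {ffun 'I_n -> 'I_N} | fixd f s) altc N v (shift N (cnt f)).

Lemma altc_ext N v v' u u' : (forall i, (i < N)%N -> u i = u' i) ->
  (forall i, (i < N)%N -> v i = v' i) -> altc N v u = altc N v' u'.
Proof.
move=> hu hv; congr (\det _); apply/matrixP => i j; rewrite !mxE.
by rewrite hu // hv.
Qed.

Lemma eq_shift N u u' : (forall i, (i < N)%N -> u i = u' i) ->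
  forall i, (i < N)%N -> shift N u i = shift N u' i.
Proof. by move=> h i iN; rewrite /shift h. Qed.

Lemma altc_anti N v u i : (i.+1 < N)%N -> altc N v (swp i u) = - altc N v u.
Proof.
move=> iN; pose i0 := Ordinal (ltnW iN); pose i1 := Ordinal iN.
rewrite /altc; set A := (X in - \det X).
have -> : \matrix_(i2, j) (swp i u i2 == v j)%:R = xrow i0 i1 A.
  apply/matrixP => a b; rewrite !mxE /swp.
  case: tpermP => [->|->|/eqP n0 /eqP n1] /=; rewrite ?eqxx //.
    by have -> : i.+1 == i = false by lia.
  by move: n0 n1; rewrite -!val_eqE /= => /negbTE -> /negbTE ->.
rewrite xrowE det_mulmx det_perm odd_tperm.
have -> : i0 != i1 by rewrite -val_eqE /=; lia.
by rewrite expr1 mulN1r.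
Qed.

Definition decr N (u : nat -> nat) := forall i, (i.+1 < N)%N -> (u i.+1 < u i)%N.

Lemma decr_lt N u i j : decr N u -> (i < j)%N -> (j < N)%N -> (u j < u i)%N.
Proof.
move=> d; elim: j => // j IH; rewrite ltnS leq_eqVlt => /orP[/eqP ->|ij] jN.
  exact: d.
by apply: ltn_trans (d _ jN) _; apply: IH => //; apply: ltnW.
Qed.

Lemma altc_neq0 N v u : altc N v u != 0 ->
  exists w : 'S_N, forall i : 'I_N, u i = v (w i).
Proof.
move=> h; have [/existsP[w /forallP wP]|] :=
  boolP [exists w : 'S_N, forall i : 'I_N, u i == v (w i)].
  by exists w => i; apply/eqP.
move/existsPn => nw; case/eqP: h; rewrite /altc /determinant big1 // => w _.
case/forallPn: (nw w) => i /negbTE ui.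
by rewrite (bigD1 i) //= mxE ui mul0r mulr0.
Qed.

(** A strictly decreasing sequence is determined by its set of values, so if some permutation
    carries [v] to [u], the two sequences are equal and the matrix is the identity. *)
Lemma altc_decr N u v : decr N u -> decr N v ->
  altc N v u = [forall i : 'I_N, u i == v i]%:R.
Proof.
move=> du dv; case: forallP => [h|nh].
  rewrite /altc (_ : \matrix_(i, j) _ = 1%:M) ?det1 //.
  apply/matrixP => i j; rewrite !mxE (eqP (h i)); congr (nat_of_bool _)%:R.
  apply/eqP/eqP => [e|-> //]; apply: val_inj => /=.
  by have [ij|ij|//] := ltngtP i j; have := decr_lt dv ij; rewrite e ltn_ord;
    rewrite ltnn => /(_ isT).
have [//|/altc_neq0[w h]] := eqVneq (altc N v u) 0.
case: nh => i; apply/eqP.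
have sd x : decr N x -> sorted gtn (mkseq x N).
    move=> dx; apply/(sortedP 0%N) => k; rewrite size_mkseq => kN.
    by rewrite !nth_mkseq ?(ltnW kN) //; apply: dx.
  have : mkseq u N = mkseq v N.
    apply: (@irr_sorted_eq _ gtn); try exact: sd.
    - by move=> a b c /= ab bc; lia.
    - by move=> a /=; lia.
    move=> y; apply/mapP/mapP => -[j]; rewrite mem_iota /= add0n => jN ->.
      exists (val (w (Ordinal jN))); first by rewrite mem_iota /= add0n.
      exact: (h (Ordinal jN)).
    exists (val (w^-1%g (Ordinal jN))); first by rewrite mem_iota /= add0n.
    by rewrite h permKV.
  by move/(congr1 (fun l => nth 0%N l i)); rewrite !nth_mkseq.
Qed.

Lemma shift_decr N th : (forall i, (i.+1 < N)%N -> (th i.+1 <= th i)%N) ->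
  decr N (shift N th).
Proof. by move=> h i iN; have := h i iN; rewrite /shift; lia. Qed.

Definition ipn n (f g : 'S_n -> algC) : algC :=
  (n`!)%:R^-1 * \sum_s f s * g s.

Lemma fact_neq0 n : (n`!)%:R != 0 :> algC.
Proof. by rewrite pnatr_eq0 -lt0n fact_gt0. Qed.

Section Product.

Variables (n M N : nat).
Implicit Types (f : {ffun 'I_n -> 'I_M}) (g : {ffun 'I_n -> 'I_N}).

Lemma cnt_pair_z (h : {ffun 'I_n -> 'I_(M * N)}) f k :
  (forall x, val (f x) = val (h x) %/ N)%N -> (k < M)%N ->
  cnt f k = (\sum_(0 <= i < N) cnt h (k * N + i))%N.
Proof.
move=> fh kM; rewrite big_mkord /cnt exchange_big /=; apply: eq_bigr => x _.
have hM := ltn_ord (h x).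
have N0 : (0 < N)%N by move: (leq_ltn_trans (leq0n _) hM); rewrite muln_gt0 => /andP[].
rewrite fh; case: eqP => [ek|ne] /=.
  have iN : (h x %% N < N)%N by rewrite ltn_mod.
  have e0 : (nat_of_ord (h x) == k * N + h x %% N)%N by rewrite -ek -divn_eq.
  rewrite (bigD1 (Ordinal iN)) //= e0 big1 // => i ii.
  case: eqP => // e; case/negP: ii; rewrite -val_eqE /= e.
  by rewrite modnMDl modn_small.
rewrite big1 // => i _; case: eqP => // e; case: ne.
by rewrite /= e divnMDl // divn_small ?addn0.
Qed.

Lemma cnt_pair_x (h : {ffun 'I_n -> 'I_(M * N)}) g i :
  (forall x, val (g x) = val (h x) %% N)%N -> (i < N)%N ->
  cnt g i = (\sum_(0 <= k < M) cnt h (k * N + i))%N.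
Proof.
move=> gh iN; rewrite big_mkord /cnt exchange_big /=; apply: eq_bigr => x _.
have hM := ltn_ord (h x).
have N0 : (0 < N)%N by lia.
rewrite gh; case: eqP => [ei|ne] /=.
  have kM : (h x %/ N < M)%N by rewrite ltn_divLR.
  have e0 : (nat_of_ord (h x) == h x %/ N * N + i)%N by rewrite -ei -divn_eq.
  rewrite (bigD1 (Ordinal kM)) //= e0 big1 // => k kk.
  case: eqP => // e; case/negP: kk; rewrite -val_eqE /= e.
  by rewrite divnMDl // divn_small ?addn0.
rewrite big1 // => k _; case: eqP => // e; case: ne.
by rewrite /= e modnMDl modn_small.
Qed.

Lemma Fc_mul (th : nat -> nat) (Psi : (nat -> nat) -> algC) s :
  (forall u u', (forall i, (i < N)%N -> u i = u' i) -> Psi u = Psi u') ->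
  Fc M th s * (\sum_(g : {ffun 'I_n -> 'I_N} | fixd g s) Psi (cnt g)) =
  \sum_(h : {ffun 'I_n -> 'I_(M * N)} | fixd h s &&
       [forall k : 'I_M, (\sum_(0 <= i < N) cnt h (k * N + i))%N == th k])
     Psi (fun i => \sum_(0 <= k < M) cnt h (k * N + i))%N.
Proof.
move=> Pext; rewrite /Fc big_distrlr /= pair_big /=.
have dvP (h : {ffun 'I_n -> 'I_(M * N)}) x : (h x %/ N < M)%N.
  have hM := ltn_ord (h x).
  have : (0 < M * N)%N by exact: leq_ltn_trans hM.
  by rewrite muln_gt0 => /andP[_ N0]; rewrite ltn_divLR.
have mdP (h : {ffun 'I_n -> 'I_(M * N)}) x : (h x %% N < N)%N.
  have : (0 < M * N)%N by exact: leq_ltn_trans (ltn_ord (h x)).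
  by rewrite muln_gt0 ltn_mod => /andP[].
pose to (h : {ffun 'I_n -> 'I_(M * N)}) :=
  ([ffun x => Ordinal (dvP h x)], [ffun x => Ordinal (mdP h x)]).
pose of_ (p : {ffun 'I_n -> 'I_M} * {ffun 'I_n -> 'I_N}) :
    {ffun 'I_n -> 'I_(M * N)} :=
  [ffun x => Ordinal (mul_add_lt (ltn_ord (p.1 x)) (ltn_ord (p.2 x)))].
have N0 (g : {ffun 'I_n -> 'I_N}) (x : 'I_n) : (0 < N)%N.
  exact: leq_ltn_trans (ltn_ord (g x)).
have toK : cancel of_ to.
  move=> [f g]; congr pair; apply/ffunP => x; apply: val_inj; rewrite !ffunE /=.
    by rewrite ?ffunE /= divnMDl ?(N0 g x) // divn_small ?addn0.
  by rewrite ?ffunE /= modnMDl modn_small.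
have ofK : cancel to of_.
  move=> h; apply/ffunP => x; apply: val_inj; rewrite !ffunE /= ?ffunE /=.
  by rewrite -divn_eq.
rewrite (reindex to) /=; last by exists of_ => ? _.
apply: eq_big => [h|h _].
  rewrite andbAC; congr (_ && _).
    apply/andP/forallP => [[/forallP h1 /forallP h2] x|h1].
      move: (h1 x) (h2 x); rewrite !ffunE -!val_eqE /= => /eqP e1 /eqP e2.
      by rewrite (divn_eq (h (s x)) N) e1 e2 -divn_eq.
    by split; apply/forallP => x; rewrite !ffunE -val_eqE /= (eqP (h1 x)).
  apply: eq_forallb => k; congr (_ == _); apply: cnt_pair_z => // x.
  by rewrite ffunE.
rewrite mul1r; apply: Pext => i iN; apply: cnt_pair_x => // x.
by rewrite ffunE.
Qed.

End Product.

(** When [v] is a shifted partition this is a Kostka number. [burnside] turns the inner product into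
    a sum over arrays with one row of pairs. Let [d] have the number of pairs (k, i) in row i and
    column k: the lattice inequality for (k, i) is then column strictness of [d] between rows i and
    i + 1. *)
Lemma ip_FX n M N (th v : nat -> nat) : (\sum_(0 <= k < M) th k)%N = n ->
  ipn (@Fc n M th) (Xc N v) =
  \sum_(d : arr N M n | ssyt d && [forall k : 'I_M, colsum d k == th k])
     altc N v (shift N (rowsum d)).
Proof.
move=> sth; rewrite /ipn.
have Pext u u' : (forall i, (i < N)%N -> u i = u' i) ->
    altc N v (shift N u) = altc N v (shift N u').
  by move=> h; apply: altc_ext => //; apply: eq_shift.
pose Ph (u : nat -> nat) : algC :=
  if [forall k : 'I_M, (\sum_(0 <= i < N) u (k * N + i))%N == th k] then
  altc N v (shift N (fun i => \sum_(0 <= k < M) u (k * N + i))%N) else 0.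
have -> : \sum_(s : 'S_n) Fc M th s * Xc N v s =
    \sum_(s : 'S_n) \sum_(h : {ffun 'I_n -> 'I_(M * N)} | fixd h s) Ph (cnt h).
  apply: eq_bigr => s _.
  rewrite /Xc (@Fc_mul n M N th (fun u => altc N v (shift N u)) s) //.
  by rewrite big_mkcondr /=; apply: eq_bigr.
rewrite burnside; last first.
  move=> u u' h; rewrite /Ph.
  have -> : [forall k : 'I_M, (\sum_(0 <= i < N) u (k * N + i))%N == th k] =
      [forall k : 'I_M, (\sum_(0 <= i < N) u' (k * N + i))%N == th k].
    apply: eq_forallb => k; congr (_ == _); apply: eq_big_nat => i /andP[_ iN].
    by apply: h; apply: mul_add_lt.
  case: ifP => // _; apply: Pext => i iN; apply: eq_big_nat => k /andP[_ kM].
  by apply: h; apply: mul_add_lt.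
rewrite mulKf ?fact_neq0 //.
have zE (c : arr 1 (M * N) n) k :
    zcont c k = (\sum_(0 <= i < N) av c 0 (k * N + i))%N.
  by rewrite /zcont big_nat1.
have xE (c : arr 1 (M * N) n) i :
    xcnt c i = (\sum_(0 <= k < M) av c 0 (k * N + i))%N.
  by apply: eq_bigr => k _; rewrite big_nat1.
transitivity (\sum_(c : arr 1 (M * N) n |
    ssyt c && [forall k : 'I_M, zcont c k == th k])
    altc N v (fun i => xcnt c i + (N - i))%N).
  rewrite big_mkcond [RHS]big_mkcond /=; apply: eq_bigr => c _.
  have -> : ssyt c by apply/ssytP.
  have e1 : [forall k : 'I_M, (\sum_(0 <= i < N) av c 0 (k * N + i))%N == th k] =
      [forall k : 'I_M, zcont c k == th k].
    by apply: eq_forallb => k; rewrite zE.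
  rewrite /Ph e1 /=; case: (boolP [forall k : 'I_M, _]) => [/forallP h|_];
    last by case: ifP.
  have -> : rowsum c 0 == n.
    rewrite /rowsum -sum_groups; apply/eqP; apply: etrans sth.
    apply: eq_big_nat => k /andP[_ kM].
    by rewrite -(eqP (h (Ordinal kM))) zE.
  by apply: altc_ext => // i iN; rewrite /shift xE.
rewrite (@sum_lattice 1 M N n th (fun _ u => altc N v u)); first last.
- by move=> _ u i iN; rewrite altc_anti.
- by move=> _ u u' h; apply: altc_ext.
- by rewrite sth.
pose to (d : arr N M n) : arr 1 (M * N) n :=
  mkarr 1 (M * N) n (fun _ j => av d (j %% N) (j %/ N)).
pose of_ (c : arr 1 (M * N) n) : arr N M n :=
  mkarr N M n (fun r k => av c 0 (k * N + r)).
have avto d k i : (k < M)%N -> (i < N)%N -> av (to d) 0 (k * N + i) = av d i k.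
  move=> kM iN; have N0 : (0 < N)%N by lia.
  by rewrite av_mkarr ?av_leB ?mul_add_lt // modnMDl modn_small // divnMDl //
    divn_small ?addn0.
have toK : cancel to of_.
  move=> d; apply: arr_ext => r k rN kM; rewrite av_mkarr ?av_leB //.
  exact: avto.
have ofK : cancel of_ to.
  move=> c; apply: arr_ext => -[|r] j // _ jM.
  case: (col_split jM) => k [i [kM iN ->]]; rewrite avto // av_mkarr ?av_leB //.
rewrite (reindex to) /=; last by exists of_ => ? _.
have preE d i k : (k <= M)%N -> (i < N)%N ->
    (\sum_(0 <= k' < k) \sum_(0 <= r' < 1) av (to d) r' (k' * N + i))%N =
    pre (av d) i k.
  move=> kM iN; apply: eq_big_nat => k' /andP[_ kk].
  by rewrite big_nat1 avto //; exact: leq_trans kk kM.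
apply: eq_big => [d|d _]; last first.
  by apply: altc_ext => // i iN; rewrite /xcnt /xcont preE.
have -> : ssyt (to d) by apply/ssytP.
rewrite /= andbC; congr (_ && _); last first.
  apply: eq_forallb => k; rewrite zE; congr (_ == _).
  by apply: eq_big_nat => i /andP[_ iN]; rewrite avto.
have h0 k i : (k < M)%N -> (i < N)%N -> lat_height 1 N (av (to d)) k 0 i = pre (av d) i k.
  by move=> kM iN; rewrite /lat_height big_nil addn0 preE // ltnW.
apply/lattP/ssytP => [h r j rN jM|h k [|r] i kM // _ iN].
  have := h j 0%N r jM isT rN; rewrite lat_heightS !h0 ?avto // ?preS //; lia.
rewrite lat_heightS !h0 ?avto -?preS //; last exact: ltnW.
exact: h.
Qed.

Definition latt1 R N B (c : arr R N B) :=
  [forall r : 'I_R, forall i : 'I_N, (i.+1 < N)%N ==>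
    (\sum_(0 <= r' < r.+1) av c r' i.+1 <= \sum_(0 <= r' < r) av c r' i)%N].

Lemma sum_lattice1 R N B m (A : (nat -> nat) -> (nat -> nat) -> algC) :
  (m <= B)%N ->
  (forall a u u', (forall i, (i < N)%N -> u i = u' i) -> A a u = A a u') ->
  (forall a u i, (i.+1 < N)%N -> A a (swp i u) = - A a u) ->
  \sum_(c : arr R N B | ssyt c && ((\sum_(0 <= r < R) rowsum c r)%N == m))
     A (rowsum c) (shift N (colsum c)) =
  \sum_(c : arr R N B |
       [&& ssyt c, (\sum_(0 <= r < R) rowsum c r)%N == m & latt1 c])
     A (rowsum c) (shift N (colsum c)).
Proof.
move=> mB Aext Aanti.
have := @sum_lattice R 1 N B (fun=> m) A.
rewrite big_nat1 => /(_ mB Aext Aanti).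
rewrite /latt /zcont /xcnt.
(* The type of the arrays mentions [1 * N], which is not convertible to [N]; generalising it first
   allows the replacement. *)
move: (1 * N)%N (mul1n N) => M eM; subst M => H.
have e1 (c : arr R N B) : [forall k : 'I_1,
    (\sum_(0 <= r < R) \sum_(0 <= i < N) av c r (k * N + i))%N == m] =
    ((\sum_(0 <= r < R) rowsum c r)%N == m).
  have e (k : 'I_1) : (\sum_(0 <= r < R) \sum_(0 <= i < N) av c r (k * N + i))%N =
      (\sum_(0 <= r < R) rowsum c r)%N.
    by apply: eq_bigr => r _; apply: eq_bigr => i _; rewrite ord1 mul0n.
  by apply/forallP/idP => [/(_ ord0)|h k]; rewrite e.
have e2 (c : arr R N B) i :
    (xcont R 1 N (av c) i + (N - i))%N = shift N (colsum c) i.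
  by rewrite /xcont big_nat1 /shift /colsum mul0n.
transitivity (\sum_(c : arr R N B | ssyt c && [forall k : 'I_1,
    (\sum_(0 <= r < R) \sum_(0 <= i < N) av c r (k * N + i))%N == m])
    A (rowsum c) (fun i => xcont R 1 N (av c) i + (N - i))%N).
  by apply: eq_big => [c|c _]; rewrite ?e1 //; apply: Aext => i _; rewrite e2.
rewrite H; apply: eq_big => [c|c _]; last by apply: Aext => i _; rewrite e2.
rewrite e1; congr [&& _, _ & _].
have hE r i : lat_height R N (av c) 0 r i = (\sum_(0 <= r' < r) av c r' i)%N.
  by rewrite /lat_height big_nil add0n mul0n.
apply/forallP/forallP => [/(_ ord0)/forallP h r|h k].
  apply/forallP => i; apply/implyP => iN.
  move/forallP/(_ i)/implyP/(_ iN): (h r).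
  by rewrite /lat_bad !hE -leqNgt.
apply/forallP => r; apply/forallP => i; apply/implyP => iN.
rewrite ord1 /lat_bad !hE -leqNgt.
by move/forallP/(_ i)/implyP/(_ iN): (h r).
Qed.

Lemma ssyt_low R M B (d : arr R M B) r j : ssyt d -> (r < R)%N -> (j < M)%N ->
  (j < r)%N -> av d r j = 0%N.
Proof.
move/ssytP => h rR jM jr; suff : (pre (av d) r j.+1 <= 0)%N by rewrite preS; lia.
elim: j r rR jM jr => [|j IH] [|r] // rR jM jr.
  by apply: leq_trans (h r 0%N rR jM) _; rewrite /pre big_nil.
apply: leq_trans (h r j.+1 rR jM) _.
by apply: IH => //; lia.
Qed.

(** Combined with [ssyt_low], it shows that a semistandard lattice array is diagonal. *)
Lemma latt1_high R N B (d : arr R N B) r i : latt1 d -> (r < R)%N -> (i < N)%N ->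
  (r < i)%N -> av d r i = 0%N.
Proof.
move=> h rR iN ri.
suff : (\sum_(0 <= r' < r.+1) av d r' i <= 0)%N by rewrite big_nat_recr //=; lia.
elim: r i rR iN ri => [|r IH] [|i] // rR iN ri.
  move/forallP/(_ (Ordinal rR))/forallP/(_ (Ordinal (ltnW iN)))/implyP/(_ iN): h.
  by rewrite /= big_nil.
move/forallP/(_ (Ordinal rR))/forallP/(_ (Ordinal (ltnW iN)))/implyP/(_ iN): h.
by move/leq_trans; apply; apply: IH => //; lia.
Qed.

Lemma sum_one (F : nat -> nat) N r : (r < N)%N ->
  (forall j, (j < N)%N -> j != r -> F j = 0%N) -> (\sum_(0 <= j < N) F j)%N = F r.
Proof.
move=> rN h; rewrite big_mkord (bigD1 (Ordinal rN)) //= big1 ?addn0 // => j.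
by rewrite -val_eqE /= => /h; apply.
Qed.

Lemma ssyt_rowsum R M B (d : arr R M B) r : ssyt d -> (r.+1 < R)%N ->
  (rowsum d r.+1 <= rowsum d r)%N.
Proof.
move=> ds rR; rewrite /rowsum; case: M d ds => [|M] d ds; first by rewrite /pre !big_nil.
apply: leq_trans (pre_mono _ _ (leqnSn M)).
by move/ssytP: ds; apply.
Qed.

(** * Orthonormality and Young's rule *)

Section Ortho.

Variables n N : nat.

(** The partitions of n with at most N parts, padded with zeros, as elements of a finite type. *)
Definition ispt (p : arr 1 N n) := (rowsum p 0 == n) &&
  [forall i : 'I_N, (i.+1 < N)%N ==> (av p 0 i.+1 <= av p 0 i)%N].

Definition sv (p : arr 1 N n) := shift N (av p 0).

Lemma ispt_le p i : ispt p -> (i.+1 < N)%N -> (av p 0 i.+1 <= av p 0 i)%N.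
Proof.
by case/andP=> _ /forallP h iN; have /implyP := h (Ordinal (ltnW iN)); apply.
Qed.

Lemma sv_decr p : ispt p -> decr N (sv p).
Proof. by move=> pP; apply: shift_decr => i iN; apply: ispt_le. Qed.

Lemma shift_eq u v : [forall i : 'I_N, shift N u i == shift N v i] =
  [forall i : 'I_N, u i == v i].
Proof. by apply: eq_forallb => i; rewrite /shift eqn_add2r. Qed.

Definition row_arr (u : nat -> nat) : arr 1 N n := mkarr 1 N n (fun _ => u).

Lemma av_row_arr u i : (forall i, (i < N)%N -> u i <= n)%N -> (i < N)%N ->
  av (row_arr u) 0 i = u i.
Proof. by move=> h iN; rewrite av_mkarr // h. Qed.

Lemma row_arr_eq u p : (forall i, (i < N)%N -> u i <= n)%N ->
  (row_arr u == p) = [forall i : 'I_N, av p 0 i == u i].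
Proof.
move=> h; apply/eqP/forallP => [<- i|e]; first by rewrite av_row_arr.
apply: arr_ext => -[|r] j // _ jN; rewrite av_row_arr //.
by rewrite (eqP (e (Ordinal jN))).
Qed.

Lemma leq_sum_nat (F : nat -> nat) M i : (i < M)%N -> (F i <= \sum_(0 <= j < M) F j)%N.
Proof. by move=> iM; rewrite big_mkord (bigD1 (Ordinal iM)) //= leq_addr. Qed.

Lemma sum_rowsum R M B (d : arr R M B) :
  (\sum_(0 <= r < R) rowsum d r)%N = (\sum_(0 <= j < M) colsum d j)%N.
Proof. by rewrite exchange_big. Qed.

Lemma ip_sumX (J : finType) (P : pred J) (a : J -> algC) (F : J -> 'S_n -> algC) g :
  ipn (fun s => \sum_(c | P c) a c * F c s) g = \sum_(c | P c) a c * ipn (F c) g.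
Proof.
rewrite /ipn [RHS](eq_bigr (fun c =>
  (n`!)%:R^-1 * \sum_s (a c * F c s * g s))); last first.
  by move=> c _; rewrite mulrCA; congr (_ * _); rewrite big_distrr /=;
    apply: eq_bigr => s _; rewrite mulrA.
rewrite -big_distrr /= exchange_big /=; congr (_ * _); apply: eq_bigr => s _.
by rewrite big_distrl.
Qed.

Lemma Xc_Fc v (s : 'S_n) : Xc N v s =
  \sum_(c : arr 1 N n | rowsum c 0 == n) altc N v (shift N (av c 0)) * Fc N (av c 0) s.
Proof.
apply: (@sum_fixd_content n N (fun u => altc N v (shift N u))).
by move=> u u' h; apply: altc_ext => //; apply: eq_shift.
Qed.

(** Expanding the first factor by [Xc_Fc] and applying [ip_FX] gives a sum over semistandard arrays
    that is alternated in the content, as the cancellation of [sum_lattice1] requires, and also in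
    the shape. *)
Lemma ip_XX_sum v w : ipn (@Xc n N v) (Xc N w) =
  \sum_(d : arr N N n | ssyt d && ((\sum_(0 <= r < N) rowsum d r)%N == n))
    altc N v (shift N (colsum d)) * altc N w (shift N (rowsum d)).
Proof.
have -> : @Xc n N v = fun s : 'S_n => \sum_(c : arr 1 N n | rowsum c 0 == n)
    altc N v (shift N (av c 0)) * Fc N (av c 0) s.
  by apply: functional_extensionality_dep => s; apply: Xc_Fc.
rewrite ip_sumX.
have csn (d : arr N N n) : (\sum_(0 <= r < N) rowsum d r)%N = n ->
    forall j, (j < N)%N -> (colsum d j <= n)%N.
  move=> e j jN; rewrite -[X in (_ <= X)%N]e sum_rowsum; exact: leq_sum_nat.
rewrite [RHS](partition_big (fun d => row_arr (colsum d))
  (fun c => rowsum c 0 == n)) /=; last first.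
  move=> d /andP[_ /eqP e]; apply/eqP; rewrite -[RHS]e sum_rowsum.
  by apply: eq_big_nat => j /andP[_ jN]; rewrite av_row_arr //; apply: csn.
apply: eq_bigr => c /eqP cn.
rewrite ip_FX // big_distrr /=; apply: eq_big => d.
  rewrite -andbA; congr (_ && _); apply/forallP/andP => [h|[/eqP e]].
    have e : (\sum_(0 <= r < N) rowsum d r)%N = n.
      rewrite sum_rowsum -[RHS]cn; apply: eq_big_nat => j /andP[_ jN].
      exact/eqP/(h (Ordinal jN)).
    rewrite e row_arr_eq; last exact: csn.
    by split=> //; apply/forallP => j; rewrite eq_sym.
  rewrite row_arr_eq; last exact: csn.
  by move/forallP => h j; rewrite eq_sym.
case/andP=> _ /forallP h; congr (_ * _); apply: altc_ext => // i iN.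
by rewrite /shift (eqP (h (Ordinal iN))).
Qed.

Definition diag_arr (p : arr 1 N n) : arr N N n :=
  mkarr N N n (fun r j => if r == j then av p 0 r else 0%N).

Lemma av_diag p r j : (r < N)%N -> (j < N)%N ->
  av (diag_arr p) r j = if r == j then av p 0 r else 0%N.
Proof.
by move=> rN jN; rewrite av_mkarr //; case: eqP => // _; apply: av_leB.
Qed.

Lemma pre_diag p r j : (r < N)%N -> (j <= N)%N ->
  pre (av (diag_arr p)) r j = if (r < j)%N then av p 0 r else 0%N.
Proof.
move=> rN jN; case: ltnP => rj; last first.
  rewrite /pre big_nat_cond big1 // => i; rewrite andbT => /andP[_ ij].
  by rewrite av_diag //; [case: eqP|]; lia.
have -> : pre (av (diag_arr p)) r j = av (diag_arr p) r r.
  apply: sum_one => // i ij ir; rewrite av_diag //; last exact: leq_trans ij jN.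
  by rewrite eq_sym (negbTE ir).
by rewrite av_diag // eqxx.
Qed.

Lemma diag_ssyt p : ispt p -> ssyt (diag_arr p).
Proof.
move=> pP; apply/ssytP => r j rN jN; rewrite !pre_diag //; try lia.
rewrite ltnS; case: ltnP => // rj; exact: ispt_le.
Qed.

Lemma rowsum_diag p r : (r < N)%N -> rowsum (diag_arr p) r = av p 0 r.
Proof. by move=> rN; rewrite /rowsum pre_diag // rN. Qed.

Lemma colsum_diag p r : (r < N)%N -> colsum (diag_arr p) r = av p 0 r.
Proof.
move=> rN; rewrite /colsum (@sum_one _ N r) //; first by rewrite av_diag ?eqxx.
by move=> s sN sr; rewrite av_diag ?(negbTE sr).
Qed.

(** Only diagonal arrays survive the cancellation. Their row sums equal their column sums, so a
    nonzero term has p and q both equal to its diagonal. *)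
Lemma ip_XX p q : ispt p -> ispt q ->
  ipn (@Xc n N (sv p)) (Xc N (sv q)) = (p == q)%:R.
Proof.
move=> pP qP; rewrite ip_XX_sum.
rewrite (@sum_lattice1 N N n n (fun a u => altc N (sv p) u * altc N (sv q) (shift N a)))
  //; first last.
- by move=> a u i iN; rewrite altc_anti // mulNr.
- by move=> a u u' h; congr (_ * _); apply: altc_ext.
have diag (d : arr N N n) : ssyt d -> latt1 d -> forall r, (r < N)%N ->
    colsum d r = av d r r /\ rowsum d r = av d r r.
  move=> ds dl r rN; split; apply: sum_one => // j jN; case: ltngtP => // jr _.
  - exact: latt1_high.
  - exact: ssyt_low.
  - exact: ssyt_low.
  - exact: latt1_high.
pose d0 := diag_arr p; have d0s : ssyt d0 := diag_ssyt pP.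
have av0 := @av_diag p; have row0 := @rowsum_diag p.
have d0l : latt1 d0.
  apply/forallP => r; apply/forallP => i; apply/implyP => iN.
  have cE r' j : (j < N)%N -> (r' <= N)%N ->
    (\sum_(0 <= s < r') av d0 s j)%N = if (j < r')%N then av p 0 j else 0%N.
    move=> jN rN; case: ltnP => rj; last first.
      rewrite big_nat_cond big1 // => s; rewrite andbT => /andP[_ sr].
      by rewrite av0 //; [case: eqP|]; lia.
    rewrite (@sum_one _ r' j) //; first by rewrite av0 ?eqxx.
    by move=> s sr sj; rewrite av0 ?(negbTE sj) //; lia.
  rewrite !cE //; try lia; last exact: ltnW.
  rewrite ltnS; case: ltnP => // _; exact: ispt_le.
have val (d : arr N N n) : ssyt d -> latt1 d ->
    altc N (sv p) (shift N (colsum d)) * altc N (sv q) (shift N (rowsum d)) =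
    ((d == d0) && (p == q))%:R.
  move=> ds dl; have dd := diag d ds dl.
  have dle r : (r.+1 < N)%N -> (rowsum d r.+1 <= rowsum d r)%N.
    exact: ssyt_rowsum.
  have dlc r : (r.+1 < N)%N -> (colsum d r.+1 <= colsum d r)%N.
    move=> rN; have [-> e1] := dd _ rN; have [-> e2] := dd _ (ltnW rN).
    by rewrite -e1 -e2; apply: dle.
  rewrite !altc_decr; try by [exact: sv_decr|exact: shift_decr].
  rewrite !shift_eq -natrM mulnb; congr (nat_of_bool _)%:R.
  apply/andP/andP => [[/forallP h1 /forallP h2]|[/eqP -> /eqP <-]].
    split; apply/eqP.
      apply: arr_ext => r j rN jN; rewrite av0 //; case: eqP => [<-|ne].
        have [<- _] := dd _ rN; exact/eqP/(h1 (Ordinal rN)).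
      case: (ltngtP r j) ne => // h _; [exact: latt1_high|exact: ssyt_low].
    apply: arr_ext => -[|r] j // _ jN; have [e1 e2] := dd _ jN.
    by rewrite -(eqP (h1 (Ordinal jN))) /= e1 -e2; apply/eqP/(h2 (Ordinal jN)).
  have [dd0 row0'] := (diag d0 d0s d0l, row0).
  split; apply/forallP => i; rewrite ?row0' //.
  by have [-> <-] := dd0 _ (ltn_ord i); rewrite row0'.
rewrite (eq_bigr (fun d => ((d == d0) && (p == q))%:R)); last first.
  by move=> d /and3P[ds _ dl]; apply: val.
have P0 : [&& ssyt d0, (\sum_(0 <= r < N) rowsum d0 r)%N == n & latt1 d0].
  rewrite d0s d0l andbT /=; case/andP: pP => /eqP pn _; apply/eqP.
  rewrite -[RHS]pn; apply: eq_big_nat => r /andP[_ rN]; exact: row0.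
rewrite (bigD1 d0) //= eqxx /= big1 ?addr0 // => d /andP[_ /negbTE ->] //.
Qed.

(** All the terms are 0 or 1, and the diagonal array contributes 1. *)
Lemma ip_FX_neq0 p : ispt p -> ipn (@Fc n N (av p 0)) (Xc N (sv p)) != 0.
Proof.
move=> pP; have /andP[/eqP pn _] := pP; rewrite ip_FX //.
rewrite (eq_bigr (fun d : arr N N n =>
  ([forall i : 'I_N, rowsum d i == av p 0 i])%:R)); last first.
  move=> d /andP[ds _]; rewrite altc_decr ?shift_eq //; first last.
    exact: sv_decr.
  by apply: shift_decr => i; apply: ssyt_rowsum.
rewrite -natr_sum pnatr_eq0 -lt0n (bigD1 (diag_arr p)) /=.
  rewrite (_ : [forall i : 'I_N, _]) //.
  by apply/forallP => i; rewrite rowsum_diag.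
by rewrite diag_ssyt //=; apply/forallP => i; rewrite colsum_diag.
Qed.

Definition spanX (g : 'S_n -> algC) := exists a : arr 1 N n -> algC,
  forall s, g s = \sum_(p | ispt p) a p * Xc N (sv p) s.

Lemma spanX_sum (J : finType) (P : pred J) (a : J -> algC) (F : J -> 'S_n -> algC) :
  (forall j, P j -> spanX (F j)) -> spanX (fun s => \sum_(j | P j) a j * F j s).
Proof.
move=> h; have /choice[b bP] : forall j : J, exists b : arr 1 N n -> algC,
    P j -> forall s, F j s = \sum_(p | ispt p) b p * Xc N (sv p) s.
  move=> j; case: (boolP (P j)) => [/h[b bP]|_]; first by exists b.
  by exists (fun=> 0).
exists (fun p => \sum_(j | P j) a j * b j p) => s.
rewrite [RHS](eq_bigr (fun p => \sum_(j | P j) a j * (b j p * Xc N (sv p) s)));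
  last by move=> p _; rewrite big_distrl /=; apply: eq_bigr => j _; rewrite mulrA.
rewrite exchange_big /=; apply: eq_bigr => j Pj.
by rewrite -big_distrr /= -bP.
Qed.

Lemma spanX_D g h : spanX g -> spanX h -> spanX (fun s => g s + h s).
Proof.
case=> a aP [b bP]; exists (fun p => a p + b p) => s; rewrite aP bP -big_split /=.
by apply: eq_bigr => p _; rewrite mulrDl.
Qed.

Lemma spanX_Z k g : spanX g -> spanX (fun s => k * g s).
Proof.
case=> a aP; exists (fun p => k * a p) => s; rewrite aP big_distrr /=.
by apply: eq_bigr => p _; rewrite mulrA.
Qed.

Lemma spanX_0 : spanX (fun=> 0).
Proof. by exists (fun=> 0) => s; rewrite big1 // => p _; rewrite mul0r. Qed.

Lemma spanX_X p : ispt p -> spanX (Xc N (sv p)).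
Proof.
move=> pP; exists (fun q => (q == p)%:R) => s.
rewrite (bigD1 p) //= eqxx mul1r big1 ?addr0 // => q /andP[_ /negbTE ->].
by rewrite mul0r.
Qed.

Lemma perm_sum_lt (w : 'S_N) : w != 1%g ->
  (\sum_(i < N) i * w i < \sum_(i < N) i * i)%N.
Proof.
move=> w1.
have h : (\sum_(i < N) 2 * (i * w i) <= \sum_(i < N) (i ^ 2 + w i ^ 2)
    ?= iff [forall (i | true), nat_of_ord i == w i])%N.
  by apply: leqif_sum => i _; apply: nat_Cauchy.
have e2 : (\sum_(i < N) (i ^ 2 + w i ^ 2) = 2 * \sum_(i < N) i * i)%N.
  rewrite big_split /= [X in (_ + X)%N](_ : _ = \sum_(i < N) i ^ 2)%N.
    by rewrite addnn -mul2n; congr (_ * _)%N; apply: eq_bigr => i _; rewrite mulnn.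
  by rewrite [RHS](reindex_inj (@perm_inj _ w)).
have : (\sum_(i < N) 2 * (i * w i) < 2 * \sum_(i < N) i * i)%N.
  rewrite -e2 (ltn_leqif h); apply/negP => /forallP e.
  case/eqP: w1; apply/permP => i; rewrite perm1; apply: val_inj.
  by rewrite /= -(eqP (implyP (e i) isT)).
by rewrite -big_distrr /= ltn_pmul2l.
Qed.

(* Triangularity: the terms of [Xc (shift th)] other than [Fc th] have a
   strictly smaller weighted sum of the indices. *)
Lemma Fc_spanX th : (\sum_(0 <= i < N) th i)%N = n -> spanX (Fc N th).
Proof.
have [m] := ubnP (\sum_(i < N) i * th i)%N.
elim: m th => // m IH th; rewrite ltnS => mm sth.
have relabel (w : 'S_N) ka : (\sum_(0 <= i < N) ka i)%N = n ->
    (\sum_(i < N) i * ka (w i) < m)%N -> spanX (Fc N ka).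
  move=> ska km.
  pose kw := fun i => if insub i is Some i' then ka (val (w i')) else 0%N.
  have -> : Fc N ka = @Fc n N kw.
    by apply: functional_extensionality_dep => s; rewrite Fc_relabel.
  have kwE (i : 'I_N) : kw i = ka (w i) by rewrite /kw valK.
  apply: IH; first by rewrite (eq_bigr (fun i : 'I_N => i * ka (w i))%N) // => i _; rewrite kwE.
  rewrite -ska !big_mkord [RHS](reindex_inj (@perm_inj _ w)) /=.
  by apply: eq_bigr => i _; rewrite kwE.
have tn i : (i < N)%N -> (th i <= n)%N.
  by move=> iN; rewrite -[X in (_ <= X)%N]sth; apply: leq_sum_nat.
have [/forallP dth|] := boolP [forall i : 'I_N, (i.+1 < N)%N ==> (th i.+1 <= th i)%N];
  last first.
  case/forallPn => i; rewrite negb_imply -ltnNge => /andP[iN lti].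
  (* At an ascent of [th], exchanging the two letters moves the larger multiplicity to the smaller
     index and lowers the weighted sum. *)
  pose i1 := Ordinal iN; apply: (relabel (tperm i i1)) => //.
  apply: leq_trans mm.
  have ii : i1 != i by rewrite -val_eqE /=; lia.
  rewrite (bigD1 i) //= (bigD1 i1) //= [X in (_ < X)%N](bigD1 i) //=.
  rewrite [X in (_ < _ + X)%N](bigD1 i1) //= tpermL tpermR /=.
  rewrite [X in (_ + (_ + X) < _)%N](eq_bigr (fun j : 'I_N => j * th j)%N).
    by lia.
  by move=> j /andP[j0 j1]; rewrite tpermD // eq_sym.
pose p := row_arr th.
have pE i : (i < N)%N -> av p 0 i = th i by apply: av_row_arr.
have pP : ispt p.
  apply/andP; split.
    by rewrite -[X in _ == X]sth; apply/eqP; apply: eq_big_nat => i /andP[_ iN]; rewrite pE.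
  apply/forallP => i; apply/implyP => iN; rewrite !pE //.
  by apply: (implyP (dth i)).
pose Q (c : arr 1 N n) :=
  [&& rowsum c 0 == n, c != p & altc N (sv p) (shift N (av c 0)) != 0].
have -> : @Fc n N th = fun s => Xc N (sv p) s +
    -1 * \sum_(c | Q c) altc N (sv p) (shift N (av c 0)) * Fc N (av c 0) s.
  apply: functional_extensionality_dep => s; rewrite Xc_Fc (bigD1 p) /=; last first.
    by case/andP: pP.
  rewrite altc_decr; try exact: sv_decr.
  rewrite shift_eq; have -> : [forall i : 'I_N, av p 0 i == av p 0 i].
    exact/forallP.
  rewrite mul1r mulN1r (eq_Fc s pE) -addrA -[LHS]addr0; congr (_ + _).
  apply/esym/eqP; rewrite subr_eq0 /Q; apply/eqP.
  rewrite (bigID (fun c => altc N (sv p) (shift N (av c 0)) != 0)) /=.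
  rewrite [X in _ + X]big1 ?addr0; last first.
    by move=> c /andP[_]; rewrite negbK => /eqP ->; rewrite mul0r.
  by apply: eq_bigl => c; rewrite andbA.
apply: spanX_D; first exact: spanX_X.
apply/spanX_Z/spanX_sum => c /and3P[/eqP cn cp /altc_neq0[w wP]].
apply: (relabel w^-1%g) => //.
have w1 : (w^-1)%g != 1%g.
  apply/eqP => /(congr1 (fun u => u^-1)%g); rewrite invgK invg1 => w1.
  case/eqP: cp; apply: arr_ext => -[|r] j // _ jN.
  by have := wP (Ordinal jN); rewrite w1 perm1 /sv /shift /=; lia.
(* The shifted content of c is a permutation of the shifted [th]. After relabelling by w^-1 the sum
   of i * (N - i) is traded for that of i * (N - w^-1 i), which is larger by the rearrangement
   inequality, so the weight of the content drops. *)
apply: leq_trans mm; have lt := perm_sum_lt w1.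
have e1 : (\sum_(i < N) i * av c 0 ((w^-1)%g i) + \sum_(i < N) i * (N - (w^-1)%g i) =
    \sum_(i < N) i * th i + \sum_(i < N) i * (N - i))%N.
  rewrite -!big_split /=; apply: eq_bigr => i _; rewrite -!mulnDr; congr (_ * _)%N.
  by have := wP ((w^-1)%g i); rewrite permKV /sv /shift pE.
have e2 (u : 'S_N) : (\sum_(i < N) i * (N - u i) + \sum_(i < N) i * u i =
    \sum_(i < N) i * N)%N.
  rewrite -big_split /=; apply: eq_bigr => i _; rewrite -mulnDr subnK //.
  exact: ltnW.
have e3 : (\sum_(i < N) i * (N - i) + \sum_(i < N) i * i = \sum_(i < N) i * N)%N.
  by rewrite -(e2 1%g); congr (_ + _)%N; apply: eq_bigr => i _; rewrite perm1.
by move: (e2 (w^-1)%g) e3 e1 lt; lia.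
Qed.

Lemma rowsum_ispt (d : arr N N n) : ssyt d ->
  (\sum_(0 <= j < N) colsum d j)%N = n ->
  (forall i, (i < N)%N -> rowsum d i <= n)%N /\ ispt (row_arr (rowsum d)).
Proof.
move=> ds; rewrite -sum_rowsum => sn.
have dn i : (i < N)%N -> (rowsum d i <= n)%N.
  by move=> iN; rewrite -[X in (_ <= X)%N]sn; apply: leq_sum_nat.
split=> //; apply/andP; split.
  rewrite -[X in _ == X]sn; apply/eqP; apply: eq_big_nat => i /andP[_ iN].
  by rewrite av_row_arr.
apply/forallP => r; apply/implyP => rN; rewrite !av_row_arr //.
exact: ssyt_rowsum.
Qed.

(** Young's rule. [Fc_spanX] provides some coefficients, orthonormality identifies them as inner
    products, and [ip_FX] computes these as numbers of tableaux. *)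
Lemma Fc_expand th s : (\sum_(0 <= i < N) th i)%N = n ->
  @Fc n N th s = \sum_(d : arr N N n | ssyt d && [forall k : 'I_N, colsum d k == th k])
    Xc N (shift N (rowsum d)) s.
Proof.
move=> sth; have [a aP] := Fc_spanX sth.
have aE p : ispt p -> a p = ipn (@Fc n N th) (Xc N (sv p)).
  move=> pP; have -> : @Fc n N th = fun s => \sum_(p | ispt p) a p * Xc N (sv p) s.
    exact: functional_extensionality_dep.
  rewrite ip_sumX (bigD1 p) //= ip_XX // eqxx mulr1 big1 ?addr0 // => q.
  by case/andP=> qP /negbTE e; rewrite ip_XX // e mulr0.
have rowP (d : arr N N n) : ssyt d && [forall k : 'I_N, colsum d k == th k] ->
    (forall i, (i < N)%N -> rowsum d i <= n)%N /\ ispt (row_arr (rowsum d)).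
  case/andP=> ds /forallP dc; apply: rowsum_ispt => //.
  rewrite -[RHS]sth; apply: eq_big_nat => i /andP[_ iN].
  exact/eqP/(dc (Ordinal iN)).
rewrite aP [RHS](partition_big (fun d => row_arr (rowsum d)) ispt) /=; last first.
  by move=> d /rowP[].
apply: eq_bigr => p pP; rewrite aE // ip_FX // big_distrl /=.
rewrite [RHS]big_mkcondr /=; apply: eq_bigr => d dP; have [dn dpt] := rowP d dP.
rewrite altc_decr; first last.
- exact: sv_decr.
- by apply: shift_decr => i iN; apply: ssyt_rowsum => //; case/andP: dP.
rewrite shift_eq row_arr_eq //.
have -> : [forall i : 'I_N, rowsum d i == av p 0 i] =
    [forall i : 'I_N, av p 0 i == rowsum d i].
  by apply: eq_forallb => i; rewrite eq_sym.
case: ifP => [/forallP h|_]; last by rewrite mul0r.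
rewrite mul1r; apply: eq_bigr => f _; apply: altc_ext => // i iN.
by rewrite /sv /shift (eqP (h (Ordinal iN))).
Qed.

End Ortho.

(** * The irreducible characters of the symmetric group *)

Lemma cnt_map n M (f : {ffun 'I_n -> 'I_M}) (g : nat -> nat) i :
  (forall x : 'I_n, val (f x) = g x) -> cnt f i = count_mem i (mkseq g n).
Proof.
move=> fg; rewrite /cnt -sum1_count [RHS]big_mkcond /= big_map.
rewrite -[n in iota 0 n]subn0 -/(index_iota 0 n) big_mkord; apply: eq_bigr => x _; rewrite /= -fg.
by case: eqP.
Qed.

Lemma reshape_index_seq rho :
  mkseq (reshape_index rho) (sumn rho) =
  flatten (mkseq (fun i => nseq (nth 0%N rho i) i) (size rho)).
Proof.
have sh : shape (mkseq (fun i => nseq (nth 0%N rho i) i) (size rho)) = rho.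
  rewrite /shape -map_comp (eq_map (g := nth 0%N rho)); first exact: mkseq_nth.
  by move=> i /=; rewrite size_nseq.
apply: (@eq_from_nth _ 0%N); first by rewrite size_mkseq size_flatten sh.
move=> x; rewrite size_mkseq => xn; rewrite nth_mkseq // nth_flatten sh.
rewrite nth_mkseq ?reshape_indexP // nth_nseq.
by rewrite reshape_offsetP.
Qed.

Lemma reshape_offset_seq rho :
  mkseq (reshape_offset rho) (sumn rho) = flatten [seq iota 0 a | a <- rho].
Proof.
have sh : shape [seq iota 0 a | a <- rho] = rho.
  rewrite /shape -map_comp -[RHS]map_id; apply: eq_map => i /=.
  by rewrite size_iota.
apply: (@eq_from_nth _ 0%N); first by rewrite size_mkseq size_flatten sh.
move=> x; rewrite size_mkseq => xn; rewrite nth_mkseq // nth_flatten sh.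
by rewrite (nth_map 0%N) ?reshape_indexP // nth_iota ?reshape_offsetP.
Qed.

Section YoungFunctions.

Variables (n N : nat) (rho : seq nat).
Hypotheses (rn : sumn rho = n) (rN : (size rho <= N)%N).

Lemma young_fun_lt (x : 'I_n) : (reshape_index rho x < N)%N.
Proof. by apply: leq_trans rN; rewrite reshape_indexP // rn. Qed.

Definition young_fun : {ffun 'I_n -> 'I_N} := [ffun x => Ordinal (young_fun_lt x)].

Lemma cnt_young_fun i : cnt young_fun i = nth 0%N rho i.
Proof.
rewrite (@cnt_map _ _ _ (reshape_index rho)); last by move=> x; rewrite ffunE.
rewrite -rn reshape_index_seq count_flatten -map_comp sumnE big_map.
rewrite -[X in iota 0 X]subn0 -/(index_iota 0 (size rho)); have [ir|ir] := ltnP i (size rho).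
  rewrite (@sum_one _ _ i) //=; first by rewrite count_nseq /= eqxx mul1n.
  by move=> j _ /negbTE ji; rewrite count_nseq /= ji.
rewrite nth_default // big_nat_cond big1 // => j; rewrite andbT => /andP[_ jr].
by rewrite /= count_nseq /=; case: eqP => // e; lia.
Qed.

Lemma mem_young s : (s \in young n rho) = fixd young_fun s.
Proof.
rewrite inE; apply: eq_forallb => x; rewrite !ffunE -val_eqE /=.
by [].
Qed.

(** The functions of content [rho] are a model of the cosets of the Young subgroup:
    [fperm young_fun] is onto them, with fibres of the order of the subgroup. *)
Lemma Ind_young s : 'Ind[[set: 'S_n]] (1 : 'CF(young n rho)) s =
  Fc N (nth 0%N rho) s.
Proof.
rewrite cfIndE ?subsetT //.
have -> : \sum_(y in [set: 'S_n]) (1 : 'CF(young n rho)) (s ^ y)%g =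
    \sum_(y : 'S_n | fixd (fperm young_fun y) s) 1.
  rewrite big_mkcond [RHS]big_mkcond /=; apply: eq_bigr => y _.
  rewrite inE cfun1E mem_young.
  have -> : fixd young_fun (s ^ y)%g = fixd (fperm young_fun y) s.
    apply/forallP/forallP => h x.
      by have := h (y x); rewrite conjgE !permM permK ![fperm _ _ _]ffunE.
    by have := h (y^-1%g x); rewrite ![fperm _ _ _]ffunE conjgE !permM permKV.
  by case: fixd.
rewrite (partition_big (fperm young_fun) (fun f => fixd f s &&
  [forall i : 'I_N, cnt f i == nth 0%N rho i])) /=; last first.
  move=> y ->; apply/forallP => i; by rewrite cnt_fperm cnt_young_fun.
rewrite big_distrr /=; apply: eq_bigr => f /andP[fs /forallP fc].
have [t0 ft] : exists t, f = fperm young_fun t.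
  apply: cnt_eq_fperm => i iN; rewrite cnt_young_fun.
  by rewrite -(eqP (fc (Ordinal iN))).
rewrite sumr_const (_ : #|_| = #|young n rho|) ?mulVf //.
  by rewrite pnatr_eq0 -lt0n cardG_gt0.
rewrite -[RHS](card_imset _ (mulgI t0)); apply: eq_card => t.
apply/andP/imsetP => [[_ /eqP h]|[y]].
  exists (t0^-1 * t)%g; last by rewrite mulKVg.
  rewrite mem_young; apply/forallP => x; rewrite permM; apply/eqP.
  have := congr1 (fun g : {ffun 'I_n -> 'I_N} => g (t0^-1%g x)) (etrans h ft).
  by rewrite ![fperm _ _ _]ffunE permKV.
rewrite mem_young => /forallP h ->.
have e : fperm young_fun (t0 * y) = f.
  apply/ffunP => x; rewrite ft ![fperm _ _ _]ffunE permM; exact/eqP/h.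
by rewrite e fs eqxx.
Qed.

End YoungFunctions.

(** If both functions of a pair take equal values at x and y, multiplication by the transposition of
    x and y pairs off elements of opposite sign in the common stabiliser. If no such x and y exist,
    the common stabiliser is trivial. *)
Lemma sum_sign_Fc n M M' th th' :
  \sum_(s : 'S_n) Fc M th s * ((-1) ^+ odd_perm s * Fc M' th' s) =
  (#|[set p : {ffun 'I_n -> 'I_M} * {ffun 'I_n -> 'I_M'} |
     [&& [forall i : 'I_M, cnt p.1 i == th i],
         [forall i : 'I_M', cnt p.2 i == th' i] &
         injectiveb (fun x => (p.1 x, p.2 x))]]|)%:R.
Proof.
have -> : \sum_(s : 'S_n) Fc M th s * ((-1) ^+ odd_perm s * Fc M' th' s) =
  \sum_(s : 'S_n) \sum_(p : {ffun 'I_n -> 'I_M} * {ffun 'I_n -> 'I_M'} |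
     [&& [forall i : 'I_M, cnt p.1 i == th i],
         [forall i : 'I_M', cnt p.2 i == th' i] & fixd p.1 s && fixd p.2 s])
     (-1) ^+ odd_perm s.
  apply: eq_bigr => s _; rewrite mulrCA /Fc big_distrlr /= pair_big /=.
  rewrite big_distrr /=; apply: eq_big => [p|p _]; last by rewrite !mulr1.
  by rewrite andbACA andbC -andbA.
rewrite (exchange_big_dep (fun p => [forall i : 'I_M, cnt p.1 i == th i] &&
  [forall i : 'I_M', cnt p.2 i == th' i])) /=; last first.
  by move=> s p _ /and3P[-> ->].
rewrite -sum1_card natr_sum /=.
rewrite [RHS](eq_bigl (fun p : {ffun 'I_n -> 'I_M} * {ffun 'I_n -> 'I_M'} =>
  ([forall i : 'I_M, cnt p.1 i == th i] && [forall i : 'I_M', cnt p.2 i == th' i])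
  && injectiveb (fun x => (p.1 x, p.2 x)))); last first.
  by move=> p; rewrite inE andbA.
rewrite [RHS]big_mkcondr /=; apply: eq_bigr => p /andP[p1 p2].
rewrite (eq_bigl (fun s => fixd p.1 s && fixd p.2 s)); last first.
  by move=> s; rewrite p1 p2.
case: ifP => [/injectiveP inj|/negbT ninj].
  rewrite (bigD1 1%g) /=; last first.
    by apply/andP; split; apply/forallP => x; rewrite perm1.
  rewrite odd_perm1 expr0 big1 ?addr0 // => s /andP[/andP[/forallP h1 /forallP h2]].
  case/eqP; apply/permP => x; rewrite perm1; apply: inj.
  by rewrite (eqP (h1 x)) (eqP (h2 x)).
have [x [y [xy e1 e2]]] : exists x y : 'I_n,
    [/\ x != y, p.1 x = p.1 y & p.2 x = p.2 y].
  have /injectivePn[x [y xy [e1 e2]]] : ~~ injectiveb (fun x => (p.1 x, p.2 x)).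
    exact: ninj.
  by exists x, y.
apply: (@sum_sign_reversing _ _ _ (fun s => tperm x y * s)%g) => s /andP[h1 h2].
have fx K (f : {ffun 'I_n -> 'I_K}) : f x = f y -> fixd f s -> fixd f (tperm x y * s)%g.
  move=> fxy /forallP h; apply/forallP => z; rewrite permM (eqP (h _)).
  by case: tpermP => [->|->|//]; rewrite fxy.
split; first by rewrite !fx.
  by rewrite mulgA tperm2 mul1g.
by rewrite odd_mul_tperm xy /= signrN.
Qed.

Lemma sumn_uniq_ge (s : seq nat) : uniq s -> (\sum_(t < size s) t <= sumn s)%N.
Proof.
move=> us; have ps : perm_eq (sort leq s) s by apply/permPl/perm_sort.
rewrite -(perm_sumn ps) -(perm_size ps).
have : sorted ltn (sort leq s).
  by rewrite ltn_sorted_uniq_leq sort_uniq us sort_sorted //; apply: leq_total.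
move: (sort leq s) => t st; rewrite sumnE (big_nth 0%N) big_mkord.
apply: leq_sum => i _; case: i => i /=; elim: i => // i IH it.
by apply: leq_ltn_trans (IH (ltnW it)) _; move/(sortedP 0%N): st; apply.
Qed.

Lemma sum_ltn b J : (b <= J)%N ->
  (\sum_(0 <= j < J) if (j < b)%N then 1%N else 0%N)%N = b.
Proof.
move=> bJ; rewrite (@big_cat_nat _ _ _ b) //=.
rewrite (eq_big_nat _ _ (F2 := fun=> 1%N)); last by move=> i /andP[_ ->].
rewrite [X in (_ + X)%N]big_nat_cond [X in (_ + X)%N]big1 ?addn0.
  by rewrite sum_nat_const_nat subn0 muln1.
by move=> i; rewrite andbT => /andP[bi _]; rewrite ltnNge bi.
Qed.

(** Both sides add up the row index over the cells of the diagram, by columns on the left and by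
    rows on the right. Removing the first row lowers every remaining row index by one. *)
Lemma sum_columns (rho : seq nat) J : is_part rho -> (head 0 rho <= J)%N ->
  (\sum_(j < J) \sum_(t < count (leq j.+1) rho) t =
   \sum_(i < size rho) i * nth 0 rho i)%N.
Proof.
elim: rho => [|a sh IH] /= aP aJ.
  by rewrite big1 ?big_ord0 // => j _; rewrite big_ord0.
have [shP sha] : is_part sh /\ (head 0 sh <= a)%N.
  case/andP: aP => sa; rewrite inE negb_or => /andP[_ n0]; split.
    by rewrite /is_part n0 (path_sorted sa).
  by case: (sh) sa => //= b sh' /andP[].
have shall j : (a <= j)%N -> count (leq j.+1) sh = 0%N.
  move=> aj; apply/eqP; rewrite -leqn0 leqNgt -has_count; apply/hasPn => b bsh.
  have : all (geq a) sh.
    case/andP: aP => sa _; apply: (order_path_min _ sa) => x y z /= h1 h2.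
    exact: leq_trans h2 h1.
  by move/allP/(_ _ bsh) => /=; lia.
rewrite big_ord_recl /= mul0n add0n.
have -> : (\sum_(i < size sh) (bump 0 i) * nth 0 sh i =
    \sum_(i < size sh) i * nth 0 sh i + sumn sh)%N.
  rewrite sumnE (big_nth 0%N) big_mkord -big_split /=; apply: eq_bigr => i _.
  by rewrite /bump /= mulnDl mul1n addnC.
have -> : sumn sh = (\sum_(j < J) count (leq j.+1) sh)%N.
  rewrite sumnE; under [RHS]eq_bigr => j _ do rewrite -sum1_count big_mkcond /=.
  rewrite exchange_big /=; apply: eq_big_seq => b bsh.
  have bJ : (b <= J)%N.
    rewrite leqNgt; apply/negP => Jb.
    have aJ' : (a <= b.-1)%N by lia.
    have := shall _ aJ'; have b0 : (0 < b)%N by lia.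
    rewrite prednK // => /eqP; rewrite -leqn0 leqNgt -has_count => /hasP; apply.
    by exists b.
  by rewrite -(big_mkord xpredT (fun j => if (j < b)%N then 1%N else 0%N)) sum_ltn.
rewrite -(IH shP (leq_trans sha aJ)) -big_split /=; apply: eq_bigr => j _.
have [ja|ja] := ltnP j a; last by rewrite shall // big_ord0.
by rewrite add1n big_ord_recr.
Qed.

Lemma altc_int N v u : altc N v u \is a Num.int.
Proof.
rewrite /altc /determinant rpred_sum // => w _; rewrite rpredM ?rpred_sign //.
by rewrite rpred_prod // => i _; rewrite mxE rpred_nat.
Qed.

Section IrreducibleX.

Variables n N : nat.
Notation G := [set: 'S_n].

Definition perm_char (c : arr 1 N n) : 'CF(G) :=
  'Ind[G] (1 : 'CF(young n (mkseq (av c 0) N))).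

Lemma perm_charE c s : rowsum c 0 = n -> perm_char c s = Fc N (av c 0) s.
Proof.
move=> cn; rewrite /perm_char (@Ind_young n N) ?size_mkseq //; last first.
  rewrite sumnE big_map -[X in iota 0 X]subn0 -/(index_iota 0 N).
  exact: cn.
by apply: eq_Fc => i iN; rewrite nth_mkseq.
Qed.

Lemma perm_char_char c : perm_char c \is a character.
Proof. by apply: cfInd_char; apply: cfun1_char. Qed.

Definition XF v : 'CF(G) := \sum_(c : arr 1 N n | rowsum c 0 == n)
  altc N v (shift N (av c 0)) *: perm_char c.

Lemma XFE v s : XF v s = Xc N v s.
Proof.
rewrite /XF sum_cfunE Xc_Fc; apply: eq_bigr => c /eqP cn.
by rewrite cfunE perm_charE.
Qed.

Lemma XF_vchar v : XF v \in 'Z[irr G]%g.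
Proof.
apply: rpred_sum => c _; apply: scale_zchar; first exact: altc_int.
exact/char_vchar/perm_char_char.
Qed.

Lemma cfdot_ipn (phi psi : 'CF(G)) (f g : 'S_n -> algC) :
  (forall s, phi s = f s) -> (forall s, psi s = g s) ->
  (forall s, (g s)^* = g s) -> '[phi, psi] = ipn f g.
Proof.
move=> pf pg gr; rewrite cfdotE cardsT card_Sn /ipn; congr (_ * _).
by apply: eq_big => [s|s _]; rewrite ?inE // pf pg gr.
Qed.

Lemma Fc_conj M th (s : 'S_n) : (Fc M th s)^* = Fc M th s.
Proof. by rewrite /Fc sumr_const conj_natr // rpred_nat. Qed.

Lemma Xc_conj v (s : 'S_n) : (Xc N v s)^* = Xc N v s.
Proof.
by rewrite /Xc; apply/conj_intr/rpred_sum => f _; apply: altc_int.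
Qed.

(** A virtual character of norm 1 is irreducible up to sign. The negative sign is excluded because
    the inner product with [perm_char p] is nonnegative by [ip_FX] and nonzero by [ip_FX_neq0]. *)
Lemma XF_irr (p : arr 1 N n) : ispt p -> exists i, XF (sv p) = 'chi_i.
Proof.
move=> pP; have norm1 : '[XF (sv p)] = 1.
  by rewrite (cfdot_ipn (XFE _) (XFE _) (Xc_conj _)) ip_XX // eqxx.
have [b [i e]] := vchar_norm1P (XF_vchar _) norm1; exists i.
case: b e => e; last by rewrite e expr0 scale1r.
have pn : rowsum p 0 = n by case/andP: pP => /eqP.
have h0 := ip_FX_neq0 pP.
have h1 : '[perm_char p, 'chi_i] = - ipn (@Fc n N (av p 0)) (Xc N (sv p)).
  rewrite -(cfdot_ipn (fun s => perm_charE s pn) (XFE _) (Xc_conj _)) e.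
  by rewrite expr1 scaleN1r cfdotNr opprK.
have h2 : ipn (@Fc n N (av p 0)) (Xc N (sv p)) >= 0.
  rewrite ip_FX // sumr_ge0 // => d /andP[ds _].
  rewrite altc_decr ?ler0n //; first last.
    exact: sv_decr.
  by apply: shift_decr => j; apply: ssyt_rowsum.
have := Cnat_cfdot_char_irr i (perm_char_char p).
move/natr_ge0; rewrite h1 oppr_ge0 => h3.
by case/eqP: h0; apply/eqP; rewrite eq_le h3 h2.
Qed.

(** Multiplicities in characters are nonnegative, so the contribution of the common constituent
    cannot be cancelled. *)
Lemma constt_cfdot (phi psi : 'CF(G)) i : phi \is a character ->
  psi \is a character -> i \in irr_constt phi -> i \in irr_constt psi ->
  '[phi, psi] != 0.
Proof.
move=> cphi cpsi; rewrite !irr_consttE => n1 n2.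
rewrite cfdot_sum_irr (bigD1 i) //=.
have nn (chi : 'CF(G)) j : chi \is a character -> 0 <= '[chi, 'chi_j].
  by move=> cc; apply: natr_ge0; apply: Cnat_cfdot_char_irr.
have cj j : '[psi, 'chi_j]^* = '[psi, 'chi_j].
  by apply: conj_natr; apply: Cnat_cfdot_char_irr.
rewrite gt_eqF // ltr_pwDl //.
  by rewrite cj mulr_gt0 // lt_def ?n1 ?n2 nn.
by apply: sumr_ge0 => j _; rewrite cj mulr_ge0 ?nn.
Qed.

End IrreducibleX.

(** * Identification of [chi] with the alternating sum *)

Section ChiX.

Variables (n N : nat) (rho : seq nat).
Hypotheses (rho_part : is_part rho) (rn : sumn rho = n) (rN : (size rho <= N)%N).
Notation G := [set: 'S_n].

Let p : arr 1 N n := row_arr n N (nth 0%N rho).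
Let rho' := conj_part rho.

Lemma nth_le_sumn s i : (nth 0%N s i <= sumn s)%N.
Proof.
elim: s i => [|a s IH] [|i] //=; first exact: leq_addr.
exact: leq_trans (IH i) (leq_addl _ _).
Qed.

Lemma av_rho i : (i < N)%N -> av p 0 i = nth 0%N rho i.
Proof. by apply: av_row_arr => j _; rewrite -rn nth_le_sumn. Qed.

Lemma nth_rho_le i : (nth 0%N rho i.+1 <= nth 0%N rho i)%N.
Proof.
have [ir|ir] := ltnP i.+1 (size rho); last by rewrite nth_default.
by case/andP: rho_part => /(sortedP 0%N) h _; apply: h.
Qed.

Lemma sum_nth_wide (s : seq nat) M : (size s <= M)%N ->
  (\sum_(0 <= i < M) nth 0%N s i)%N = sumn s.
Proof.
move=> sM; rewrite (@big_cat_nat _ _ _ (size s)) //= sumnE [RHS](big_nth 0%N).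
rewrite [X in (_ + X)%N]big_nat_cond [X in (_ + X)%N]big1 ?addn0 // => i.
by rewrite andbT => /andP[si _]; rewrite nth_default.
Qed.

Lemma rho_ispt : ispt p.
Proof.
apply/andP; split.
  apply/eqP; rewrite -[RHS]rn -(sum_nth_wide rN).
  by apply: eq_big_nat => i /andP[_ iN]; rewrite av_rho.
apply/forallP => i; apply/implyP => iN.
by rewrite !av_rho ?(ltnW iN) // nth_rho_le.
Qed.

Lemma sumn_conj_part : sumn rho' = n.
Proof.
have := reshape_offset_seq rho => /(congr1 size); rewrite size_mkseq rn => ->.
rewrite size_flatten /shape -map_comp /rho' /conj_part.
rewrite (eq_map (g := id)) ?map_id; last by move=> a /=; rewrite size_iota.
rewrite !sumnE big_map; under eq_bigr => j _ do rewrite -sum1_count big_mkcond /=.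
rewrite exchange_big /=; apply: eq_big_seq => b br.
have bh : (b <= head 0 rho)%N.
  case: (rho) rho_part br => //= a s /andP[sa _]; rewrite inE => /orP[/eqP -> //|bs].
  have : all (geq a) s.
    apply: (order_path_min _ sa) => x y z /= h1 h2; exact: leq_trans h2 h1.
  by move/allP/(_ _ bs).
by rewrite -[X in iota 0 X]subn0 -/(index_iota 0 (head 0%N rho)) sum_ltn.
Qed.

Definition sgn_young : 'CF(G) := 'Ind[G] ('Res[young n rho'] (sign_char n)).

Lemma sign_charE s : sign_char n s = (-1) ^+ odd_perm s.
Proof. by rewrite /sign_char cfunElock. Qed.

(** The projection formula: inducing a restricted character multiplies it by the permutation
    character. *)
Lemma sgn_youngE s : sgn_young s =
  (-1) ^+ odd_perm s * Fc (size rho') (nth 0%N rho') s.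
Proof.
rewrite /sgn_young -['Res[_] _]mul1r cfIndM ?subsetT // cfunE sign_charE mulrC.
by rewrite (@Ind_young n (size rho')) // sumn_conj_part.
Qed.

Lemma sign_repr_subproof :
  mx_repr G (fun s : 'S_n => ((-1) ^+ odd_perm s)%:M : 'M[algC]_1).
Proof.
split=> [|s t _ _]; first by rewrite odd_perm1.
by rewrite odd_permM signr_addb -scalar_mxM.
Qed.

Lemma sign_char_char : sign_char n \is a character.
Proof.
have -> : sign_char n = cfRepr (MxRepresentation sign_repr_subproof).
  apply/cfunP => s; rewrite sign_charE cfunE inE mulr1n /=.
  by rewrite mxtrace_scalar mulr1n.
exact: cfRepr_char.
Qed.

Lemma sgn_young_char : sgn_young \is a character.
Proof. exact/cfInd_char/cfRes_char/sign_char_char. Qed.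

Lemma cfdot_sgn_young (q : arr 1 N n) : rowsum q 0 = n ->
  '[perm_char q, sgn_young] = (n`!)%:R^-1 *
  (#|[set f : {ffun 'I_n -> 'I_N} * {ffun 'I_n -> 'I_(size rho')} |
     [&& [forall i : 'I_N, cnt f.1 i == av q 0 i],
         [forall i : 'I_(size rho'), cnt f.2 i == nth 0%N rho' i] &
         injectiveb (fun x => (f.1 x, f.2 x))]]|)%:R.
Proof.
move=> qn; rewrite (cfdot_ipn (fun s => perm_charE s qn) sgn_youngE).
  by rewrite /ipn sum_sign_Fc.
by move=> s; rewrite rmorphM /= rmorph_sign Fc_conj.
Qed.

Lemma offset_lt (x : 'I_n) : (reshape_offset rho x < size rho')%N.
Proof.
rewrite size_mkseq; have xr : (x < sumn rho)%N by rewrite rn.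
apply: leq_trans (reshape_offsetP xr) _.
elim: (reshape_index rho x) => [|i IH]; first by rewrite nth0.
exact: leq_trans (nth_rho_le i) IH.
Qed.

(** Number the cells of the diagram of [rho] by ['I_n]. The row and the column of a cell form an
    injective pair with the two contents that [cfdot_sgn_young] counts. *)
Lemma cells_sgn_young : '[perm_char p, sgn_young] != 0.
Proof.
rewrite cfdot_sgn_young; last by case/andP: rho_ispt => /eqP.
rewrite mulf_neq0 ?invr_eq0 ?fact_neq0 // pnatr_eq0 -lt0n.
apply/card_gt0P; exists (young_fun rn rN, [ffun x => Ordinal (offset_lt x)]).
rewrite inE /=; apply/and3P; split.
- by apply/forallP => i; rewrite cnt_young_fun av_rho.
- apply/forallP => j; rewrite (@cnt_map _ _ _ (reshape_offset rho)); last first.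
    by move=> x; rewrite ffunE.
  rewrite -{1}rn reshape_offset_seq count_flatten -map_comp sumnE big_map.
  rewrite nth_mkseq; last by apply: leq_trans (ltn_ord j) _; rewrite size_mkseq.
  rewrite -sum1_count [X in _ == X]big_mkcond /=; apply/eqP/eq_bigr => a _.
  rewrite /= count_uniq_mem ?iota_uniq // mem_iota add0n /=.
  by case: ltnP.
apply/injectiveP => x y; rewrite !ffunE => -[e1 e2]; apply: val_inj => /=.
by rewrite -(reshape_indexK rho x) -(reshape_indexK rho y) e1 e2.
Qed.

(** In an injective pair (f, g), f takes distinct values on each fibre of g. These fibres have the
    sizes of the columns of [rho], and m distinct naturals add up to at least 0 + 1 + ... + (m - 1);
    [sum_columns] gives the total of these bounds. *)
Lemma sgn_young_weight (q : arr 1 N n) : rowsum q 0 = n ->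
  '[perm_char q, sgn_young] != 0 ->
  (\sum_(i < N) i * av p 0 i <= \sum_(i < N) i * av q 0 i)%N.
Proof.
move=> qn; rewrite cfdot_sgn_young // mulf_eq0 negb_or => /andP[_].
rewrite pnatr_eq0 -lt0n => /card_gt0P[[f g]]; rewrite inE /=.
case/and3P => /forallP hf /forallP hg /injectiveP inj.
have weight (h : {ffun 'I_n -> 'I_N}) : (\sum_(x < n) h x = \sum_(i < N) i * cnt h i)%N.
  rewrite /cnt; under [RHS]eq_bigr => i _ do rewrite big_distrr /=.
  rewrite exchange_big /=; apply: eq_bigr => x _.
  rewrite (bigD1 (h x)) //= eqxx muln1 big1 ?addn0 // => i ix.
  by rewrite eq_sym; move: ix; rewrite -val_eqE /= => /negbTE ->; rewrite muln0.
have -> : (\sum_(i < N) i * av q 0 i = \sum_(x < n) f x)%N.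
  by rewrite weight; apply: eq_bigr => i _; rewrite (eqP (hf i)).
have -> : (\sum_(i < N) i * av p 0 i = \sum_(i < size rho) i * nth 0%N rho i)%N.
  rewrite -!(big_mkord xpredT (fun i => i * _ i)%N).
  rewrite (@big_cat_nat _ _ _ (size rho)) //= [X in (_ + X)%N]big_nat_cond.
  rewrite [X in (_ + X)%N]big1 ?addn0.
    by apply: eq_big_nat => i /andP[_ ir]; rewrite av_rho //; apply: leq_trans ir rN.
  by move=> i; rewrite andbT => /andP[ri iN]; rewrite av_rho // nth_default ?muln0.
rewrite -(@sum_columns rho (size rho')) //; last by rewrite size_mkseq.
rewrite [X in (_ <= X)%N](partition_big g xpredT) //=; apply: leq_sum => j _.
have -> : count (leq j.+1) rho = size [seq val (f x) | x <- enum [pred x | g x == j]].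
  rewrite size_map -cardE; have := eqP (hg j); rewrite nth_mkseq; last first.
    by apply: leq_trans (ltn_ord j) _; rewrite size_mkseq.
  move=> <-; rewrite -sum1_card [RHS]big_mkcond; apply: eq_bigr => x _.
  by rewrite inE -val_eqE /=; case: eqP.
apply: leq_trans (sumn_uniq_ge _) _; last first.
  by rewrite sumnE big_map big_enum.
rewrite map_inj_in_uniq ?enum_uniq // => x y; rewrite !mem_enum !inE.
move=> /eqP gx /eqP gy e; apply: inj; congr pair; last by rewrite gx gy.
exact: val_inj.
Qed.

(** An entry j lies in a row of index at most j, so the row indices of the cells add up to at most
    the sum of the entries. The hypothesis is the opposite inequality; equality then makes [d]
    diagonal. *)
Lemma ssyt_weight (d : arr N N n) :
  ssyt d -> (forall i, (i < N)%N -> colsum d i = av p 0 i) ->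
  (\sum_(i < N) i * av p 0 i <= \sum_(i < N) i * rowsum d i)%N ->
  forall i, (i < N)%N -> rowsum d i = av p 0 i.
Proof.
move=> ds dc.
have -> : (\sum_(i < N) i * av p 0 i = \sum_(j < N) \sum_(r < N) j * av d r j)%N.
  apply: eq_bigr => j _; rewrite -dc // -big_distrr /=.
  by rewrite /colsum big_mkord.
have -> : (\sum_(i < N) i * rowsum d i = \sum_(j < N) \sum_(r < N) r * av d r j)%N.
  rewrite exchange_big /=; apply: eq_bigr => r _; rewrite -big_distrr /=.
  by rewrite /rowsum /pre big_mkord.
rewrite !pair_big /= => le.
have tle (x : 'I_N * 'I_N) : (x.2 * av d x.2 x.1 <= x.1 * av d x.2 x.1)%N.
  have [jr|rj] := ltnP x.1 x.2; first by rewrite (ssyt_low ds) ?muln0.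
  by rewrite leq_mul2r rj orbT.
have := @leqif_sum _ xpredT _ _ _ (fun x _ => leqif_eq (tle x)).
move/geq_leqif; rewrite le => /esym/forallP eq0 i iN.
have d0 r j : (r < N)%N -> (j < N)%N -> j != r -> av d r j = 0%N.
  move=> rlt jN; case: ltngtP => // h _; first exact: ssyt_low.
  have := eq0 (Ordinal jN, Ordinal rlt); rewrite /= eqn_mul2r => /orP[/eqP //|].
  by move/eqP => e; rewrite e ltnn in h.
rewrite -dc // /rowsum /pre /colsum (@sum_one _ N i) //; last first.
  by move=> j jN; apply: d0.
by rewrite (@sum_one _ N i) // => r rN' ri; apply: d0 => //; rewrite eq_sym.
Qed.

Lemma eq_Xc v v' (s : 'S_n) : (forall i, (i < N)%N -> v i = v' i) ->
  Xc N v s = Xc N v' s.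
Proof. by move=> h; apply: eq_bigr => f _; apply: altc_ext. Qed.

Lemma chi_Xc s : chi n rho s = Xc N (shift N (nth 0%N rho)) s.
Proof.
have pn : rowsum p 0 = n by case/andP: rho_ispt => /eqP.
have pE : 'Ind[G] (1 : 'CF(young n rho)) = perm_char p.
  apply/cfunP => t; rewrite perm_charE // (@Ind_young n N) //.
  by apply: eq_Fc => i iN; rewrite av_rho.
rewrite /chi pE -/rho' -/sgn_young.
case: pickP => [i /andP[i1 i2]|none]; last first.
  (* Without a common constituent the two induced characters would be orthogonal. *)
  case/eqP: cells_sgn_young; rewrite cfdot_sum_irr big1 // => j _.
  have := none j; rewrite !irr_consttE; case: eqP => [->|_] /=.
    by rewrite mul0r.
  by move/negbFE/eqP ->; rewrite conjC0 mulr0.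
have [d [ds dc di]] : exists d : arr N N n, [/\ ssyt d,
    forall k, (k < N)%N -> colsum d k = av p 0 k
    & '[XF n N (sv (row_arr n N (rowsum d))), 'chi_i] != 0].
  pose P (d : arr N N n) := ssyt d && [forall k : 'I_N, colsum d k == av p 0 k].
  have pX : perm_char p = \sum_(d | P d) XF n N (sv (row_arr n N (rowsum d))).
    apply/cfunP => t; rewrite perm_charE // Fc_expand // sum_cfunE.
    apply: eq_bigr => d /andP[ds /forallP dc]; rewrite XFE; apply: eq_Xc => k kN.
    rewrite /sv /shift av_row_arr //.
    have [] // := @rowsum_ispt n N d ds.
    rewrite -[RHS]pn; apply: eq_big_nat => j /andP[_ jN].
    exact/eqP/(dc (Ordinal jN)).
  case: (pickP (fun d => P d && ('[XF n N (sv (row_arr n N (rowsum d))), 'chi_i] != 0))).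
    move=> d /andP[/andP[ds /forallP dc] di]; exists d; split=> // k kN.
    exact/eqP/(dc (Ordinal kN)).
  move=> h; case/negP: i1; rewrite pX cfdot_suml big1 // => d Pd.
  by apply/eqP; have := h d; rewrite Pd /= => /negbFE.
set q := row_arr n N (rowsum d) in di.
have [dn qP] : (forall i, (i < N)%N -> rowsum d i <= n)%N /\ ispt q.
  apply: rowsum_ispt => //; rewrite -[RHS]pn; apply: eq_big_nat => j /andP[_ jN].
  exact: dc.
have qn : rowsum q 0 = n by case/andP: qP => /eqP.
have qi : XF n N (sv q) = 'chi_i.
  have [k ek] := XF_irr qP; move: di; rewrite ek cfdot_irr.
  by case: (eqVneq k i) => [->|_] //; rewrite eqxx.
have iq : i \in irr_constt (perm_char q).
  rewrite irr_consttE -qi.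
  rewrite (cfdot_ipn (fun s => perm_charE s qn) (@XFE n N (sv q)) (@Xc_conj n N (sv q))).
  exact: ip_FX_neq0.
(* The constituent also occurs in [perm_char q], since [q] indexes it. This gives one inequality
   between the weights of [rho] and [q]; the tableau [d] of shape [q] and content [rho] gives the
   other, and hence equality of the two partitions. *)
have := constt_cfdot (perm_char_char q) sgn_young_char iq i2.
move/(sgn_young_weight qn) => le.
have rE := ssyt_weight ds dc.
rewrite -qi XFE; apply: eq_Xc => k kN; rewrite /sv /shift av_row_arr // rE ?av_rho //.
apply: leq_trans le _; apply/eq_leq/eq_bigr => j _.
by rewrite av_row_arr.
Qed.

End ChiX.

(** * The product of a permutation character and an irreducible one *)

Lemma xcont_lat_height R L N w i : (0 < L)%N ->
  xcont R L N w i = lat_height R N w L.-1 R i.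
Proof.
move=> L0; rewrite (@xcont_height R L N w L.-1 R) //; last by lia.
by rewrite big_geq // big_geq ?addn0 //; lia.
Qed.

Lemma latt_xcnt R L N B (c : arr R (L * N) B) i : latt c -> (i.+1 < N)%N ->
  (xcnt c i.+1 <= xcnt c i)%N.
Proof.
move=> /lattP cl iN; rewrite /xcnt.
have [L0|L0] := posnP L; first by rewrite /xcont !big_geq // L0.
have [R0|R0] := posnP R.
  by rewrite /xcont !big1 // => k _; rewrite big_geq // R0.
rewrite !xcont_lat_height //.
have h : (L.-1 < L)%N by lia.
have h' : (R.-1 < R)%N by lia.
have := cl _ _ _ h h' iN; rewrite prednK // => /leq_trans; apply.
have := lat_heightS R N (av c) L.-1 R.-1 i; rewrite prednK // => ->.
exact: leq_addr.
Qed.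

Section KroneckerExpansion.

Variables (n L N : nat) (nu la : nat -> nat).
Hypotheses (nun : (\sum_(0 <= k < L) nu k)%N = n)
  (lad : forall i, (i.+1 < N)%N -> (la i.+1 <= la i)%N).

(** The arrays are square because [Fc_expand] produces square ones; a semistandard tableau has no
    more nonempty rows than there are letters. *)
Definition lat_arr (c : arr (L * N) (L * N) n) :=
  [&& ssyt c, [forall k : 'I_L, zcont c k == nu k], latt c
    & [forall i : 'I_N, xcnt c i == la i]].

(** Young's rule for the alphabet of pairs replaces each content by tableaux. The summand depends on
    the shape and alternates in the i-content; the flip keeps the shape and the k-content, so
    [sum_lattice] applies. *)
Lemma Fc_Xc_expand (s : 'S_n) :
  Fc L nu s * Xc N (shift N la) s =
  \sum_(c | lat_arr c) Xc (L * N) (shift (L * N) (rowsum c)) s.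
Proof.
set v := shift N la; set M := (L * N)%N.
have Pext u u' : (forall i, (i < N)%N -> u i = u' i) ->
    altc N v (shift N u) = altc N v (shift N u').
  by move=> h; apply: altc_ext => //; apply: eq_shift.
rewrite (@Fc_mul n L N nu (fun u => altc N v (shift N u)) s) //.
pose Ph (u : nat -> nat) : algC :=
  if [forall k : 'I_L, (\sum_(0 <= i < N) u (k * N + i))%N == nu k] then
  altc N v (shift N (fun i => \sum_(0 <= k < L) u (k * N + i))%N) else 0.
have PhE u u' : (forall i, (i < M)%N -> u i = u' i) -> Ph u = Ph u'.
  move=> h; rewrite /Ph.
  have -> : [forall k : 'I_L, (\sum_(0 <= i < N) u (k * N + i))%N == nu k] =
      [forall k : 'I_L, (\sum_(0 <= i < N) u' (k * N + i))%N == nu k].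
    apply: eq_forallb => k; congr (_ == _); apply: eq_big_nat => i /andP[_ iN].
    by apply: h; apply: mul_add_lt.
  case: ifP => // _; apply: Pext => i iN; apply: eq_big_nat => k /andP[_ kM].
  by apply: h; apply: mul_add_lt.
transitivity (\sum_(h : {ffun 'I_n -> 'I_M} | fixd h s) Ph (cnt h)).
  by rewrite big_mkcondr /=; apply: eq_bigr.
rewrite (@sum_fixd_content n M Ph s PhE).
have zE (c : arr M M n) k :
    zcont c k = (\sum_(0 <= i < N) colsum c (k * N + i))%N.
  by rewrite /zcont exchange_big.
have xE (c : arr M M n) i :
    @xcnt M L N n c i = (\sum_(0 <= k < L) colsum c (k * N + i))%N.
  by [].
pose S (c : arr M M n) := ssyt c && ((\sum_(0 <= j < M) colsum c j)%N == n).
transitivity (\sum_(c | S c) Ph (colsum c) * Xc M (shift M (rowsum c)) s).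
  have csn (d : arr M M n) : S d -> forall j, (j < M)%N -> (colsum d j <= n)%N.
    case/andP => _ /eqP e j jN; rewrite -[X in (_ <= X)%N]e; exact: leq_sum_nat.
  rewrite [RHS](partition_big (fun d => row_arr n M (colsum d))
    (fun c => rowsum c 0 == n)) /=; last first.
    move=> d dS; case/andP: (dS) => _ /eqP e; apply/eqP; rewrite -[RHS]e.
    by apply: eq_big_nat => j /andP[_ jN]; rewrite av_row_arr //; apply: csn.
  apply: eq_bigr => k /eqP kn; rewrite Fc_expand // big_distrr /=.
  apply: eq_big => d.
    rewrite /S -andbA; congr (_ && _); apply/forallP/andP => [h|[e]].
      have e : (\sum_(0 <= j < M) colsum d j)%N = n.
        rewrite -[RHS]kn; apply: eq_big_nat => j /andP[_ jN].
        exact/eqP/(h (Ordinal jN)).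
      rewrite e row_arr_eq; last first.
        by move=> j jN; rewrite -[X in (_ <= X)%N]e; apply: leq_sum_nat.
      by split=> //; apply/forallP => j; rewrite eq_sym.
    rewrite row_arr_eq; last first.
      by move=> j jN; rewrite -[X in (_ <= X)%N](eqP e); apply: leq_sum_nat.
    by move/forallP => h j; rewrite eq_sym.
  case/andP=> _ /forallP h; congr (_ * _); apply: PhE => i iN.
  by rewrite (eqP (h (Ordinal iN))).
pose A (a u : nat -> nat) : algC := altc N v u * Xc M (shift M a) s.
transitivity (\sum_(c : arr M M n | ssyt c && [forall k : 'I_L, zcont c k == nu k])
    A (rowsum c) (fun i => @xcnt M L N n c i + (N - i))%N).
  rewrite big_mkcond [RHS]big_mkcond /=; apply: eq_bigr => c _; rewrite /S.
  case: (ssyt c) => //=.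
  have e1 : [forall k : 'I_L, (\sum_(0 <= i < N) colsum c (k * N + i))%N == nu k] =
      [forall k : 'I_L, zcont c k == nu k].
    by apply: eq_forallb => k; rewrite zE.
  rewrite /Ph e1; case: (boolP [forall k : 'I_L, _]) => [/forallP h|_];
    last by rewrite mul0r if_same.
  have -> : (\sum_(0 <= j < M) colsum c j)%N == n.
    rewrite -sum_rowsum -[X in _ == X]nun; apply/eqP.
    transitivity (\sum_(0 <= k < L) zcont c k)%N; last first.
      by apply: eq_big_nat => k /andP[_ kL]; rewrite (eqP (h (Ordinal kL))).
    rewrite [RHS]exchange_big /=; apply: eq_bigr => r _.
    by rewrite /rowsum -sum_groups.
  by congr (_ * _); apply: altc_ext.
rewrite (@sum_lattice M L N n nu A); first last.
- by move=> a u i iN; rewrite /A altc_anti // mulNr.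
- by move=> a u u' h; rewrite /A; congr (_ * _); apply: altc_ext.
- by rewrite nun.
rewrite [RHS](eq_bigl (fun c => [&& ssyt c, [forall k : 'I_L, zcont c k == nu k]
  & latt c] && [forall i : 'I_N, xcnt c i == la i])); last first.
  by move=> c; rewrite /lat_arr -!andbA.
rewrite [RHS]big_mkcondr /=; apply: eq_bigr => c /and3P[_ _ cl].
rewrite /A altc_decr; first last.
- exact: shift_decr.
- by apply: (@shift_decr N (xcnt c)) => i; apply: latt_xcnt.
rewrite (_ : [forall i : 'I_N, _] = [forall i : 'I_N, xcnt c i == la i]).
  by case: ifP; rewrite ?mul1r ?mul0r.
exact: shift_eq.
Qed.

End KroneckerExpansion.

(** * Symmetric functions and roots of unity *)

Lemma geq_trans : transitive geq.
Proof. by move=> y x z /= h1 h2; exact: leq_trans h2 h1. Qed.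

Lemma geq_anti : antisymmetric geq.
Proof. by move=> x y /=; lia. Qed.

Lemma geq_total : total geq.
Proof. by move=> x y; apply: leq_total. Qed.

Lemma part_of_subproof (s : seq nat) : is_part (sort geq (filter (leq 1) s)).
Proof.
rewrite /is_part (sort_sorted geq_total) /=.
by rewrite mem_sort mem_filter.
Qed.

Definition part_of s := IntPart (part_of_subproof s).

Lemma part_of_perm s t : perm_eq (filter (leq 1) s) (filter (leq 1) t) ->
  part_of s = part_of t.
Proof.
move=> st; apply: val_inj => /=; apply/perm_sortP => //.
- exact: geq_total.
- exact: geq_trans.
- exact: geq_anti.
Qed.

Lemma intpart_pos (ka : intpart) : all (leq 1) ka.
Proof.
case: ka => s /= /andP[_ n0]; apply/allP => x xs; rewrite lt0n.
by apply: contraNN n0 => /eqP <-.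
Qed.

Lemma intpart_sorted (ka : intpart) : sorted geq ka.
Proof. by case: ka => s /= /andP[]. Qed.

Lemma part_of_id (ka : intpart) : part_of ka = ka.
Proof.
apply: val_inj => /=; rewrite (all_filterP (intpart_pos ka)).
apply: sorted_sort; [exact: geq_trans|exact: intpart_sorted].
Qed.

Lemma part_of_eq s (ka : intpart) : (part_of s == ka) = perm_eq (filter (leq 1) s) ka.
Proof.
apply/eqP/idP => [<-|h]; first by rewrite perm_sym /= perm_sort.
rewrite -[RHS]part_of_id; apply: part_of_perm.
by rewrite (all_filterP (intpart_pos ka)).
Qed.

Lemma sumn_part_of s : sumn (part_of s) = sumn s.
Proof.
rewrite /= (@perm_sumn _ (filter (leq 1) s)); last by rewrite perm_sort.
by elim: s => //= -[|x] s /= ->.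
Qed.

Lemma size_part (ka : intpart) : (size ka <= sumn ka)%N.
Proof.
have := intpart_pos ka; elim: (val ka) => //= x s IH /andP[x1 /IH].
by move=> h; rewrite -add1n leq_add.
Qed.

(** A finite list that contains every partition of size less than [d], and possibly larger ones;
    [d.-1.+1] makes the ordinal type nonempty, as [inord] requires. *)
Definition parts d : seq intpart :=
  undup [seq part_of (mkseq (fun i => nat_of_ord (f (inord i))) d)
        | f : {ffun 'I_d.-1.+1 -> 'I_d.-1.+1}].

Lemma mem_parts (ka : intpart) d : (sumn ka < d)%N -> ka \in parts d.
Proof.
move=> kd; rewrite mem_undup.
have d0 : d = d.-1.+1 by lia.
apply/imageP.
exists [ffun i : 'I_d.-1.+1 => inord (nth 0%N ka i)] => //.
apply/esym/eqP; rewrite part_of_eq.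
have -> : mkseq (fun i => nat_of_ord ([ffun i : 'I_d.-1.+1 => inord (nth 0%N ka i)]
    (inord i) : 'I_d.-1.+1)) d = ka ++ nseq (d - size ka) 0%N.
  have sd : (size ka <= d)%N by apply: leq_trans (size_part ka) (ltnW kd).
  apply: (@eq_from_nth _ 0%N); first by rewrite size_mkseq size_cat size_nseq subnKC.
  move=> i; rewrite size_mkseq => id_; rewrite nth_mkseq // ffunE.
  have e1 : nat_of_ord (inord i : 'I_d.-1.+1) = i by rewrite inordK -?d0.
  rewrite e1 inordK -?d0; last exact: leq_ltn_trans (nth_le_sumn _ _) kd.
  rewrite nth_cat nth_nseq; case: ltnP => // ki.
  by rewrite nth_default //; case: ifP.
rewrite filter_cat (all_filterP (intpart_pos ka)).
have -> : [seq x <- nseq (d - size ka) 0%N | (1 <= x)%N] = [::].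
  by elim: (d - size ka)%N.
by rewrite cats0.
Qed.

Lemma mdeg_sumn n (m : 'X_{1..n}) : mdeg m = sumn m.
Proof. by rewrite sumnE. Qed.

Lemma mcoeff_kill_last n (p : {mpoly algC[n.+1]}) (k : 'X_{1..n}) :
  (kill_last p)@_k = p@_(mnmwiden k).
Proof.
rewrite {1 2}(mpolyE p) /kill_last (raddf_sum (comp_mpoly _)) !raddf_sum /=; apply: eq_bigr => m _.
by rewrite comp_mpolyZ !mcoeffZ -/(kill_last _) kill_lastX mcoeffX.
Qed.

Lemma sf_coef_widen (f : symfun) n (k : 'X_{1..n}) :
  (f n.+1)@_(mnmwiden k) = (f n)@_k.
Proof. by case: (sf_poly_axiom f) => _ h _; rewrite -(h n) mcoeff_kill_last. Qed.

Lemma sf_coef_perm (f : symfun) n (m m' : 'X_{1..n}) : perm_eq m m' ->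
  (f n)@_m = (f n)@_m'.
Proof.
case: (sf_poly_axiom f) => /(_ n)/issymP h _ _ /tuple_permP[s es].
rewrite -[in RHS](h s) mcoeff_sym; congr (_ @_ _).
apply/mnmP => i; rewrite mnmE mnm_tnth (tnth_nth 0%N) es -tnth_nth tnth_mktuple.
by rewrite -mnm_tnth.
Qed.

Definition sf_coef (f : symfun) (ka : seq nat) : algC :=
  (f (size ka))@_[multinom nth 0%N ka i | i < size ka].

(** Symmetry moves a zero exponent to the last variable and stability removes that variable; this is
    repeated until all exponents are positive. *)
Lemma sf_coefE (f : symfun) n (m : 'X_{1..n}) : (f n)@_m = sf_coef f (part_of m).
Proof.
elim: n m => [|n IH] m.
  have -> : part_of m = part_of [::].
    by apply: part_of_perm; case: m => m; rewrite (tuple0 m).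
  by rewrite /sf_coef; congr (_ @_ _); apply/mnmP; case.
have [am|/allPn[z zm]] := boolP (all (leq 1) m).
  have pm : perm_eq m (part_of m) by rewrite /= (all_filterP am) perm_sym perm_sort.
  rewrite /sf_coef; have sz : size (part_of m) = n.+1.
    by rewrite -(perm_size pm) size_tuple.
  move: (val (part_of m)) pm sz => s; rewrite /= => pm sz.
  move: pm; rewrite sz => pm; apply: sf_coef_perm.
  congr (perm_eq _ _): pm; apply: (@eq_from_nth _ 0%N); first by rewrite size_tuple.
  move=> i; rewrite sz => iN; rewrite -[i]/(val (Ordinal iN)) -tnth_nth.
  by rewrite -mnm_tnth mnmE.
rewrite -leqNgt leqn0 => /eqP z0; subst z.
have ps : perm_eq m (rcons (rem 0%N m) 0%N).
  by rewrite perm_sym perm_rcons perm_sym perm_to_rem.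
have sz : size (rem 0%N m) == n by rewrite size_rem // size_tuple.
pose k := Multinom (Tuple sz).
have wk : mnmwiden k = rcons (rem 0%N m) 0%N :> seq nat by [].
rewrite (sf_coef_perm f (m' := mnmwiden k)) ?wk // sf_coef_widen IH.
congr (sf_coef f _); congr part_val; apply: part_of_perm => /=.
by have := perm_filter (leq 1) ps; rewrite filter_rcons perm_sym.
Qed.

Lemma sf_coef_deg (f : symfun) d ka : (forall n, msize (f n) <= d)%N ->
  (d <= sumn ka)%N -> sf_coef f ka = 0.
Proof.
move=> fd dk; apply: memN_msupp_eq0; apply/negP => /msize_mdeg_lt.
apply/negP; rewrite -leqNgt (leq_trans (fd _)) // (leq_trans dk) //.
rewrite mdegE sumnE (big_nth 0%N) big_mkord; apply/eq_leq/eq_bigr => i _.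
by rewrite mnmE.
Qed.

Lemma sf_polyD (f g : symfun) n : (f + g) n = f n + g n. Proof. by []. Qed.
Lemma sf_polyM (f g : symfun) n : (f * g) n = f n * g n. Proof. by []. Qed.
Lemma sf_polyZ a (f : symfun) n : (a *: f) n = a *: f n. Proof. by []. Qed.

Lemma sf_poly_sum (I : Type) (r : seq I) (P : pred I) (F : I -> symfun) n :
  (\sum_(i <- r | P i) F i) n = \sum_(i <- r | P i) F i n.
Proof. by apply: (big_morph (fun f : symfun => f n)). Qed.

Lemma sf_poly_prod (I : Type) (r : seq I) (P : pred I) (F : I -> symfun) n :
  (\prod_(i <- r | P i) F i) n = \prod_(i <- r | P i) F i n.
Proof. by apply: (big_morph (fun f : symfun => f n)). Qed.

Lemma monomial_expansion (f : symfun) d : (forall n, msize (f n) <= d)%N ->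
  f = \sum_(ka <- parts d) sf_coef f ka *: monomial ka.
Proof.
move=> fd; apply: sf_ext => n; apply/mpolyP => m.
rewrite sf_poly_sum raddf_sum /=.
have e (ka : intpart) : (sf_coef f ka *: monomial ka n)@_m =
    if ka == part_of m then sf_coef f (part_of m) else 0.
  rewrite mcoeffZ monos_polyE /mono_pred -part_of_eq eq_sym.
  case: eqP => [->|_]; last by rewrite mulr0.
  by rewrite sumn_part_of mdeg_sumn ltnSn mulr1.
rewrite (eq_bigr _ (fun ka _ => e ka)) -big_mkcond /= sf_coefE.
have [dm|md] := leqP d (sumn (part_of m)).
  by rewrite (sf_coef_deg fd dm) big1.
rewrite -big_filter (_ : filter _ _ = [:: part_of m]) ?big_seq1 //.
by rewrite filter_pred1_uniq ?undup_uniq // mem_parts.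
Qed.

Lemma hall_coef (B : {bilinear symfun -> symfun -> algC | *%R & *%R}) :
  is_hall B -> forall (ka : intpart) f, B (hsym ka) f = sf_coef f ka.
Proof.
move=> BP ka f; have [_ _ [d0 fd0]] := sf_poly_axiom f.
pose d := maxn d0 (sumn ka).+1.
have fd n : (msize (f n) <= d)%N by rewrite (leq_trans (fd0 n)) // leq_maxl.
rewrite {1}(monomial_expansion fd) linear_sum /=.
under eq_bigr => la _ do rewrite linearZ /= BP.
rewrite (bigD1_seq ka) ?undup_uniq //=; last by apply: mem_parts; rewrite leq_max ltnSn orbT.
rewrite eqxx mulr1 big1 ?addr0 // => la /negbTE h.
by rewrite eq_sym h mulr0.
Qed.

Lemma sf_evalD f g X : sf_eval (f + g) X = sf_eval f X + sf_eval g X.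
Proof. exact: mevalD. Qed.

Lemma sf_evalM f g X : sf_eval (f * g) X = sf_eval f X * sf_eval g X.
Proof. exact: mevalM. Qed.

Lemma sf_evalZ a f X : sf_eval (a *: f) X = a * sf_eval f X.
Proof. exact: mevalZ. Qed.

Lemma sf_eval0 X : sf_eval 0 X = 0.
Proof. exact: meval0. Qed.

Lemma sf_eval1 X : sf_eval 1 X = 1.
Proof. exact: meval1. Qed.

Lemma sf_evalB f g X : sf_eval (f - g) X = sf_eval f X - sf_eval g X.
Proof. by rewrite sf_evalD -scaleN1r sf_evalZ mulN1r. Qed.

Lemma sf_eval_sum (I : Type) (r : seq I) (P : pred I) (F : I -> symfun) X :
  sf_eval (\sum_(i <- r | P i) F i) X = \sum_(i <- r | P i) sf_eval (F i) X.
Proof.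
apply: (big_morph (fun f => sf_eval f X)) => [f g|]; last exact: sf_eval0.
exact: sf_evalD.
Qed.

Lemma sf_evalX f k X : sf_eval (f ^+ k) X = sf_eval f X ^+ k.
Proof.
by elim: k => [|k IH]; rewrite ?expr0 ?sf_eval1 // !exprS sf_evalM IH.
Qed.

(** * Complete homogeneous functions at roots of unity, and separation *)

Lemma poly_nat_roots (p : {poly algC}) c N0 :
  (forall m, (N0 <= m)%N -> p.[c + m%:R] = 0) -> p = 0.
Proof.
move=> h; apply/eqP; apply: contraT => p0.
have := @max_poly_roots _ p [seq c + m%:R | m <- iota N0 (size p)] p0.
rewrite size_map size_iota ltnn; apply.
  apply/allP => x /mapP[m]; rewrite mem_iota => /andP[mN _] ->.
  by rewrite /root h.
rewrite map_inj_uniq ?iota_uniq // => a b /addrI /eqP.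
by rewrite eqr_nat => /eqP.
Qed.

(** The series 1 / (1 - x X) cut off after degree J. The generating function of the complete
    homogeneous functions is thereby a polynomial, correct up to degree J. *)
Definition geom J (x : algC) : {poly algC} := \poly_(a < J.+1) x ^+ a.

Definition hgen J (X : seq algC) : {poly algC} := \prod_(x <- X) geom J x.

Lemma hom_eval j J X : (j <= J)%N -> sf_eval (Defs.hom j) X = (hgen J X)`_j.
Proof.
move=> jJ; rewrite /sf_eval /hgen (big_nth 0) big_mkord.
set n := size X.
have -> : \prod_(i < n) geom J X`_i = \sum_(g : {ffun 'I_n -> 'I_J.+1})
    (\prod_(i < n) X`_i ^+ g i) *: 'X^(\sum_(i < n) g i).
  rewrite /geom; under eq_bigr => i _ do rewrite poly_def.
  rewrite bigA_distr_bigA /=; apply: eq_bigr => g _.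
  by rewrite scaler_prod prodrXr.
have -> : Defs.hom j n = \sum_(g : {ffun 'I_n -> 'I_J.+1} | (\sum_(i < n) g i)%N == j)
    'X_[[multinom nat_of_ord (g i) | i < n]].
  apply/mpolyP => m; rewrite monos_polyE raddf_sum /= /hom_pred -mdeg_sumn.
  have [mj|mj] := eqVneq (mdeg m) j; last first.
    rewrite big1 // => g /eqP gj; rewrite mcoeffX; case: eqP => // e.
    case/eqP: mj; rewrite -e mdegE -gj; apply: eq_bigr => i _.
    by rewrite mnmE.
  have mle i : (m i < J.+1)%N.
    rewrite ltnS (leq_trans _ jJ) // -mj mdegE (bigD1 i) //=; exact: leq_addr.
  pose g0 := [ffun i => Ordinal (mle i)] : {ffun 'I_n -> 'I_J.+1}.
  rewrite mj ltnSn (bigD1 g0) /=; last first.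
    by rewrite -mj mdegE; apply/eqP; apply: eq_bigr => i _; rewrite ffunE.
  rewrite mcoeffX (_ : [multinom _ | i < n] = m) ?eqxx; last first.
    by apply/mnmP => i; rewrite mnmE ffunE.
  rewrite big1 ?addr0 // => g /andP[_ gg]; rewrite mcoeffX; case: eqP => // e.
  case/eqP: gg; apply/ffunP => i; apply: val_inj; rewrite ffunE /= -e.
  by rewrite mnmE.
rewrite coef_sum (raddf_sum (meval _)) /= big_mkcond /=; apply: eq_bigr => g _.
rewrite coefZ coefXn mevalX eq_sym.
case: eqP => _; rewrite ?mulr0 // mulr1.
by apply: eq_bigr => i _; rewrite mnmE.
Qed.

Lemma geom_inv J x : (1 - x *: 'X) * geom J x = 1 - x ^+ J.+1 *: 'X^(J.+1).
Proof.
apply/polyP => i; rewrite mulrBl mul1r -scalerAl coefB coefZ coefXM !coef_poly.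
rewrite coefB coef1 coefZ coefXn.
case: i => [|i] /=; first by rewrite mulr0 subr0 expr0 mulr0 subr0.
rewrite add0r ltnS eqSS; have [->|iJ] := eqVneq i J.
  by rewrite ltnn ltnSn !sub0r mulr1 -exprS.
rewrite mulr0 oppr0 ltnS [in X in _ * X]leq_eqVlt (negbTE iJ) /=.
by case: ltnP => _; rewrite ?mulr0 ?subr0 // -exprS subrr.
Qed.

(** The left side is the reversed polynomial of X^d - 1. The reversal is carried out by evaluating
    at t and 1 / t for the nonzero numbers t = 1 + m, which are infinitely many. *)
Lemma prod_roots_of_unity d : (0 < d)%N ->
  \prod_(x <- roots_of_unity d) (1 - x *: 'X) = 1 - 'X^d :> {poly algC}.
Proof.
move=> d0; rewrite /roots_of_unity.
case: (closed_field_poly_normal _) => r /= er.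
have m1 : ('X^d - 1 : {poly algC}) \is monic by rewrite monicXnsubC.
rewrite (monicP m1) scale1r in er.
have sr : size r = d.
  by have := size_XnsubC (1 : algC) d0; rewrite er size_prod_XsubC => -[].
apply/eqP; rewrite -subr_eq0; apply/eqP; apply: (@poly_nat_roots _ 1 0) => m _.
have t0 : 1 + m%:R != 0 :> algC by rewrite -[1]/(1%:R) -natrD pnatr_eq0.
set t := 1 + m%:R in t0 *.
rewrite hornerD hornerN horner_prod.
have -> : \prod_(x <- r) (1 - x *: 'X).[t] = t ^+ d * ('X^d - 1).[t^-1].
  rewrite er horner_prod -sr; elim: (r) => [|x s IH] /=.
    by rewrite !big_nil expr0 mulr1.
  rewrite !big_cons IH /= exprS.
  have -> : (1 - x *: 'X).[t] = t * ('X - x%:P).[t^-1].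
    by rewrite !hornerE mulrBr divff // [t * x]mulrC.
  by rewrite mulrACA.
rewrite !hornerE /= mulrBr mulr1 -exprMn divff // expr1n.
by rewrite subrr.
Qed.

(** Multiplying the generating function by 1 - X^K cancels the factor of the K-th roots of unity;
    the errors due to truncation lie in degrees above j. *)
Lemma hom_roots_cat K X j : (0 < K)%N ->
  sf_eval (Defs.hom j) (roots_of_unity K ++ X) = sf_eval (Defs.hom j) X +
  (if (K <= j)%N then sf_eval (Defs.hom (j - K)) (roots_of_unity K ++ X) else 0).
Proof.
move=> K0; rewrite !(@hom_eval _ j) // ?leq_subr //.
set Y := roots_of_unity K ++ X.
have e : hgen j Y * (1 - 'X^K) =
    (\prod_(x <- roots_of_unity K) (1 - x ^+ j.+1 *: 'X^(j.+1))) * hgen j X.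
  rewrite -(prod_roots_of_unity K0) /hgen /Y big_cat /= mulrAC; congr (_ * _).
  by rewrite -big_split /=; apply: eq_bigr => x _; rewrite mulrC geom_inv.
have c (s : seq algC) (p : {poly algC}) :
    (\prod_(x <- s) (1 - x ^+ j.+1 *: 'X^(j.+1)) * p)`_j = p`_j.
  elim: s => [|x s IH]; first by rewrite big_nil mul1r.
  rewrite big_cons -mulrA mulrBl mul1r coefB IH -scalerAl coefZ coefXnM ltnSn.
  by rewrite mulr0 subr0.
move/(congr1 (fun p : {poly algC} => p`_j)): e; rewrite c => <-.
rewrite mulrBr mulr1 coefB coefMXn ltnNge.
by case: (K <= j)%N => /=; rewrite ?subr0 ?addr0 // subrK.
Qed.

Lemma hom0 : Defs.hom 0 = 1.
Proof.
apply: sf_ext => n; apply/mpolyP => m; rewrite monos_polyE /= /hom_pred.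
by rewrite -mdeg_sumn mcoeff1 mdeg_eq0; case: eqP => // ->; rewrite mdeg0.
Qed.

Lemma hom_Xi_small m K nu j : (j <= K)%N ->
  sf_eval (Defs.hom j) (Xi (nseq m K.+1 ++ nu)) = sf_eval (Defs.hom j) (Xi nu).
Proof.
move=> jK; elim: m => // m IH; rewrite -[RHS]IH.
rewrite -[Xi (nseq m.+1 K.+1 ++ nu)]/(roots_of_unity K.+1 ++ Xi (nseq m K.+1 ++ nu)).
by rewrite hom_roots_cat // ltnNge jK addr0.
Qed.

(** With [hom_Xi_small]: adjoining m parts [K.+1] shifts the value of the function of degree [K.+1]
    by m and leaves the lower ones unchanged. This independence drives the separation argument. *)
Lemma hom_Xi_big m K nu :
  sf_eval (Defs.hom K.+1) (Xi (nseq m K.+1 ++ nu)) =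
  sf_eval (Defs.hom K.+1) (Xi nu) + m%:R.
Proof.
elim: m => [|m IH]; first by rewrite addr0.
rewrite -[Xi (nseq m.+1 K.+1 ++ nu)]/(roots_of_unity K.+1 ++ Xi (nseq m K.+1 ++ nu)).
rewrite hom_roots_cat // leqnn subnn hom0 sf_eval1 IH -addrA; congr (_ + _).
by rewrite -natr1.
Qed.

(* The subalgebra generated by the complete homogeneous functions of degree at
   most K. *)
Fixpoint hgenerated K (f : symfun) : Prop :=
  if K is K'.+1 then
    exists P : {poly symfun}, (forall i, hgenerated K' P`_i) /\ f = P.[Defs.hom K]
  else exists a : algC, f = a *: 1.

Lemma hgenerated_closed K :
  [/\ forall a, hgenerated K (a *: 1),
      forall f g, hgenerated K f -> hgenerated K g -> hgenerated K (f + g)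
    & forall f g, hgenerated K f -> hgenerated K g -> hgenerated K (f * g)].
Proof.
elim: K => [|K [hZ hD hM]] /=.
  split=> [a|_ _ [a ->] [b ->]|_ _ [a ->] [b ->]]; first by exists a.
    by exists (a + b); rewrite scalerDl.
  by exists (a * b); rewrite -scalerAl mul1r scalerA.
have h0 : hgenerated K 0 by rewrite -(scale0r (1 : symfun)).
split=> [a|_ _ [P [PP ->]] [Q [QP ->]]|_ _ [P [PP ->]] [Q [QP ->]]].
- by exists (a *: 1)%:P; split=> [i|]; rewrite ?hornerC // coefC; case: eqP.
- by exists (P + Q); split=> [i|]; rewrite ?hornerD // coefD; apply: hD.
- exists (P * Q); split=> [i|]; rewrite ?hornerM // coefM.
  by elim/big_ind: _ => // j _; apply: hM.
Qed.

Lemma hgeneratedS K f : hgenerated K f -> hgenerated K.+1 f.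
Proof.
move=> fK; exists f%:P; split=> [i|]; last by rewrite hornerC.
rewrite coefC; case: eqP => // _; rewrite -(scale0r (1 : symfun)).
by case: (hgenerated_closed K).
Qed.

Lemma hgenerated_hom K j : (j <= K)%N -> hgenerated K (Defs.hom j).
Proof.
elim: K => [|K IH]; first by rewrite leqn0 => /eqP ->; exists 1; rewrite hom0 scale1r.
rewrite leq_eqVlt => /orP[/eqP ->|jK]; last exact/hgeneratedS/IH.
have [hZ _ _] := hgenerated_closed K.
exists 'X; split=> [i|]; last by rewrite hornerX.
rewrite coefX; case: eqP => _.
  by have := hZ 1; rewrite scale1r.
by have := hZ 0; rewrite scale0r.
Qed.

Lemma hgenerated_hsym K ka : all (fun k => k <= K)%N ka -> hgenerated K (hsym ka).
Proof.
rewrite /hsym; have [hZ _ hM] := hgenerated_closed K.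
elim: ka => [|k ka IH] /=; first by rewrite big_nil => _; have := hZ 1; rewrite scale1r.
move=> /andP[kK /IH h]; rewrite big_cons; apply: hM => //.
exact: hgenerated_hom.
Qed.

Lemma hgenerated_eval K f X Y : hgenerated K f ->
  (forall j, (j <= K)%N -> sf_eval (Defs.hom j) X = sf_eval (Defs.hom j) Y) ->
  sf_eval f X = sf_eval f Y.
Proof.
elim: K f => [|K IH] f /=.
  by case=> a -> _; rewrite !sf_evalZ !sf_eval1.
case=> P [PP ->] h; rewrite horner_coef !sf_eval_sum; apply: eq_bigr => i _.
rewrite !sf_evalM !sf_evalX h //; congr (_ * _); apply: IH; first exact: PP.
by move=> j jK; apply: h; apply: leqW.
Qed.

(** Write f as a polynomial in the complete function of degree [K.+1]. For fixed nu with parts at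
    most K, adjoining m parts [K.+1] keeps the values of the coefficients and gives infinitely many
    roots in one variable, so the coefficients vanish at nu and induction applies to them. *)
Lemma hgenerated_sep K f N0 : hgenerated K.+1 f ->
  (forall nu, is_part nu -> (N0 <= sumn nu)%N -> sf_eval f (Xi nu) = 0) -> f = 0.
Proof.
(* A lower bound on the size of nu is needed for f' only, since the adjoined parts make nu as large
   as desired. The statement used for the coefficients has no bound. *)
have step K' f' N1 : (forall g, hgenerated K' g ->
      (forall nu, is_part nu -> all (fun k => k <= K')%N nu -> sf_eval g (Xi nu) = 0) ->
      g = 0) ->
    hgenerated K'.+1 f' ->
    (forall nu, is_part nu -> all (fun k => k <= K'.+1)%N nu -> (N1 <= sumn nu)%N ->
      sf_eval f' (Xi nu) = 0) -> f' = 0.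
  move=> IH [P [PP ->]] h.
  suff -> : P = 0 by rewrite horner0.
  apply/polyP => i; rewrite coef0; apply: IH; first exact: PP.
  move=> nu nuP nuK.
  pose Q := \poly_(k < size P) sf_eval P`_k (Xi nu).
  have Q0 : Q = 0.
    apply: (@poly_nat_roots _ (sf_eval (Defs.hom K'.+1) (Xi nu)) N1) => m mN.
    rewrite -hom_Xi_big horner_poly.
    rewrite -[RHS](h (nseq m K'.+1 ++ nu)).
    - rewrite horner_coef sf_eval_sum; apply: eq_bigr => k _; rewrite sf_evalM sf_evalX; congr (_ * _).
      apply: (hgenerated_eval (PP k)) => j jK.
      by rewrite hom_Xi_small.
    - rewrite /is_part mem_cat negb_or mem_nseq /= andbF /=.
      case/andP: nuP => nus ->; rewrite andbT; elim: (m) => //= k IHk.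
      rewrite path_sortedE; last exact: geq_trans.
      rewrite IHk andbT all_cat all_nseq /= leqnn orbT /=.
      by apply/allP => x xn; apply: leqW; apply: (allP nuK).
    - rewrite all_cat all_nseq leqnn orbT /=; apply/allP => x xn.
      by apply: leqW; apply: (allP nuK).
    - rewrite sumn_cat sumn_nseq; apply: leq_trans (leq_addr _ _).
      by apply: leq_trans mN _; rewrite mulSn leq_addr.
  have := congr1 (fun q : {poly algC} => q`_i) Q0; rewrite coef_poly coef0.
  case: ltnP => // si _; rewrite nth_default ?sf_eval0 //.
move=> fK h; have sep0 : forall K' g, hgenerated K' g ->
    (forall nu, is_part nu -> all (fun k => k <= K')%N nu -> sf_eval g (Xi nu) = 0) ->
    g = 0.
  elim=> [|K' IH] g; last first.
    by move=> gK hg; apply: (step K' g 0%N) => // nu nuP nuK _; apply: hg.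
  case=> a -> /(_ [::] isT isT); rewrite sf_evalZ sf_eval1 mulr1 => ->.
  by rewrite scale0r.
by apply: (step K f N0 (sep0 K) fK) => nu nuP _; apply: h.
Qed.

Lemma hom_homog k n : Defs.hom k n \is k.-homog.
Proof.
apply/dhomogP => m; rewrite mcoeff_msupp monos_polyE /hom_pred.
case: (sumn m =P k) => [e _|_]; last by rewrite eqxx.
exact: etrans (mdeg_sumn m) e.
Qed.

Lemma hsym_size ka n : (msize (hsym ka n) <= (sumn ka).+1)%N.
Proof.
suff h : hsym ka n \is (sumn ka).-homog.
  rewrite msizeE; apply/bigmax_leqP_seq => m mm _.
  by move/dhomogP: h => /(_ m mm) /= ->.
rewrite /hsym; elim: ka => [|k ka IH]; first by rewrite big_nil; apply: dhomog1.
by rewrite big_cons sf_polyM; apply: dhomogM => //; apply: hom_homog.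
Qed.

(* The Hall form makes the h_ka linearly independent, so in each degree they
   span what the monomial functions span. *)
Lemma hsym_span (B : {bilinear symfun -> symfun -> algC | *%R & *%R}) d (f : symfun) :
  is_hall B -> (forall n, msize (f n) <= d)%N -> hgenerated d f.
Proof.
move=> BP fd; pose ps := [seq ka <- parts d | sumn (part_val ka) < d]%N; pose q := size ps.
pose k0 := part_of [::]; pose pa (i : 'I_q) := nth k0 ps i.
have pad i : (sumn (pa i) < d)%N.
  have : pa i \in ps by apply: mem_nth.
  by rewrite mem_filter => /andP[].
have expand (g : symfun) : (forall n, msize (g n) <= d)%N ->
    g = \sum_(i < q) sf_coef g (pa i) *: monomial (pa i).
  move=> gd; rewrite {1}(monomial_expansion gd).
  rewrite (bigID (fun ka : intpart => sumn ka < d)%N) /= [X in _ + X]big1 ?addr0.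
    by rewrite -big_filter (big_nth k0) big_mkord.
  by move=> ka; rewrite -leqNgt => dk; rewrite (sf_coef_deg gd dk) scale0r.
pose H : 'M[algC]_q := \matrix_(i, j) sf_coef (hsym (pa i)) (pa j).
have hE i : hsym (pa i) = \sum_j H i j *: monomial (pa j).
  rewrite {1}(expand (hsym (pa i))); first by apply: eq_bigr => j _; rewrite mxE.
  by move=> n; apply: leq_trans (hsym_size _ _) _; apply: pad.
have injpa : injective pa.
  move=> i j /eqP; rewrite nth_uniq ?filter_uniq ?undup_uniq //.
  by move/eqP; apply: val_inj.
(* A row vector in the kernel of H is a linear relation among the complete functions; pairing it
   with the monomial functions gives each of its coefficients. *)
have Hu : H \in unitmx.
  rewrite -row_free_unit -kermx_eq0; apply/eqP/row_matrixP => k.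
  set v := row k (kermx H); have vH : v *m H = 0.
    by rewrite -row_mul mulmx_ker row0.
  have v0 : \sum_i v 0 i *: hsym (pa i) = 0.
    under eq_bigr => i _ do rewrite hE scaler_sumr.
    rewrite exchange_big big1 //= => j _.
    under eq_bigr => i _ do rewrite scalerA.
    rewrite -scaler_suml; move/matrixP/(_ 0 j): vH; rewrite !mxE => ->.
    by rewrite scale0r.
  apply/rowP => j; rewrite row0 [RHS]mxE.
  have := linear0l B (monomial (pa j)); rewrite -v0 linear_sumlz /= => e.
  rewrite -[RHS]e (bigD1 j) //= linearZl_LR BP eqxx mulr1 big1 ?addr0 // => i ij.
  by rewrite linearZl_LR BP (inj_eq injpa) (negbTE ij) mulr0.
have [hZ hD hM] := hgenerated_closed d.
have mgen j : hgenerated d (monomial (pa j)).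
  have -> : monomial (pa j) = \sum_i (invmx H) j i *: hsym (pa i).
    transitivity (\sum_k (\sum_i invmx H j i * H i k) *: monomial (pa k)).
      have VH k : \sum_i invmx H j i * H i k = (j == k)%:R.
        by move/matrixP/(_ j k): (mulVmx Hu); rewrite !mxE.
      rewrite (bigD1 j) //= VH eqxx scale1r big1 ?addr0 // => k kj.
      by rewrite VH eq_sym (negbTE kj) scale0r.
    rewrite [RHS](eq_bigr (fun i => \sum_k (invmx H j i * H i k) *: monomial (pa k))).
      rewrite exchange_big /=; apply: eq_bigr => k _; exact: scaler_suml.
    move=> i _; rewrite hE scaler_sumr; apply: eq_bigr => k _.
    by rewrite scalerA.
  elim/big_ind: _ => [|//|i _]; first by have := hZ 0; rewrite scale0r.
  rewrite -[hsym _]mul1r scalerAl; apply: hM => //; apply: hgenerated_hsym.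
  apply/allP => x xk; have [m em] : exists m, x = nth 0%N (pa i) m.
    by exists (index x (pa i)); rewrite nth_index.
  by rewrite em (leq_trans (nth_le_sumn _ _)) // ltnW.
rewrite (expand f fd); elim/big_ind: _ => [|//|i _].
  by have := hZ 0; rewrite scale0r.
by rewrite -[monomial _]mul1r scalerAl; apply: hM.
Qed.

Lemma sf_separation (B : {bilinear symfun -> symfun -> algC | *%R & *%R}) f N0 :
  is_hall B ->
  (forall nu, is_part nu -> (N0 <= sumn nu)%N -> sf_eval f (Xi nu) = 0) -> f = 0.
Proof.
move=> BP; have [_ _ [d fd]] := sf_poly_axiom f.
exact/hgenerated_sep/hgeneratedS/(hsym_span BP fd).
Qed.

(** * Power sums, cycles, and permutations of a given cycle type *)

Section PowerSums.

Variables (n M : nat) (s : 'S_n).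

Lemma fixd_porbit (f : {ffun 'I_n -> 'I_M}) x y : fixd f s ->
  y \in porbit s x -> f y = f x.
Proof.
move=> /forallP h /porbitP[k ->]; elim: k => [|k IH]; first by rewrite expg0 perm1.
by rewrite expgSr permM (eqP (h _)).
Qed.

(** Expanding the product chooses one letter for each cycle, which amounts to a function constant on
    the cycles; [j0] is the value given outside the set of cycles. *)
Lemma prod_porbits (j0 : 'I_M) :
  \prod_(c in porbits s) \sum_(i < M) 'X_i ^+ #|c| =
  \sum_(f : {ffun 'I_n -> 'I_M} | fixd f s) \prod_(x < n) 'X_(f x) :> {mpoly algC[M]}.
Proof.
rewrite (big_distr_big j0) /=.
pose of_ (f : {ffun 'I_n -> 'I_M}) : {ffun {set 'I_n} -> 'I_M} :=
  [ffun c => if c \in porbits s then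
     if [pick x in c] is Some x then f x else j0 else j0].
pose to (g : {ffun {set 'I_n} -> 'I_M}) : {ffun 'I_n -> 'I_M} :=
  [ffun x => g (porbit s x)].
have ofP f x : fixd f s -> of_ f (porbit s x) = f x.
  move=> fs; rewrite ffunE; have -> : porbit s x \in porbits s by apply: imset_f.
  case: pickP => [y yx|/(_ x)]; first exact: fixd_porbit.
  by rewrite porbit_id.
rewrite (reindex_onto to of_) /=; last first.
  by move=> f fs; apply/ffunP => x; rewrite ffunE ofP.
apply: eq_big => [g|g _].
  apply/idP/andP => [/pfamilyP[gP _]|[gs /eqP <-]]; last first.
    apply/pfamilyP; split=> [|//].
    by apply/supportP => c cs; rewrite ffunE (negbTE cs).
  have gs : fixd (to g) s.
    apply/forallP => x; rewrite !ffunE; apply/eqP; congr (g _).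
    by apply/eqP; rewrite eq_porbit_mem; have := mem_porbit s 1 x; rewrite expg1.
  split=> //; apply/eqP/ffunP => c.
  case: (boolP (c \in porbits s)) => [/imsetP[x _ ->]|cs].
    by rewrite ofP // ffunE.
  by rewrite ffunE (negbTE cs) (supportP gP).
rewrite [RHS](partition_big (porbit s) (mem (porbits s))) /=; last first.
  by move=> x _; apply: imset_f.
apply: eq_bigr => c /imsetP[x0 _ ->].
rewrite (eq_bigr (fun _ => 'X_(g (porbit s x0)))); last first.
  by move=> x /eqP <-; rewrite ffunE.
rewrite prodr_const; congr (_ ^+ _); apply: eq_card => x.
by rewrite -eq_porbit_mem.
Qed.

Lemma prod_Xcnt (f : {ffun 'I_n -> 'I_M}) :
  \prod_(x < n) 'X_(f x) = 'X_[[multinom cnt f i | i < M]] :> {mpoly algC[M]}.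
Proof.
rewrite (mprodXE algC (fun x => U_(f x)%MM)).
congr 'X_[_]; apply/mnmP => i; rewrite mnm_sumE mnmE; apply: eq_bigr => x _.
by rewrite mnmE.
Qed.

End PowerSums.

(** Together with [hall_coef] it identifies the Hall product of h_ka and p_nu with a count of fixed
    functions. *)
Lemma psym_coef n (s : 'S_n) (nu : intpart) (ka : seq nat) :
  (0 < size ka)%N -> cycle_type s = nu ->
  sf_coef (psym nu) ka = Fc (size ka) (nth 0%N ka) s.
Proof.
move=> ka0 snu; rewrite /sf_coef /psym sf_poly_prod.
set M := size ka; have j0 : 'I_M := Ordinal ka0.
have -> : \prod_(k <- nu) psumS k.-1 M =
    \prod_(c in porbits s) \sum_(i < M) 'X_i ^+ #|c| :> {mpoly algC[M]}.
  rewrite -snu (perm_big [seq #|pred_of_set c| | c <- enum (porbits s)]) /=;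
    last by rewrite perm_sort.
  rewrite big_map big_enum /=; apply: eq_bigr => c /imsetP[x _ ->].
  have c0 : (0 < #|porbit s x|)%N by apply/card_gt0P; exists x; apply: porbit_id.
  by apply: eq_bigr => i _; rewrite prednK.
rewrite (prod_porbits s j0) raddf_sum /= /Fc.
rewrite [RHS]big_mkcondr /=; apply: eq_bigr => f _; rewrite prod_Xcnt mcoeffX.
rewrite (_ : (_ == _) = [forall i : 'I_M, cnt f i == nth 0%N ka i]).
  by case: ifP.
apply/eqP/forallP => [/mnmP h i|h]; first by have := h i; rewrite !mnmE => ->.
by apply/mnmP => i; rewrite !mnmE (eqP (h i)).
Qed.

Section CycleType.

Variables (n : nat) (nu : intpart).
Hypothesis nun : sumn nu = n.

Lemma rotate_lt (x : 'I_n) :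
  ((reshape_offset nu x).+1 %% nth 0%N nu (reshape_index nu x) <
   nth 0%N nu (reshape_index nu x))%N.
Proof.
rewrite ltn_mod; apply: leq_ltn_trans (reshape_offsetP _); first exact: leq0n.
by rewrite nun.
Qed.

Lemma rotate_sub (x : 'I_n) : (flatten_index nu (reshape_index nu x)
  ((reshape_offset nu x).+1 %% nth 0%N nu (reshape_index nu x))%N < n)%N.
Proof. by rewrite -[X in (_ < X)%N]nun; apply/flatten_indexP/rotate_lt. Qed.

(** Cyclic shift inside each of the consecutive intervals of lengths nu; its cycles are these
    intervals. *)
Definition rotate (x : 'I_n) : 'I_n := Ordinal (rotate_sub x).

Lemma rotate_index x : reshape_index nu (rotate x) = reshape_index nu x.
Proof. by rewrite flatten_indexKl // rotate_lt. Qed.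

Lemma rotate_offset x : reshape_offset nu (rotate x) =
  ((reshape_offset nu x).+1 %% nth 0%N nu (reshape_index nu x))%N.
Proof. by rewrite flatten_indexKr // rotate_lt. Qed.

Lemma offsetP (x : 'I_n) : (reshape_offset nu x < nth 0%N nu (reshape_index nu x))%N.
Proof. by apply: reshape_offsetP; rewrite nun. Qed.

Lemma rotate_inj : injective rotate.
Proof.
move=> x y e; have ei : reshape_index nu x = reshape_index nu y.
  by rewrite -rotate_index e rotate_index.
apply: val_inj => /=; rewrite -(reshape_indexK nu x) -(reshape_indexK nu y) ei.
congr flatten_index; have := rotate_offset x; rewrite e rotate_offset ei.
have := offsetP x; have := offsetP y; rewrite ei.
move: (reshape_offset nu x) (reshape_offset nu y) (nth 0%N nu _) => a b m bm am.
have h c : (c < m)%N -> (c.+1 %% m = if c.+1 == m then 0 else c.+1)%N.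
  move=> cm; case: eqP => [->|ne]; first by rewrite modnn.
  by rewrite modn_small //; lia.
by rewrite !h //; do 2!case: eqP; lia.
Qed.

Let s := perm rotate_inj.

Lemma porbit_rotate x : porbit s x = [set y : 'I_n | reshape_index nu y == reshape_index nu x].
Proof.
have inv (y : 'I_n) k : reshape_index nu ((s ^+ k)%g y) = reshape_index nu y.
  elim: k => [|k IH]; first by rewrite expg0 perm1.
  by rewrite expgSr permM permE rotate_index.
have off (y : 'I_n) k : (reshape_offset nu y + k < nth 0%N nu (reshape_index nu y))%N ->
    reshape_offset nu ((s ^+ k)%g y) = (reshape_offset nu y + k)%N.
  elim: k => [|k IH] h; first by rewrite expg0 perm1 addn0.
  rewrite expgSr permM permE rotate_offset inv IH; last by lia.
  by rewrite modn_small; lia.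
have reach (y z : 'I_n) : reshape_index nu y = reshape_index nu z ->
    (reshape_offset nu y <= reshape_offset nu z)%N -> z \in porbit s y.
  move=> e le; have -> : z = (s ^+ (reshape_offset nu z - reshape_offset nu y))%g y.
    apply: val_inj; rewrite /= -[LHS](reshape_indexK nu) -[RHS](reshape_indexK nu).
    rewrite inv e off subnKC //.
    by rewrite e; apply: offsetP.
  exact: mem_porbit.
apply/setP => y; rewrite inE; apply/idP/eqP => [/porbitP[k ->]|e]; first exact: inv.
case: (leqP (reshape_offset nu x) (reshape_offset nu y)) => h.
  exact: reach.
by rewrite porbit_sym; apply: reach => //; apply: ltnW.
Qed.

Lemma cycle_type_rotate : cycle_type s = nu.
Proof.
pose blk (r : 'I_(size nu)) := [set y : 'I_n | reshape_index nu y == r].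
have cblk r : #|blk r| = nth 0%N nu r.
  rewrite -(cnt_young_fun nun (leqnn (size nu))) /cnt -sum1_card big_mkcond /=.
  by apply: eq_bigr => x _; rewrite inE ffunE /=; case: eqP.
have pos (r : 'I_(size nu)) : (0 < nth 0%N nu r)%N.
  by apply: (allP (intpart_pos nu)); apply: mem_nth.
have iblk : injective blk.
  move=> r r' e; have /card_gt0P[x] : (0 < #|blk r|)%N by rewrite cblk.
  move=> xr; move: (xr); rewrite e !inE; move: xr; rewrite inE => /eqP -> /eqP.
  exact: val_inj.
have pE : porbits s = [set blk r | r : 'I_(size nu)].
  apply/setP => c; apply/imsetP/imsetP => [[x _ ->]|[r _ ->]].
    have xr : (reshape_index nu x < size nu)%N by rewrite reshape_indexP // nun.
    by exists (Ordinal xr) => //; rewrite porbit_rotate.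
  have /card_gt0P[x] : (0 < #|blk r|)%N by rewrite cblk.
  by rewrite inE => /eqP xr; exists x => //; rewrite porbit_rotate xr.
rewrite /cycle_type; apply: (sorted_eq geq_trans geq_anti).
- exact: (sort_sorted geq_total).
- exact: intpart_sorted.
rewrite perm_sort.
have -> : nu = [seq #|pred_of_set c| | c <- [seq blk r | r : 'I_(size nu)]] :> seq nat.
  rewrite -map_comp; apply: (@eq_from_nth _ 0%N).
    by rewrite size_map -cardE card_ord.
  move=> i iN; rewrite (nth_map (Ordinal iN)) /=; last by rewrite -cardE card_ord.
  by rewrite cblk nth_enum_ord.
apply: perm_map; apply: uniq_perm; rewrite ?enum_uniq //.
  by rewrite map_inj_uniq ?enum_uniq.
move=> c; rewrite mem_enum pE; apply/imsetP/imageP => -[r _ ->]; by exists r.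
Qed.

End CycleType.

Lemma cycle_type_exists (nu : intpart) :
  exists s : 'S_(sumn nu), cycle_type s = nu.
Proof. by exists (perm (@rotate_inj _ nu erefl)); apply: cycle_type_rotate. Qed.

(** * Lattice tableaux *)

(** Index 0 stands for an absent letter. The unbarred letter comes first, being the larger, and a
    proper prefix is smaller; the order of labels is therefore the lexicographic order of the pairs
    (k, i), zeros included. *)
Definition lab (k i : nat) : label :=
  (if k is k'.+1 then [:: (true, k) : letter] else [::]) ++
  (if i is i'.+1 then [:: (false, i) : letter] else [::]).

Lemma lab_lt k i k' i' :
  label_lt (lab k i) (lab k' i') = (k < k')%N || (k == k') && (i < i')%N.
Proof.
case: k k' i i' => [|k] [|k'] [|i] [|i']; rewrite /label_lt /lab /= ?ltxi0s ?ltxis0 //.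
all: rewrite ?Order.SeqLexiOrder.ltxi_cons.
all: rewrite ?Order.ProdLexiOrder.leEprodlexi /=.
all: rewrite ?Order.SeqLexiOrder.ltxis0 ?Order.SeqLexiOrder.ltxi0s ?leEnat /=; lia.
Qed.

Definition labj N j := lab (j %/ N) (j %% N).

Lemma ltn_divmod N j j' : (0 < N)%N ->
  (j < j')%N = (j %/ N < j' %/ N)%N || (j %/ N == j' %/ N)%N && (j %% N < j' %% N)%N.
Proof.
move=> N0; case: (ltngtP (j %/ N) (j' %/ N)) => [h|h|e] /=.
- by rewrite ltnNge; apply/negP => /(leq_div2r N); rewrite leqNgt h.
- by apply/negbTE; rewrite -leqNgt leqNgt; apply/negP => /ltnW /(leq_div2r N); rewrite leqNgt h.
- by rewrite {1}(divn_eq j N) {1}(divn_eq j' N) e ltn_add2l.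
Qed.

Lemma labj_lt N j j' : (0 < N)%N -> label_lt (labj N j) (labj N j') = (j < j')%N.
Proof. by move=> N0; rewrite lab_lt [RHS](@ltn_divmod N). Qed.

Lemma labj_le N j j' : (0 < N)%N -> label_le (labj N j) (labj N j') = (j <= j')%N.
Proof.
move=> N0; rewrite leqNgt -(labj_lt _ _ N0) /label_le /label_lt.
by rewrite -leNgt.
Qed.

Lemma labj_inj N : (0 < N)%N -> injective (labj N).
Proof.
move=> N0 j j' e; apply/eqP; rewrite eqn_leq -!(labj_le _ _ N0) e.
by rewrite /label_le lexx.
Qed.

Lemma unbarred_lab k i : unbarred_part (lab k i) = lab k 0.
Proof. by case: k i => [|k] [|i]. Qed.

Lemma barred_lab k i : [seq x.2 | x <- filter barred (lab k i)] =
  if (0 < i)%N then [:: i] else [::].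
Proof. by case: k i => [|k] [|i]. Qed.

Lemma lab0_eq k k' : (lab k 0 == lab k' 0) = (k == k').
Proof.
case: k k' => [|k] [|k'] //=.
by apply/eqP/eqP => [[->]|->].
Qed.

Lemma is_label_lab k i : (0 < k + i)%N -> is_label (lab k i) && set_label (lab k i).
Proof. by case: k i => [|k] [|i]. Qed.

Lemma count_lab k i (b : bool) m : (0 < m)%N ->
  count_mem ((b, m) : letter) (lab k i) = (m == if b then k else i) :> nat.
Proof.
case: m b k i => // m [] [|k] [|i] _ //=; rewrite ?addn0 ?add0n.
all: by rewrite ?xpair_eqE /= ?andbT ?eqSS ?[k == _]eq_sym ?[i == _]eq_sym ?addn0.
Qed.

Lemma sum_count (F : nat -> nat) M t : all (gtn M) t ->
  (\sum_(x <- t) F x = \sum_(0 <= a < M) F a * count_mem a t)%N.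
Proof.
elim: t => [|x t IH] /=.
  by rewrite big_nil big1 // => a _; rewrite muln0.
case/andP=> xM tM; rewrite big_cons IH //.
under [RHS]eq_bigr => a _ do rewrite mulnDr.
rewrite big_split /=; congr (_ + _)%N.
rewrite (@sum_one _ M x) //; first by rewrite eqxx muln1.
by move=> a _ ax; rewrite eq_sym (negbTE ax) muln0.
Qed.

Lemma count_sum (p : pred nat) M t : all (gtn M) t ->
  (count p t = \sum_(0 <= a < M) p a * count_mem a t)%N.
Proof.
move=> tM; rewrite -(sum_count (fun a => p a : nat) tM) -sum1_count big_mkcond.
by apply: eq_bigr => x _; case: (p x).
Qed.

Lemma pre_count t j : (\sum_(0 <= a < j) count_mem a t = count (gtn j) t)%N.
Proof.
elim: t => [|x t IH] /=; first by rewrite big1.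
rewrite big_split /= IH; congr (_ + _)%N.
have [xj|jx] := ltnP x j.
  by rewrite (@sum_one _ j x) ?eqxx // => a _ ax; rewrite eq_sym (negbTE ax).
rewrite big_nat_cond big1 // => a; rewrite andbT => /andP[_ aj].
by case: eqP => // e; lia.
Qed.

Lemma count_gtnE x s : count (gtn x) s = count (fun y : nat => (y < x)%O) s.
Proof. by apply: eq_count => y; rewrite /= ltEnat. Qed.

Lemma sorted_count_ge t s x : sorted leq s -> (count (gtn x) s <= t < size s)%N ->
  (x <= nth 0 s t)%N.
Proof.
by move=> ss; rewrite count_gtnE => h; have := nth_count_ge 0%N ss h; rewrite leEnat.
Qed.

Lemma sorted_count_lt t s x : sorted leq s -> (t < count (gtn x) s)%N ->
  (nth 0 s t < x)%N.
Proof.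
by move=> ss; rewrite count_gtnE => h; have := nth_count_lt 0%N ss h; rewrite ltEnat.
Qed.

(** It turns a comparison of cells in two adjacent rows into the inequality between counts that
    [ssyt] uses. *)
Lemma column_strictP a b M : sorted leq a -> sorted leq b -> (size b <= size a)%N ->
  all (gtn M) b ->
  (forall j, (j < size b)%N -> (nth 0 a j < nth 0 b j)%N) <->
  (forall t, (t < M)%N -> (count (gtn t.+1) b <= count (gtn t) a)%N).
Proof.
move=> sa sb ba bM; split=> h.
  move=> t tM; case e: (count _ _) => [|m] //.
  have h1 := @sorted_count_lt m b t.+1 sb; rewrite e in h1.
  have mb : (m < size b)%N by rewrite -ltnS -e; apply: (leq_ltn_trans (count_size _ _)).
  rewrite ltnNge; apply/negP => cm.
  have h2 := @sorted_count_ge m a t sa; rewrite cm (leq_trans mb ba) in h2.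
  by have := h _ mb; have := h1 (ltnSn _); have := h2 isT; lia.
move=> j jb; set t := nth 0%N b j.
have tM : (t < M)%N by apply: (allP bM); apply: mem_nth.
apply: sorted_count_lt => //; apply: leq_trans (h _ tM).
rewrite ltnNge; apply/negP => cj; have := @sorted_count_ge j b t.+1 sb.
by rewrite cj jb -/t ltnn => /(_ isT).
Qed.

Lemma take_sorted_geq d i : sorted geq d ->
  take (count (leq i) d) d = filter (leq i) d.
Proof.
elim: d => //= x d IH pd; case: (leqP i x) => ix /=; first by congr (_ :: _); rewrite add0n; apply/IH/(path_sorted pd).
rewrite add0n; have : all (fun y => ~~ (i <= y)%N) d.
  have := order_path_min geq_trans pd; apply: sub_all => y /= yx; lia.
move=> h; have -> : filter (leq i) d = [::].
  by apply/eqP; rewrite -(negbK (_ == _)) -has_filter -all_predC.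
have -> : count (leq i) d = 0%N by apply/eqP; rewrite -leqn0 leqNgt -has_count -all_predC.
by rewrite take0.
Qed.

(** In a weakly decreasing word the letters i + 1 precede the letters i, so the critical prefix is u
    followed by all the letters of d that exceed i. *)
Lemma lattice_word_cat u d : sorted geq d ->
  lattice_word (u ++ d) <-> lattice_word u /\
  (forall i, (0 < i)%N -> (count_mem i.+1 (u ++ d) <= count_mem i u)%N).
Proof.
move=> sd; split=> [h|[hu hd] t i i0].
  split=> [t i i0|i i0].
    have [tu|ut] := leqP t (size u).
      by have := h t i i0; rewrite takel_cat.
    have := h (size u) i i0; rewrite take_size_cat // take_oversize //; exact: ltnW.
  have := h (size u + count (leq i.+1) d)%N i i0.
  rewrite take_cat ltnNge leq_addr /= addKn take_sorted_geq // !count_cat.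
  have -> : count_mem i.+1 [seq x <- d | (i < x)%N] = count_mem i.+1 d.
    by rewrite count_filter; apply: eq_count => x /=; case: eqP => // ->; rewrite leqnn.
  rewrite [count_mem i (filter _ _)](_ : _ = 0%N) ?addn0 //.
  by rewrite count_filter (@eq_count _ _ pred0) ?count_pred0 // => x /=; lia.
have [tu|ut] := leqP t (size u); first by rewrite takel_cat //; apply: hu.
rewrite take_cat ltnNge (ltnW ut) /= !count_cat.
have h1 := hd i i0; rewrite count_cat in h1.
have h2 : (count_mem i.+1 (take (t - size u) d) <= count_mem i.+1 d)%N.
  by rewrite -{2}(cat_take_drop (t - size u) d) count_cat leq_addr.
exact: leq_trans (leq_trans (leq_add (leqnn _) h2) h1) (leq_addr _ _).
Qed.

Lemma lattice_blocks (blk : nat -> seq nat) Bn : (forall b, sorted geq (blk b)) ->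
  lattice_word (flatten (mkseq blk Bn)) <->
  (forall b i, (b < Bn)%N -> (0 < i)%N ->
    (\sum_(0 <= b' < b.+1) count_mem i.+1 (blk b') <=
     \sum_(0 <= b' < b) count_mem i (blk b'))%N).
Proof.
move=> sb.
have cE i B : count_mem i (flatten (mkseq blk B)) =
    (\sum_(0 <= b' < B) count_mem i (blk b'))%N.
  rewrite count_flatten -map_comp sumnE big_map -[X in iota 0 X]subn0.
  by rewrite -/(index_iota 0 B).
elim: Bn => [|B IH]; first by split=> // _ t i _; rewrite /mkseq /= !count_mem_nil.
rewrite mkseqS flatten_rcons; split.
  case/(lattice_word_cat _ (sb B)) => /IH h1 h2 b i.
  rewrite ltnS leq_eqVlt => /orP[/eqP ->|bB] i0; last exact: h1.
  by rewrite -!cE mkseqS flatten_rcons; apply: h2.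
move=> h; apply/lattice_word_cat => //; split.
  by apply/IH => b i bB; apply: h; apply: ltnW.
by move=> i i0; rewrite -flatten_rcons -mkseqS !cE; apply: h.
Qed.

Lemma flatten_mkseq_wide (T : Type) (f : nat -> seq T) m R : (m <= R)%N ->
  (forall r, (m <= r)%N -> f r = [::]) ->
  flatten (mkseq f R) = flatten (mkseq f m).
Proof.
move=> mR h; rewrite -(subnKC mR); elim: (R - m)%N => [|d IH]; first by rewrite addn0.
by rewrite addnS mkseqS flatten_rcons IH h ?cats0 // leq_addr.
Qed.

Lemma flatten_mkseq_mul (T : Type) (g : nat -> seq T) L R :
  flatten (mkseq (fun k => flatten (mkseq (fun r => g (k * R + r)%N) R)) L) =
  flatten (mkseq g (L * R)).
Proof.
elim: L => [|L IH] //; rewrite mkseqS flatten_rcons IH mulSn addnC.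
rewrite /mkseq iotaD map_cat flatten_cat add0n; congr (_ ++ flatten _).
by rewrite -[in RHS](addn0 (L * R)%N) iotaDl -map_comp.
Qed.

Lemma flatten_map_filter (T S : Type) (p : pred T) (f : T -> seq S) s :
  (forall x, ~~ p x -> f x = [::]) ->
  flatten (map f (filter p s)) = flatten (map f s).
Proof.
move=> h; elim: s => //= x s IH; case: (boolP (p x)) => px /=; rewrite IH //.
by rewrite (h _ px).
Qed.

Lemma sum_groups_shift (F : nat -> nat) k r R :
  (\sum_(0 <= b < k * R + r) F b =
   \sum_(0 <= k' < k) \sum_(0 <= r' < R) F (k' * R + r')%N +
   \sum_(0 <= r' < r) F (k * R + r')%N)%N.
Proof.
rewrite (@big_cat_nat _ _ _ (k * R)%N) ?leq_addr //=; congr (_ + _)%N.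
  by rewrite (sum_groups R (fun=> F) 0%N k).
rewrite -{1}[(k * R)%N]add0n big_addn addKn.
by apply: eq_bigr => i _; rewrite addnC.
Qed.

Lemma count_letters b b' al m :
  count_mem ((b, m) : letter) (letters b' al) =
  if (b == b') && (0 < m)%N then nth 0%N al m.-1 else 0%N.
Proof.
rewrite /letters count_flatten -map_comp sumnE big_map.
rewrite -[X in iota 0 X]subn0 -/(index_iota 0 (size al)).
have e i : (count_mem ((b, m) : letter) \o
    (fun i => nseq (nth 0%N al i) ((b', i.+1) : letter))) i =
    if (b == b') && (m == i.+1) then nth 0%N al i else 0%N.
  rewrite /= count_nseq /= xpair_eqE eq_sym [i.+1 == m]eq_sym.
  by case: ifP; rewrite ?mul1n ?mul0n.
rewrite (eq_bigr _ (fun i _ => e i)).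
case: (b == b'); last by rewrite big1.
case: m {e} => [|m] /=; first by rewrite big1.
have [mal|alm] := ltnP m (size al).
  rewrite (@sum_one _ _ m) //; first by rewrite eqxx.
  by move=> j _ jm; rewrite eqSS eq_sym (negbTE jm).
rewrite nth_default // big_nat_cond big1 // => i; rewrite andbT => /andP[_ ia].
by case: eqP => // -[e]; lia.
Qed.

Section NatTableaux.

Variables L N : nat.
Hypotheses (N0 : (0 < N)%N) (L0 : (0 < L)%N).
Notation M := (L * N)%N.
Implicit Types (U : seq (seq nat)) (t : seq nat).

Definition tabU U : tableau := map (map (labj N)) U.

(** The code 0 is that of the empty label, which a tableau does not contain. *)
Definition okrow t := sorted leq t && all (fun j => 0 < j < M)%N t.

Definition uu U (r j : nat) : nat := count_mem j (nth [::] U r).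

Lemma okrow_lt t : okrow t -> all (gtn M) t.
Proof. by case/andP=> _; apply: sub_all => j /andP[]. Qed.

Lemma nth_tabU U r : nth [::] (tabU U) r = map (labj N) (nth [::] U r).
Proof.
have [rU|Ur] := ltnP r (size U); first by rewrite (nth_map [::]).
by rewrite !nth_default ?size_map.
Qed.

Lemma nth_okrow U r : all okrow U -> okrow (nth [::] U r).
Proof.
move=> /allP h; have [rU|Ur] := ltnP r (size U); first exact/h/mem_nth.
by rewrite nth_default.
Qed.

(** The barred letters of the cells in group k; [leq 1] discards the cells that have none. *)
Definition wd k (s : seq nat) :=
  filter (leq 1) [seq j %% N | j <- s & j %/ N == k]%N.

Lemma wd_flatten k ss : wd k (flatten ss) = flatten (map (wd k) ss).
Proof. by rewrite /wd filter_flatten map_flatten filter_flatten -!map_comp. Qed.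

Lemma wd_rev k s : wd k (rev s) = rev (wd k s).
Proof. by rewrite /wd filter_rev map_rev filter_rev. Qed.

Lemma wd_sorted k t : sorted leq t -> sorted geq (rev (wd k t)).
Proof.
move=> st; rewrite rev_sorted; apply: sorted_filter; first exact: leq_trans.
have := sorted_filter leq_trans (fun j => j %/ N == k)%N st.
apply: (homo_sorted_in (P := fun j => j %/ N == k)%N).
  move=> x y /eqP ex /eqP ey; rewrite {1}(divn_eq x N) {1}(divn_eq y N).
  by rewrite ex ey leq_add2l.
exact: filter_all.
Qed.

Lemma count_wd k t i : (0 < i)%N -> (i < N)%N ->
  count_mem i (wd k t) = count_mem (k * N + i)%N t.
Proof.
move=> i0 iN; rewrite /wd count_filter count_map count_filter; apply: eq_count => j /=.
apply/andP/eqP => [[/andP[/eqP <- _] /eqP <-]|->]; first by rewrite -divn_eq.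
by rewrite modnMDl modn_small // divnMDl // divn_small // addn0 !eqxx.
Qed.

Lemma count_wd_out k t i : (N <= i)%N -> count_mem i (wd k t) = 0%N.
Proof.
move=> Ni; rewrite /wd count_filter count_map; apply/eqP.
rewrite -leqn0 leqNgt -has_count; apply/hasPn => j _ /=.
have := ltn_pmod j N0; case: eqP => [->|//]; lia.
Qed.

Lemma reading_tabU U : reading (tabU U) = map (labj N) (flatten (map rev U)).
Proof.
rewrite /reading /tabU map_flatten -!map_comp; congr flatten; apply: eq_map => t /=.
by rewrite map_rev.
Qed.

Lemma unbarred_labj j : unbarred_part (labj N j) = lab (j %/ N) 0.
Proof. exact: unbarred_lab. Qed.

Lemma read_word_tabU U k :
  read_word (tabU U) (lab k 0) = wd k (flatten (map rev U)).
Proof.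
rewrite /read_word reading_tabU filter_map -map_comp /wd.
rewrite (eq_filter (a2 := fun j => j %/ N == k)%N); last first.
  by move=> j /=; rewrite unbarred_labj lab0_eq.
elim: (filter _ _) => //= j s IH; rewrite /labj barred_lab IH.
by case: posnP.
Qed.

Lemma unbarred_parts_tabU U : all okrow U ->
  unbarred_parts (tabU U) = [seq lab k 0 | k <- iota 1 L.-1 &
    has (fun j => j %/ N == k)%N (flatten (map rev U))].
Proof.
move=> Uok; rewrite /unbarred_parts reading_tabU -map_comp.
set W := flatten _.
have WM j : j \in W -> (j < M)%N.
  case/flattenP => t /mapP[t' t'U ->]; rewrite mem_rev => jt.
  exact: (allP (okrow_lt (allP Uok _ t'U))).
apply: (sorted_eq (leT := label_le)).
- by move=> x y z; apply: le_trans.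
- by move=> x y; apply: le_anti.
- by apply: sort_sorted => x y; apply: le_total.
- rewrite sorted_map; apply: (sub_sorted (e := ltn)).
    move=> a b /= ab; rewrite /label_le; apply: ltW.
    by have := lab_lt a 0 b 0; rewrite /label_lt ab.
  by apply: (sorted_filter ltn_trans); apply: iota_ltn_sorted.
rewrite perm_sort; apply: uniq_perm; first exact: undup_uniq.
  rewrite map_inj_uniq ?filter_uniq ?iota_uniq // => a b /eqP.
  by rewrite lab0_eq => /eqP.
move=> S; rewrite mem_undup mem_filter; apply/andP/mapP.
  case=> S0 /mapP[j jW eS]; exists (j %/ N)%N; last by rewrite eS /= unbarred_labj.
  rewrite mem_filter mem_iota; apply/andP; split; first by apply/hasP; exists j.
  have jL : (j %/ N < L)%N by rewrite ltn_divLR // WM.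
  move: S0; rewrite eS /= unbarred_labj; case: (j %/ N)%N jL => //= q qL _.
  by rewrite add1n prednK.
case=> k; rewrite mem_filter mem_iota => /andP[/hasP[j jW /eqP jk] /andP[k0 _]] ->.
split; first by case: k k0 {jk}.
by apply/mapP; exists j => //=; rewrite unbarred_labj jk.
Qed.

(** Groups that do not occur in the tableau, and rows beyond its last one, contribute empty words,
    so the word is a concatenation over all k < L and r < R. The condition starts at i = 1 because i
    = 0 stands for no barred letter. *)
Lemma lattice_tabU U R : all okrow U -> (size U <= R)%N ->
  is_lattice (tabU U) <->
  (forall k r i, (k < L)%N -> (r < R)%N -> (0 < i)%N -> (i.+1 < N)%N ->
   lat_height R N (uu U) k r.+1 i.+1 <= lat_height R N (uu U) k r i)%N.
Proof.
move=> Uok UR; rewrite /is_lattice unbarred_parts_tabU //.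
set W := flatten (map rev U).
pose blk b := rev (wd (b %/ R)%N (nth [::] U (b %% R)%N)).
have -> : flatten (map (read_word (tabU U)) ([::] :: [seq lab k 0 | k <- iota 1 L.-1 &
    has (fun j => j %/ N == k)%N W])) = flatten (mkseq blk (L * R)).
  rewrite /= -map_comp (eq_map (g := fun k => wd k W)); last first.
    by move=> k /=; rewrite read_word_tabU.
  rewrite flatten_map_filter; last first.
    move=> k /hasPn h; rewrite /wd (_ : filter _ W = [::]) //.
    by apply/eqP; rewrite -(negbK (_ == _)) -has_filter; apply/hasPn.
  rewrite -[[::] : label]/(lab 0 0) read_word_tabU -/W.
  have -> : wd 0 W ++ flatten [seq wd k W | k <- iota 1 L.-1] =
      flatten (mkseq (fun k => wd k W) L) by rewrite -[in RHS](prednK L0).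
  rewrite -flatten_mkseq_mul; congr flatten; apply/eq_in_map => k _.
  have -> : wd k W = flatten (mkseq (fun r => rev (wd k (nth [::] U r))) (size U)).
    rewrite /W wd_flatten -map_comp; congr flatten.
    rewrite -{1}(mkseq_nth [::] U) -map_comp; apply: eq_map => r /=.
    by rewrite wd_rev.
  rewrite -(flatten_mkseq_wide UR); last by move=> r rU; rewrite nth_default.
  congr flatten; apply/eq_in_map => r; rewrite mem_iota add0n => /andP[_ rR].
  rewrite /blk modnMDl modn_small // divnMDl ?divn_small ?addn0 //.
  exact: leq_ltn_trans rR.
have sblk b : sorted geq (blk b).
  by apply: wd_sorted; case/andP: (nth_okrow (b %% R)%N Uok).
have cblk k r i : (r < R)%N -> (0 < i)%N -> (i < N)%N ->
    count_mem i (blk (k * R + r)%N) = uu U r (k * N + i)%N.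
  move=> rR i0 iN; rewrite /blk count_rev modnMDl modn_small // divnMDl; last first.
    exact: leq_ltn_trans rR.
  by rewrite divn_small // addn0 count_wd.
have hE k r i : (r <= R)%N -> (0 < i)%N -> (i < N)%N ->
    (\sum_(0 <= b < k * R + r) count_mem i (blk b) = lat_height R N (uu U) k r i)%N.
  move=> rR i0 iN; rewrite sum_groups_shift /lat_height; congr (_ + _)%N.
    apply: eq_bigr => k' _; apply: eq_big_nat => r' /andP[_ r'R].
    exact: cblk.
  apply: eq_big_nat => r' /andP[_ r'r]; apply: cblk => //.
  exact: leq_trans r'r rR.
split.
  move/(lattice_blocks _ sblk) => h k r i kL rR i0 iN.
  rewrite -!hE // ?(ltnW iN) // ?(ltnW rR) // addnS.
  by apply: h => //; apply: mul_add_lt.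
move=> h; apply/lattice_blocks => // b i bLR i0.
have [iN|Ni] := ltnP i.+1 N; last first.
  by rewrite big1 // => b' _; rewrite /blk count_rev count_wd_out.
case: (col_split bLR) => k [r [kL rR ->]].
rewrite -addnS !hE // ?(ltnW iN) // ?(ltnW rR) //.
exact: h.
Qed.

Lemma count_tabU U R b m : all okrow U -> (size U <= R)%N -> (0 < m)%N ->
  count_mem ((b, m) : letter) (flatten (flatten (tabU U))) =
  (\sum_(0 <= r < R) \sum_(0 <= k < L) \sum_(0 <= i < N)
     (m == if b then k else i) * uu U r (k * N + i))%N.
Proof.
move=> Uok UR m0; rewrite !count_flatten.
have -> : flatten (tabU U) = map (labj N) (flatten U) by rewrite /tabU map_flatten.
rewrite -map_comp sumnE big_map big_flatten /=.
have -> : (\sum_(t <- U) \sum_(j <- t) count_mem ((b, m) : letter) (labj N j) =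
    \sum_(0 <= r < size U) \sum_(j <- nth [::] U r) count_mem ((b, m) : letter) (labj N j))%N.
  by rewrite (big_nth [::]).
rewrite [RHS](@big_cat_nat _ _ _ (size U)) //=.
rewrite [X in (_ + X)%N]big_nat_cond [X in (_ + X)%N]big1 ?addn0; last first.
  move=> r; rewrite andbT => /andP[Ur _]; rewrite big1 // => k _; rewrite big1 // => i _.
  by rewrite /uu nth_default //= muln0.
apply: eq_bigr => r _.
rewrite (@sum_count (fun j => count_mem ((b, m) : letter) (labj N j)) M); last first.
  exact/okrow_lt/nth_okrow.
have := sum_groups N (fun _ j => count_mem ((b, m) : letter) (labj N j) *
  count_mem j (nth [::] U r))%N 0%N L.
rewrite /pre => <-.
apply: eq_bigr => k _; apply: eq_big_nat => i /andP[_ iN].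
rewrite /labj count_lab // modnMDl modn_small // divnMDl // divn_small // addn0.
by [].
Qed.

Lemma content_tabU U R la al : all okrow U -> (size U <= R)%N ->
  (size la < N)%N -> (size al < L)%N ->
  perm_eq (flatten (flatten (tabU U))) (letters false la ++ letters true al) <->
  (forall i, (0 < i)%N -> (i < N)%N ->
     xcont R L N (uu U) i = nth 0%N la i.-1) /\
  (forall k, (0 < k)%N -> (k < L)%N ->
     \sum_(0 <= r < R) \sum_(0 <= i < N) uu U r (k * N + i) = nth 0%N al k.-1)%N.
Proof.
move=> Uok UR laN alL.
have cF i : (0 < i)%N -> (i < N)%N ->
    count_mem ((false, i) : letter) (flatten (flatten (tabU U))) = xcont R L N (uu U) i.
  move=> i0 iN; rewrite (@count_tabU U R) // /xcont exchange_big /=.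
  apply: eq_bigr => k _; apply: eq_bigr => r _; rewrite (@sum_one _ N i) ?eqxx ?mul1n //.
  by move=> j _ ji; rewrite eq_sym (negbTE ji).
have cT k : (0 < k)%N -> (k < L)%N ->
    count_mem ((true, k) : letter) (flatten (flatten (tabU U))) =
    (\sum_(0 <= r < R) \sum_(0 <= i < N) uu U r (k * N + i))%N.
  move=> k0 kL; rewrite (@count_tabU U R) //; apply: eq_bigr => r _.
  rewrite (@sum_one _ L k) //.
    by apply: eq_bigr => i _; rewrite eqxx mul1n.
  by move=> j _ jk; rewrite big1 // => i _; rewrite eq_sym (negbTE jk).
have cR b m : count_mem ((b, m) : letter) (letters false la ++ letters true al) =
    if (0 < m)%N then nth 0%N (if b then al else la) m.-1 else 0%N.
  by rewrite count_cat !count_letters; case: b; case: m => [|m]; rewrite /= ?addn0.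
split.
  move/seq.permP => h; split=> [i i0 iN|k k0 kL].
    by rewrite -cF // h cR i0.
  by rewrite -cT // h cR k0.
case=> h1 h2; apply/allP => -[b m] _ /=; apply/eqP; rewrite cR.
case: posnP => [->|m0].
  apply/eqP; rewrite -leqn0 leqNgt -has_count; apply/hasP => -[x].
  case/flattenP => S /flattenP[t /mapP[t' t'U ->] /mapP[j jt ->]] xS /eqP ex.
  rewrite ex in xS; move: xS; rewrite /labj /lab.
  by case: (j %/ N)%N => [|?]; case: (j %% N)%N => [|?]; case: b {ex}.
case: b => /=.
  have [mL|Lm] := ltnP m L; first by rewrite cT // h2.
  rewrite nth_default; last by lia.
  rewrite (@count_tabU U R) // big1 // => r _; rewrite big_nat_cond big1 // => k.
  rewrite andbT => /andP[_ kL]; rewrite big1 // => i _.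
  by case: eqP => // e; lia.
have [mN|Nm] := ltnP m N; first by rewrite cF // h1.
rewrite nth_default; last by lia.
rewrite (@count_tabU U R) // big1 // => r _; rewrite big1 // => k _.
rewrite big_nat_cond big1 // => i; rewrite andbT => /andP[_ iN].
by case: eqP => // e; lia.
Qed.

End NatTableaux.

Lemma size_flatten_ge (T : tableau) : all (all is_label) T ->
  (size (flatten T) <= size (flatten (flatten T)))%N.
Proof.
move=> Tl; have : all is_label (flatten T).
  by apply/allP => S /flattenP[t tT St]; apply: (allP (allP Tl _ tT)).
elim: (flatten T) => //= S s IH /andP[/and3P[S0 _ _] /IH].
by rewrite size_cat -add1n => h; apply: leq_add => //; case: S S0.
Qed.

Lemma size_letters b (be : seq nat) : size (letters b be) = sumn be.
Proof.
rewrite /letters size_flatten /shape -map_comp -[RHS](congr1 sumn (mkseq_nth 0%N be)).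
by congr sumn; apply: eq_map => i /=; rewrite size_nseq.
Qed.

Lemma nth_sum_shift (be : seq nat) m : (size be < m)%N ->
  (\sum_(1 <= i < m) nth 0%N be i.-1)%N = sumn be.
Proof.
move=> bm; have -> : m = m.-1.+1 by lia.
by rewrite big_add1 /= sum_nth_wide //; lia.
Qed.

(** * From arrays with many empty labels to the tableaux of the theorem *)

Section Bijection.

Variables (la ga : intpart) (al : seq nat) (n : nat).

Let s0 := (sumn la + sumn al)%N.
(** Large enough for the parts of (n - |la|, la) and, when |ga| is at most s0, for the rows of (n -
    |ga|, ga). In [ngroups] the extra group is the one without unbarred letter. *)
Definition nvars := (size la + s0).+2.
Definition ngroups := (size al).+1.
Notation N := nvars.
Notation L := ngroups.
Notation M := (L * N)%N.

Hypotheses (gas : (sumn ga <= s0)%N) (ns : (3 * s0 < n)%N).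

Let nu := nth 0%N ((n - sumn al)%N :: al).
Let lah := nth 0%N ((n - sumn la)%N :: la).
Let rho := nth 0%N ((n - sumn ga)%N :: ga).

Let N0 : (0 < N)%N. Proof. by []. Qed.
Let L0 : (0 < L)%N. Proof. by []. Qed.

Let laN : (size la < N)%N. Proof. rewrite /nvars; lia. Qed.
Let alL : (size al < L)%N. Proof. by []. Qed.

Let gaM : ((size ga).+1 <= M)%N.
Proof.
apply: leq_trans (leq_pmull N L0); rewrite /nvars.
by have := size_part ga; move: gas; lia.
Qed.

(** The conditions on a tableau expressed by multiplicities; none of them refers to the empty
    labels, which the array has in addition. *)
Record tab_cond (U : seq (seq nat)) : Prop := TabCond {
  tc_size : size U = (size ga).+1;
  tc_shape : forall r, size (nth [::] U r.+1) = nth 0%N ga r;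
  tc_cols : forall r t, (r.+1 < size ga)%N -> (t < M)%N ->
    (count (gtn t.+1) (nth [::] U r.+2) <= count (gtn t) (nth [::] U r.+1))%N;
  tc_xcont : forall i, (0 < i)%N -> (i < N)%N -> xcont M L N (uu U) i = nth 0%N la i.-1;
  tc_zcont : forall k, (0 < k)%N -> (k < L)%N ->
    (\sum_(0 <= r < M) \sum_(0 <= i < N) uu U r (k * N + i) = nth 0%N al k.-1)%N;
  tc_row1 : forall i, (0 < i)%N -> (i < N)%N -> uu U 0 i = 0%N;
  tc_lat : forall k r i, (k < L)%N -> (r < M)%N -> (0 < i)%N -> (i.+1 < N)%N ->
    (lat_height M N (uu U) k r.+1 i.+1 <= lat_height M N (uu U) k r i)%N
}.

Definition good_tab (T : tableau) : Prop :=
  [/\ is_mct ga la al T, all (all set_label) T & is_lattice T].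

Lemma label_form (S : label) : is_label S -> set_label S ->
  (forall x : letter, x \in S -> (0 < x.2)%N && (if x.1 then x.2 < L else x.2 < N)%N) ->
  exists2 j, (0 < j < M)%N & S = labj N j.
Proof.
move=> /and3P[S0 sS _] /and3P[_ cu cb] h.
have [k [i [ki kL iN ->]]] : exists k i, [/\ (0 < k + i)%N, (k < L)%N, (i < N)%N & S = lab k i].
  case: S S0 sS cu cb h => [|x [|y [|z S]]] // _.
  - case: x => -[] a _ _ _ h; have := h _ (mem_head _ _) => /= /andP[a0 aL].
      by exists a, 0%N; rewrite addn0; split=> //; case: a a0 {h aL}.
    by exists 0%N, a; rewrite add0n; split=> //; case: a a0 {h aL}.
  - case: x y => -[] a [[] b] sS cu cb h.
    + by move: cu => /=; lia.
    + have := h _ (mem_head _ _) => /= /andP[a0 aL].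
      have := h (false, b); rewrite !inE eqxx orbT => /(_ isT) /= /andP[b0 bN].
      exists a, b; split=> //; first by rewrite addn_gt0 a0.
      by case: a b a0 b0 {h aL bN sS cu cb} => [|a] [|b].
    + by move: sS.
    + by move: cb => /=; lia.
  - by case: x y z => -[] a [[] b] [[] d] /=; lia.
exists (k * N + i)%N; last first.
  by rewrite /labj modnMDl modn_small // divnMDl // divn_small // addn0.
rewrite mul_add_lt // andbT; move: ki; rewrite !addn_gt0 muln_gt0 N0 andbT.
by [].
Qed.

Lemma tabU_of (T : tableau) : good_tab T ->
  exists2 U, all (okrow L N) U & T = tabU N U.
Proof.
case=> -[_ _ Tl Tr _ Tc _] Ts _.
have form S : S \in flatten T -> exists2 j, (0 < j < M)%N & S = labj N j.
  case/flattenP => t tT St; apply: label_form.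
  - exact: (allP (allP Tl _ tT)).
  - exact: (allP (allP Ts _ tT)).
  move=> [b m] xS; have : ((b, m) : letter) \in flatten (flatten T).
    by apply/flattenP; exists S => //; apply/flattenP; exists t.
  rewrite (perm_mem Tc) -has_pred1 has_count count_cat !count_letters.
  case: b {xS} => /=; case: m => [|m] //=; rewrite ?addn0 ?add0n => h.
    by rewrite /ngroups ltnS leqNgt; apply/negP => h'; rewrite nth_default ?ltnn // in h.
  apply: leq_trans (_ : m.+2 <= (size la).+1)%N _ => //.
  by rewrite ltnS leqNgt; apply/negP => h'; rewrite nth_default ?ltnn // in h.
pose idx (S : label) := if S \in flatten T then
  odflt 0%N (omap val [pick j : 'I_M | labj N j == S]) else 0%N.
have idxP S : S \in flatten T -> (0 < idx S < M)%N /\ labj N (idx S) = S.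
  move=> ST; rewrite /idx ST; have [j /andP[j0 jM] eS] := form S ST.
  case: pickP => [j' /eqP ej'|/(_ (Ordinal jM))]; last by rewrite eS eqxx.
  rewrite /= ej'; split=> //; have := ej'; rewrite eS => /(labj_inj N0) ->.
  by rewrite j0.
have rowE t : t \in T -> map (labj N) (map idx t) = t.
  move=> tT; rewrite -map_comp -[RHS]map_id; apply/eq_in_map => S St /=.
  by have [] := idxP S; first by apply/flattenP; exists t.
exists (map (map idx) T).
  apply/allP => u /mapP[t tT ->]; apply/andP; split.
    have := allP Tr _ tT; rewrite -{1}(rowE t tT) sorted_map.
    by apply: sub_sorted => a b /=; rewrite labj_le.
  apply/allP => j /mapP[S St ->]; have [] // := idxP S.
  by apply/flattenP; exists t.
rewrite /tabU -map_comp -[LHS]map_id; apply/eq_in_map => t tT /=.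
by rewrite rowE.
Qed.

Lemma ga_le r : (nth 0%N ga r.+1 <= nth 0%N ga r)%N.
Proof. by apply: nth_rho_le; case: (ga). Qed.

Lemma good_tabU U : all (okrow L N) U -> good_tab (tabU N U) <-> tab_cond U.
Proof.
move=> Uok.
have okr r : okrow L N (nth [::] U r) by apply: nth_okrow.
have sorr r : sorted leq (nth [::] U r) by case/andP: (okr r).
have nthB r : nth [::] (behead (tabU N U)) r = map (labj N) (nth [::] U r.+1).
  by rewrite nth_behead nth_tabU.
have row1P : all (has unbarred) (head [::] (tabU N U)) <->
    (forall i, (0 < i)%N -> (i < N)%N -> uu U 0 i = 0%N).
  have -> : head [::] (tabU N U) = map (labj N) (nth [::] U 0) by rewrite -nth_tabU nth0.
  rewrite all_map.
  have e j : has unbarred (labj N j) = (0 < j %/ N)%N.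
    by rewrite /labj /lab; case: (j %/ N)%N; case: (j %% N)%N.
  rewrite (eq_all (a2 := fun j => 0 < j %/ N)%N) //; split.
    move=> /allP h i i0 iN; apply/count_memPn/negP => /h.
    by rewrite divn_small.
  move=> h; apply/allP => j jU; rewrite divn_gt0 // leqNgt; apply/negP => jN.
  have j0 : (0 < j)%N by case/andP: (okr 0%N) => _ /allP /(_ _ jU) /andP[].
  by have /count_memPn := h _ j0 jN; rewrite jU.
have colP : shape (behead U) = ga ->
    ((forall i j, (j < nth 0%N ga i.+1)%N ->
      label_lt (nth [::] (nth [::] (behead (tabU N U)) i) j)
               (nth [::] (nth [::] (behead (tabU N U)) i.+1) j)) <->
    (forall r t, (r.+1 < size ga)%N -> (t < M)%N ->
      (count (gtn t.+1) (nth [::] U r.+2) <= count (gtn t) (nth [::] U r.+1))%N)).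
  move=> sh; have sz r : size (nth [::] U r.+1) = nth 0%N ga r.
    by rewrite -nth_behead -nth_shape sh.
  have lE i j : (j < nth 0%N ga i.+1)%N ->
      label_lt (nth [::] (nth [::] (behead (tabU N U)) i) j)
               (nth [::] (nth [::] (behead (tabU N U)) i.+1) j) =
      (nth 0 (nth [::] U i.+1) j < nth 0 (nth [::] U i.+2) j)%N.
    move=> jg; rewrite !nthB !(nth_map 0%N) ?sz //; first exact: labj_lt.
    exact: leq_trans jg (ga_le i).
  have cs r := @column_strictP (nth [::] U r.+1) (nth [::] U r.+2) M (sorr _) (sorr _).
  split=> h.
    move=> r t rg; move: t; apply/cs; first by rewrite !sz ga_le.
      exact: okrow_lt.
    by move=> j; rewrite sz => jg; rewrite -lE //; apply: h.
  move=> r j jg; rewrite lE //; have rg : (r.+1 < size ga)%N.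
    by rewrite ltnNge; apply/negP => h'; rewrite nth_default in jg.
  have := cs r; rewrite !sz ga_le => /(_ isT (okrow_lt (okr _)))[_ cs'].
  by apply: (cs' (fun t => h r t rg)); rewrite ?sz.
split.
  case=> -[T0 sh Tl Tr Tcol Tc T1] Ts Tlat.
  have shU : shape (behead U) = ga.
    rewrite -sh /tabU behead_map /shape -map_comp; apply: eq_map => t /=.
    by rewrite size_map.
  have szU : size U = (size ga).+1.
    by rewrite -shU size_map size_behead prednK //; case: (U) T0.
  have UM : (size U <= M)%N by rewrite szU.
  have [X1 X2] := (content_tabU N0 L0 Uok UM laN alL).1 Tc.
  split=> //.
  - by move=> r; rewrite -nth_behead -nth_shape shU.
  - exact/(colP shU).
  - exact/row1P.
  - exact: (lattice_tabU N0 L0 Uok UM).1 Tlat.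
case=> szU sz cols X1 X2 r1 lat.
have UM : (size U <= M)%N by rewrite szU.
have shU : shape (behead U) = ga.
  apply: (@eq_from_nth _ 0%N); first by rewrite size_map size_behead szU.
  by move=> r _; rewrite nth_shape nth_behead sz.
have lab_ok j : (0 < j < M)%N -> is_label (labj N j) && set_label (labj N j).
  move=> /andP[j0 _]; apply: is_label_lab; move: j0; rewrite {1}(divn_eq j N).
  by case: (j %/ N)%N; case: (j %% N)%N.
split; last exact: (lattice_tabU N0 L0 Uok UM).2 lat.
  split.
  - by rewrite -size_eq0 size_map szU.
  - rewrite -[RHS]shU /tabU behead_map /shape -map_comp; apply: eq_map => t /=.
    by rewrite size_map.
  - apply/allP => t /mapP[u uU ->]; apply/allP => S /mapP[j ju ->].
    case/andP: (allP Uok _ uU) => _ /allP /(_ _ ju) /lab_ok /andP[] //.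
  - apply/allP => t /mapP[u uU ->]; rewrite sorted_map.
    case/andP: (allP Uok _ uU) => su _; apply: sub_sorted su => a b /= ab.
    by rewrite labj_le.
  - exact/(colP shU).
  - exact: (content_tabU N0 L0 Uok UM laN alL).2 (conj X1 X2).
  - exact/row1P.
apply/allP => t /mapP[u uU ->]; apply/allP => S /mapP[j ju ->].
by case/andP: (allP Uok _ uU) => _ /allP /(_ _ ju) /lab_ok /andP[].
Qed.

Definition good_arr (c : arr M M n) :=
  lat_arr nu lah c && [forall r : 'I_M, rowsum c r == rho r].

(** The excluded entry (0, 0), the number of empty labels, has no counterpart in [U]; the length of
    the first row determines it. *)
Definition agree (c : arr M M n) U := forall r j, (r < M)%N -> (j < M)%N ->
  (0 < r + j)%N -> av c r j = uu U r j.

Lemma uu0 U r : all (okrow L N) U -> uu U r 0 = 0%N.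
Proof.
move=> Uok; apply/count_memPn/negP => h.
by case/andP: (nth_okrow r Uok) => _ /allP /(_ _ h).
Qed.

Lemma size_uu U r : all (okrow L N) U -> (\sum_(0 <= j < M) uu U r j)%N = size (nth [::] U r).
Proof.
move=> Uok; rewrite pre_count -[RHS]count_predT; apply: eq_in_count => j jU.
exact: (allP (okrow_lt (nth_okrow r Uok))).
Qed.

Lemma mul_add_gt0 k i : (0 < i)%N -> (0 < k * N + i)%N.
Proof. by move=> i0; rewrite addn_gt0 i0 orbT. Qed.

Lemma agree_height c U k r i : agree c U -> (k < L)%N -> (r <= M)%N -> (0 < i)%N ->
  (i < N)%N -> lat_height M N (av c) k r i = lat_height M N (uu U) k r i.
Proof.
move=> ag kL rM i0 iN; rewrite /lat_height; congr (_ + _)%N.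
  apply: eq_big_nat => k' /andP[_ kk]; apply: eq_big_nat => r' /andP[_ r'M].
  apply: ag => //; first by apply: mul_add_lt => //; exact: ltn_trans kk kL.
  by rewrite addn_gt0 mul_add_gt0 // orbT.
apply: eq_big_nat => r' /andP[_ r'r]; apply: ag.
- exact: leq_trans r'r rM.
- exact: mul_add_lt.
- by rewrite addn_gt0 mul_add_gt0 // orbT.
Qed.

Lemma agree_xcnt c U i : agree c U -> (0 < i)%N -> (i < N)%N ->
  @xcnt M L N n c i = xcont M L N (uu U) i.
Proof.
move=> ag i0 iN; apply: eq_big_nat => k /andP[_ kL]; apply: eq_big_nat => r /andP[_ rM].
apply: ag => //; first exact: mul_add_lt.
by rewrite addn_gt0 mul_add_gt0 // orbT.
Qed.

Lemma agree_zcont c U k : agree c U -> (0 < k)%N -> (k < L)%N ->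
  @zcont M L N n c k = (\sum_(0 <= r < M) \sum_(0 <= i < N) uu U r (k * N + i))%N.
Proof.
move=> ag k0 kL; apply: eq_big_nat => r /andP[_ rM]; apply: eq_big_nat => i /andP[_ iN].
apply: ag => //; first exact: mul_add_lt.
by rewrite !addn_gt0 muln_gt0 k0 N0 /= orbT.
Qed.

Lemma agree_pre c U r j : all (okrow L N) U -> agree c U -> (0 < r)%N -> (r < M)%N ->
  (j <= M)%N -> pre (av c) r j = count (gtn j) (nth [::] U r).
Proof.
move=> Uok ag r0 rM jM; rewrite -pre_count; apply: eq_big_nat => a /andP[_ aj].
apply: ag => //; first exact: leq_trans aj jM.
by rewrite addn_gt0 r0.
Qed.

Lemma agree_row0 c U : all (okrow L N) U -> agree c U ->
  rowsum c 0 = (av c 0 0 + size (nth [::] U 0))%N.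
Proof.
move=> Uok ag; have M0 : (0 < M)%N by apply: leq_trans gaM.
rewrite -size_uu // /rowsum /pre !(big_ltn M0) uu0 // add0n; congr (_ + _)%N.
by apply: eq_big_nat => j /andP[j0 jM]; apply: ag.
Qed.

Lemma agree_rowS c U r : all (okrow L N) U -> agree c U -> (r.+1 < M)%N ->
  rowsum c r.+1 = size (nth [::] U r.+1).
Proof.
move=> Uok ag rM; rewrite -size_uu //; apply: eq_big_nat => j /andP[_ jM].
exact: ag.
Qed.

Lemma row0_size U : all (okrow L N) U -> good_tab (tabU N U) ->
  (size (nth [::] U 0) <= s0)%N.
Proof.
move=> Uok [[T0 _ Tl _ _ Tc _] _ _].
have -> : s0 = size (flatten (flatten (tabU N U))).
  by rewrite (perm_size Tc) size_cat !size_letters.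
apply: leq_trans (size_flatten_ge Tl).
have -> : size (nth [::] U 0) = size (head [::] (tabU N U)).
  by rewrite -nth0 nth_tabU size_map.
by case: (tabU N U) => //= t T; rewrite size_cat leq_addr.
Qed.

Lemma good_arr_of c U : all (okrow L N) U -> tab_cond U -> agree c U ->
  (av c 0 0 + size (nth [::] U 0))%N = (n - sumn ga)%N -> good_arr c.
Proof.
move=> Uok Uc ag e00; have [szU sz cols X1 X2 r1 lat] := Uc.
have M0 : (0 < M)%N by apply: leq_trans gaM.
have r0s : (size (nth [::] U 0) <= s0)%N.
  by apply: row0_size => //; apply/good_tabU.
(* The first row has n - |ga| cells, hence at least n - s0, and at most s0 of them are nonempty;
   this is where [3 * s0 < n] is spent. *)
have c00 : (s0 < av c 0 0)%N by move: gas ns e00 r0s; lia.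
have ga0 r : (nth 0%N ga r <= s0)%N := leq_trans (nth_le_sumn _ _) gas.
have rows r : (r < M)%N -> rowsum c r = rho r.
  case: r => [|r] rM; first by rewrite (agree_row0 Uok ag) e00.
  by rewrite (agree_rowS Uok ag) // sz.
have rtot : (\sum_(0 <= r < M) rowsum c r)%N = n.
  rewrite (eq_big_nat _ _ (F2 := rho)); last by move=> r /andP[_]; apply: rows.
  by rewrite sum_nth_wide //= subnK //; move: gas ns; lia.
(* The contents at k = 0 and i = 0 cannot be read off [U]; they are found by subtracting the others
   from the total n. *)
have ztot : (\sum_(0 <= k < L) @zcont M L N n c k)%N = n.
  rewrite exchange_big /= -[RHS]rtot; apply: eq_bigr => r _.
  exact: (sum_groups N (av c) r L).
have xtot : (\sum_(0 <= i < N) @xcnt M L N n c i)%N = n.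
  rewrite /xcnt /xcont exchange_big /= -[RHS]ztot; apply: eq_bigr => k _.
  by rewrite exchange_big.
have zk k : (0 < k)%N -> (k < L)%N -> @zcont M L N n c k = nth 0%N al k.-1.
  by move=> k0 kL; rewrite (agree_zcont ag) // X2.
have xi i : (0 < i)%N -> (i < N)%N -> @xcnt M L N n c i = nth 0%N la i.-1.
  by move=> i0 iN; rewrite (agree_xcnt ag) // X1.
have hle k r i : (k < L)%N -> (r <= M)%N ->
    (lat_height M N (av c) k r i <= @xcnt M L N n c i)%N.
  by move=> kL rM; rewrite /xcnt (@xcont_height M L N _ k r _ kL rM) -addnA leq_addr.
apply/andP; split; last by apply/forallP => r; rewrite rows.
apply/and4P; split.
- apply/ssytP => r j rM jM; case: r rM => [|r] rM.
    case: j jM => [|j] jM.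
      by rewrite preS /pre !big_nil add0n (ag _ _ rM) // uu0.
    (* The second row lies entirely above empty labels. Hence no column condition links it to the
       nonempty cells of the first row, as in the skew shape of the theorem. *)
    apply: (@leq_trans (rowsum c 1)); first exact: pre_mono.
    rewrite (agree_rowS Uok ag) // sz; apply: leq_trans (ga0 0%N) _.
    apply: leq_trans (ltnW c00) _; rewrite /pre big_ltn //; exact: leq_addr.
  rewrite !(agree_pre Uok ag) // ?(ltnW jM) //; last exact: ltnW.
  have [rg|gr] := ltnP r.+1 (size ga); first exact: cols.
  by rewrite [nth [::] U r.+2]nth_default // szU ltnS.
- apply/forallP => -[k kL] /=; apply/eqP; case: k kL => [|k] kL; last by rewrite zk.
  move: ztot; rewrite big_ltn // (eq_big_nat _ _ (F2 := fun k => nth 0%N al k.-1)).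
    by rewrite nth_sum_shift // /nu /=; move: ns; lia.
  by move=> k /andP[k0 kL']; rewrite zk.
- apply/lattP => k r i kL rM iN; case: i iN => [|i] iN; last first.
    by rewrite !(agree_height ag) ?(ltnW rM) ?(ltnW iN) //; apply: lat.
  (* Letters 0 and 1. At the start of the word the inequality is the row-1 condition; anywhere later
     the empty labels already read outnumber all the letters 1. *)
  have [/andP[/eqP -> /eqP ->]|kr] := boolP ((k == 0%N) && (r == 0%N)).
    have M1 : (1 < M)%N := leq_trans iN (leq_pmull N L0).
    by rewrite lat_heightS /lat_height !big_nil !add0n ?mul0n ?addn0 ag // r1.
  apply: leq_trans (hle _ _ _ kL rM) _; rewrite xi //.
  apply: leq_trans (_ : s0 <= _)%N.
    by apply: leq_trans (nth_le_sumn _ _) _; apply: leq_addr.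
  apply: leq_trans (ltnW c00) _; rewrite /lat_height !addn0.
  case: k kL kr => [|k] kL kr.
    case: r rM kr => // r rM _; rewrite ?mul0n.
    by apply: leq_trans (leq_addl _ _); rewrite big_ltn //; apply: leq_addr.
  apply: leq_trans (leq_addr _ _); rewrite big_ltn //; apply: leq_trans (leq_addr _ _).
  by rewrite ?mul0n big_ltn //; apply: leq_addr.
- apply/forallP => -[i iN] /=; apply/eqP; case: i iN => [|i] iN; last by rewrite xi.
  move: xtot; rewrite big_ltn // (eq_big_nat _ _ (F2 := fun i => nth 0%N la i.-1)).
    by rewrite nth_sum_shift // /lah /=; move: ns; lia.
  by move=> k /andP[k0 kN]; rewrite xi.
Qed.

Definition crow (c : arr M M n) r : seq nat :=
  sort leq (flatten (mkseq (fun j => nseq (av c r j.+1) j.+1) M.-1)).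

Definition arr_rows (c : arr M M n) := mkseq (crow c) (size ga).+1.

Lemma count_crow c r j : count_mem j (crow c r) =
  if (0 < j < M)%N then av c r j else 0%N.
Proof.
rewrite count_sort count_flatten -map_comp sumnE big_map.
rewrite -[X in iota 0 X]subn0 -/(index_iota 0 M.-1).
have e a : (count_mem j \o (fun j => nseq (av c r j.+1) j.+1)) a =
    if a.+1 == j then av c r a.+1 else 0%N.
  by rewrite /= count_nseq /=; case: eqP; rewrite ?mul1n ?mul0n.
rewrite (eq_bigr _ (fun a _ => e a)); case: j {e} => [|j] /=; first by rewrite big1.
have [jM|Mj] := ltnP j.+1 M; last first.
  rewrite big_nat_cond big1 // => a; rewrite andbT => /andP[_ aM].
  case: eqP => // -[ea]; have : (a.+1 < M)%N by rewrite -ltn_predRL.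
  by rewrite ea ltnNge Mj.
have jM' : (j < M.-1)%N by rewrite ltn_predRL.
rewrite (sum_one jM'); first by rewrite eqxx.
by move=> a _ aj; rewrite eqSS (negbTE aj).
Qed.

Lemma crow_ok c r : okrow L N (crow c r).
Proof.
rewrite /okrow sort_sorted /=; last exact: leq_total.
apply/allP => j; rewrite -has_pred1 has_count count_crow; by case: ifP.
Qed.

Lemma arr_rows_ok c : all (okrow L N) (arr_rows c).
Proof. by apply/allP => t /mapP[r _ ->]; apply: crow_ok. Qed.

Lemma arr_rows_agree c : good_arr c -> agree c (arr_rows c).
Proof.
case/andP=> /and4P[cs _ _ _] /forallP cr r j rM jM rj; rewrite /uu.
have [rg|gr] := ltnP r (size ga).+1.
  rewrite nth_mkseq // count_crow jM andbT; case: posnP => // j0; subst j.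
  by apply: (ssyt_low cs) => //; move: rj; rewrite addn0.
rewrite [nth [::] _ r]nth_default ?size_mkseq //=.
have := cr (Ordinal rM); rewrite /= /rho; case: r rM rj gr => // r rM _ gr /=.
rewrite nth_default // => /eqP r0; apply/eqP; rewrite -leqn0 -[X in (_ <= X)%N]r0.
by rewrite /rowsum; apply: (@leq_sum_nat (av c r.+1)).
Qed.

Lemma arr_rows_cond c : good_arr c -> tab_cond (arr_rows c).
Proof.
move=> cg; have ag := arr_rows_agree cg; have Uok := arr_rows_ok c.
case/andP: cg => /and4P[cs /forallP cz /lattP cl /forallP cx] /forallP cr.
split.
- by rewrite size_mkseq.
- move=> r; have [rM|Mr] := ltnP r.+1 M.
    by rewrite -(agree_rowS Uok ag) // (eqP (cr (Ordinal rM))).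
  rewrite !nth_default ?size_mkseq //; first by move: gaM Mr; lia.
  by move: gaM Mr; lia.
- move=> r t rg tM; rewrite -!(agree_pre Uok ag) //; try (move: gaM rg tM; lia).
  by move/ssytP: cs; apply => //; move: gaM rg; lia.
- move=> i i0 iN; rewrite -(agree_xcnt ag) // (eqP (cx (Ordinal iN))).
  by case: i i0 iN.
- move=> k k0 kL; rewrite -(agree_zcont ag) // (eqP (cz (Ordinal kL))).
  by case: k k0 kL.
- have M0 : (0 < M)%N by apply: leq_trans gaM.
  (* Before the first row of group 0 nothing has been read, so the lattice condition leaves no room
     for a pair (0, i + 1) there. *)
  move=> [|i] // _ iN; have := cl 0%N 0%N i L0 M0 iN.
  rewrite lat_heightS /lat_height !big_nil !add0n ?mul0n leqn0 => /eqP e.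
  rewrite -ag //; apply: leq_trans iN _; exact: leq_pmull.
- move=> k r i kL rM i0 iN; rewrite -!(agree_height ag) ?(ltnW iN) ?(ltnW rM) //.
  exact: cl.
Qed.

Lemma arr_rows_inj : {in good_arr &, injective arr_rows}.
Proof.
move=> c d cg dg e; have ac := arr_rows_agree cg; have ad := arr_rows_agree dg.
rewrite e in ac.
apply: arr_ext => r j rM jM; have [rj|] := posnP (r + j); last first.
  by move=> rj; rewrite ac // ad.
have [-> ->] : r = 0%N /\ j = 0%N by lia.
have Uok := arr_rows_ok d.
have M0 : (0 < M)%N by apply: leq_trans gaM.
have := agree_row0 Uok ac; have := agree_row0 Uok ad.
case/andP: cg => _ /forallP/(_ (Ordinal M0))/eqP /= ->.
case/andP: dg => _ /forallP/(_ (Ordinal M0))/eqP /= ->.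
by move=> -> /addIn.
Qed.

Lemma arr_of_tab U : all (okrow L N) U -> tab_cond U ->
  exists2 c, good_arr c & arr_rows c = U.
Proof.
move=> Uok Uc; have [szU sz _ _ _ _ _] := Uc.
have M0 : (0 < M)%N by apply: leq_trans gaM.
have r0s : (size (nth [::] U 0) <= s0)%N.
  by apply: row0_size => //; apply/good_tabU.
pose v r j := if (r + j)%N == 0%N then (n - sumn ga - size (nth [::] U 0))%N else uu U r j.
have un r j : (uu U r j <= n)%N.
  apply: leq_trans (count_size _ _) _; case: r => [|r].
    by apply: leq_trans r0s _; move: ns; lia.
  rewrite sz; apply: leq_trans (nth_le_sumn _ _) _; move: gas ns; lia.
pose c := mkarr M M n v.
have avc r j : (r < M)%N -> (j < M)%N -> av c r j = v r j.
  move=> rM jM; rewrite av_mkarr // /v; case: eqP => // _; lia.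
have ag : agree c U.
  by move=> r j rM jM rj; rewrite avc // /v; case: eqP => // e; rewrite e in rj.
have cg : good_arr c.
  apply: (good_arr_of Uok Uc ag); rewrite avc // /v /=.
  by rewrite subnK //; move: gas ns; lia.
exists c => //; apply: (@eq_from_nth _ [::]); first by rewrite size_mkseq szU.
move=> r; rewrite size_mkseq => rg; rewrite nth_mkseq //.
have [su aU] := andP (nth_okrow r Uok); have [sc aC] := andP (crow_ok c r).
apply: (sorted_eq leq_trans anti_leq) => //.
have rM : (r < M)%N by exact: leq_trans rg gaM.
apply/allP => j _ /=; apply/eqP; rewrite count_crow.
case: ifP => [/andP[j0 jM]|jn]; first by rewrite ag // addn_gt0 j0 orbT.
apply/esym/count_memPn/negP => jU.
by have := allP aU _ jU; rewrite jn.
Qed.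

Lemma tableaux_count : exists S : {fset tableau},
  (forall T, T \in S <-> good_tab T) /\ #|` S| = #|[set c | good_arr c]|.
Proof.
exists [fset tabU N (arr_rows c) | c in [set c | good_arr c]]%fset; split.
  move=> T; split.
    case/imfsetP => c /=; rewrite inE => cg ->.
    by apply: (good_tabU (arr_rows_ok c)).2; apply: arr_rows_cond.
  move=> gT; have [U Uok eT] := tabU_of gT.
  have Uc : tab_cond U by apply: (good_tabU Uok).1; rewrite -eT.
  have [c cg eU] := arr_of_tab Uok Uc.
  by apply/imfsetP; exists c; rewrite ?inE // eU.
rewrite card_in_imfset /=; first by rewrite -cardE.
move=> c d; rewrite !inE => cg dg e; apply: arr_rows_inj => //.
have mi : injective (map (labj N)) by apply/inj_map/labj_inj.
exact: (inj_map mi).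
Qed.

End Bijection.

(** * The expansion *)

Lemma cycle_type_part n (s : 'S_n) : is_part (cycle_type s).
Proof.
rewrite /is_part (sort_sorted geq_total) mem_sort; apply/mapP => -[c].
rewrite mem_enum => /imsetP[x _ ->] /esym/eqP; apply/negP; rewrite -lt0n.
by apply/card_gt0P; exists x; apply: porbit_id.
Qed.

Lemma sumn_cycle_type n (s : 'S_n) : sumn (cycle_type s) = n.
Proof.
rewrite /cycle_type (@perm_sumn _ [seq #|pred_of_set c| | c <- enum (porbits s)]);
  last by rewrite perm_sort.
rewrite sumnE big_map big_enum /= -[RHS](card_ord n) -sum1_card.
rewrite [RHS](partition_big (porbit s) (mem (porbits s))) /=; last first.
  by move=> x _; apply: imset_f.
apply: eq_bigr => c /imsetP[x0 _ ->]; rewrite sum1_card; apply: eq_card => x.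
by rewrite -eq_porbit_mem.
Qed.

Lemma intpart_ext (x y : intpart) : (forall r, nth 0%N x r = nth 0%N y r) -> x = y.
Proof.
have pos (z : intpart) r : (r < size z)%N -> (0 < nth 0%N z r)%N.
  by move=> rz; apply: (allP (intpart_pos z)); apply: mem_nth.
move=> h; apply: val_inj; apply: (@eq_from_nth _ 0%N) => [|r _]; last exact: h.
apply/eqP; rewrite eqn_leq; apply/andP; split; rewrite leqNgt; apply/negP => lt.
  by have := pos _ _ lt; rewrite h nth_default.
by have := pos _ _ lt; rewrite -h nth_default.
Qed.

Lemma head_le_sumn (s : seq nat) : (head 0%N s <= sumn s)%N.
Proof. by rewrite -nth0 nth_le_sumn. Qed.

Lemma long_part n (x : intpart) : (sumn x + head 0%N x <= n)%N -> (0 < n)%N ->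
  is_part ((n - sumn x)%N :: x) /\ sumn ((n - sumn x)%N :: x) = n.
Proof.
move=> h n0; split; last by rewrite /= subnK //; lia.
have := intpart_sorted x; have := intpart_pos x; move: h.
rewrite /is_part /= inE negb_or; case: (val x) => [|a s] /= h.
  by move=> _ _; rewrite addn0 in h *; rewrite subn0; lia.
move=> /andP[a0 sp] -> ; rewrite inE negb_or; apply/and3P; split; [by lia|by lia|].
apply/andP; split; first by lia.
by apply/negP => /(allP sp).
Qed.

(** It allows the unsorted composition in place of the partition obtained by sorting it. *)
Lemma sf_coef_part_of f s : sf_coef f s = sf_coef f (part_of s).
Proof.
rewrite {1}/sf_coef sf_coefE; congr (sf_coef f _); congr part_val; congr part_of.
apply: (@eq_from_nth _ 0%N); first by rewrite size_tuple.
move=> i; rewrite size_tuple => iN.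
by rewrite -[i]/(val (Ordinal iN)) -tnth_nth -mnm_tnth mnmE.
Qed.

(** * Uniqueness of the coefficients, and the expansion itself *)

Section Independence.

Variable stilde : intpart -> symfun.
Hypothesis stildeP : forall la : intpart, is_stilde la (stilde la).

(** Evaluated at the cycle types of permutations of n points, a linear relation becomes one between
    distinct members of an orthonormal family. *)
Lemma stilde_free (A : seq intpart) (b : intpart -> algC) : uniq A ->
  \sum_(x <- A) b x *: stilde x = 0 -> forall x, x \in A -> b x = 0.
Proof.
move=> uA sum0.
(* Large enough for the characterisation of [stilde x] to apply to all x in A at once. *)
pose n := (\sum_(x <- A) 2 * sumn (part_val x)).+1%N.
have An (x : intpart) : x \in A -> (sumn x + head 0%N x < n)%N.
  move=> xA; rewrite ltnS (bigD1_seq x) //=; apply: leq_trans (leq_addr _ _).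
  by have := head_le_sumn x; lia.
have n0 : (0 < n)%N by [].
clearbody n; pose rx (x : intpart) := (n - sumn x)%N :: part_val x.
pose px x : arr 1 n n := row_arr n n (nth 0%N (rx x)).
have rxP x : x \in A -> [/\ is_part (rx x), sumn (rx x) = n & (size (rx x) <= n)%N].
  move=> /An xn; have [] := @long_part n x (ltnW xn) n0; split=> //.
  by have := size_part x; rewrite /=; lia.
have pxP x : x \in A -> ispt (px x) by move=> /rxP[h1 h2 h3]; apply: rho_ispt.
have val0 (s : 'S_n) : \sum_(x <- A) b x * Xc n (sv (px x)) s = 0.
  pose nu := IntPart (cycle_type_part s).
  rewrite -[RHS](sf_eval0 (Xi nu)) -sum0 sf_eval_sum; apply: eq_big_seq => x xA.
  rewrite sf_evalZ; congr (_ * _).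
  rewrite (stildeP (n := n) (nu := nu) (s := s)) //; last exact/ltnW/An.
  have [h1 h2 h3] := rxP x xA; rewrite (chi_Xc h1 h2 h3); apply: eq_Xc => i iN.
  by rewrite /sv /shift av_rho.
move=> y yA; pose q := size A; pose x0 := y.
have : ipn (fun s : 'S_n => \sum_(i < q) b (nth x0 A i) * Xc n (sv (px (nth x0 A i))) s)
    (Xc n (sv (px y))) = 0.
  rewrite /ipn big1 ?mulr0 // => s _; have := val0 s.
  by rewrite (big_nth x0) big_mkord => ->; rewrite mul0r.
rewrite ip_sumX => <-.
have iy : (index y A < q)%N by rewrite index_mem.
rewrite (bigD1 (Ordinal iy)) //= nth_index // ip_XX ?pxP // eqxx mulr1.
rewrite big1 ?addr0 // => i ni; have iA : nth x0 A i \in A by apply: mem_nth.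
rewrite ip_XX ?pxP //; case: eqP => [e|_]; last by rewrite mulr0.
case/eqP: ni; apply: val_inj => /=.
have -> : y = nth x0 A i.
  apply: intpart_ext => r; have [h1 h2 h3] := rxP _ yA; have [k1 k2 k3] := rxP _ iA.
  have [rn|nr] := ltnP r.+1 n.
    have := congr1 (fun p => av p 0 r.+1) e.
    by rewrite !av_rho.
  rewrite [LHS]nth_default; last by move: h3; rewrite /=; lia.
  by rewrite [RHS]nth_default //; move: k3; rewrite /=; lia.
by rewrite index_uniq.
Qed.

End Independence.

Section Expansion.

Variables (la : intpart) (al : seq nat).
Let s0 := (sumn la + sumn al)%N.
Notation N := (nvars la al).
Notation L := (ngroups al).
Notation M := (L * N)%N.

(** Labels are nonempty, so the tableau has at most as many cells as letters. *)
Lemma good_tab_small (ga : intpart) (T : tableau) :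
  good_tab la ga al T -> (sumn ga <= s0)%N.
Proof.
case=> -[T0 sh Tl _ _ Tc _] _ _.
have <- : size (flatten (flatten T)) = s0.
  by rewrite (perm_size Tc) size_cat !size_letters.
apply: leq_trans (size_flatten_ge Tl); rewrite -sh -size_flatten.
by case: (T) => //= t T'; rewrite size_cat leq_addl.
Qed.

Variable n : nat.
Hypothesis ns : (3 * s0 < n)%N.
Let nu := nth 0%N ((n - sumn al)%N :: al).
Let lah := nth 0%N ((n - sumn la)%N :: la).

(** All but |al| entries belong to group 0, and all but at most |la| of these have i = 0. The letter
    0 can only stand in the first row. *)
Lemma sum_row0_cells (c : arr M M n) : lat_arr nu lah c -> (n - s0 <= av c 0 0)%N.
Proof.
case/and4P => cs /forallP cz _ /forallP cx.
have L0 : (0 < L)%N by []. have N0 : (0 < N)%N by [].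
have M0 : (0 < M)%N by rewrite muln_gt0.
have z0 : @zcont M L N n c 0 = (n - sumn al)%N := eqP (cz (Ordinal L0)).
have e1 : @zcont M L N n c 0 = (\sum_(0 <= i < N) \sum_(0 <= r < M) av c r i)%N.
  by rewrite /zcont exchange_big /=; apply: eq_bigr => i _; apply: eq_bigr.
have e2 : (\sum_(0 <= r < M) av c r 0)%N = av c 0 0.
  apply: (sum_one (F := fun r => av c r 0%N)) => // r rM r0.
  by apply: (ssyt_low cs) => //; rewrite lt0n.
have e3 : (\sum_(1 <= i < N) \sum_(0 <= r < M) av c r i <= sumn la)%N.
  rewrite -(@nth_sum_shift la N); last by rewrite /nvars; lia.
  rewrite !big_nat; apply: leq_sum => i /andP[i0 iN].
  have -> : nth 0%N la i.-1 = @xcnt M L N n c i.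
    by rewrite (eqP (cx (Ordinal iN))); case: i i0 iN.
  by rewrite /xcnt /xcont [X in (_ <= X)%N]big_ltn //; apply: leq_addr.
move: z0; rewrite e1 big_ltn // e2 => z0.
by move: e3; rewrite /s0; lia.
Qed.

Lemma chi_product (s : 'S_n) :
  Fc L nu s * chi n ((n - sumn la)%N :: la) s =
  \sum_(ga <- [seq ga <- parts s0.+1 | (sumn (part_val ga) <= s0)%N])
    #|[set c : arr M M n | good_arr ga c]|%:R * chi n ((n - sumn ga)%N :: ga) s.
Proof.
have n0 : (0 < n)%N by move: ns; lia.
have hd (x : intpart) : (sumn x <= s0)%N -> (sumn x + head 0%N x <= n)%N.
  by move=> xs; have := head_le_sumn x; move: ns; lia.
have las : (sumn la <= s0)%N by apply: leq_addr.
have [la1 la2] := long_part (hd la las) n0.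
have laN : (size ((n - sumn la)%N :: la) <= N)%N by rewrite /nvars /=; lia.
have nun : (\sum_(0 <= k < L) nu k)%N = n.
  by rewrite sum_nth_wide //= subnK //; move: ns; rewrite /s0; lia.
rewrite (chi_Xc la1 la2 laN) (Fc_Xc_expand nun); last first.
  by move=> i _; apply: nth_rho_le.
set G := filter _ _.
have gaM (ga : intpart) : (sumn ga <= s0)%N -> ((size ga).+1 <= M)%N.
  move=> gs; apply: leq_trans (leq_pmull N (isT : (0 < L)%N)).
  by have := size_part ga; rewrite /nvars -/s0; lia.
pose rho (ga : intpart) := nth 0%N ((n - sumn ga)%N :: ga).
pose Rr (ga : intpart) (c : arr M M n) := [forall r : 'I_M, rowsum c r == rho ga r].
transitivity (\sum_(ga <- G) \sum_(c | lat_arr nu lah c && Rr ga c)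
    Xc M (shift M (rowsum c)) s); last first.
  apply: eq_big_seq => ga; rewrite mem_filter => /andP[gs _].
  have [g1 g2] := long_part (hd ga gs) n0.
  rewrite (chi_Xc g1 g2 (gaM _ gs)).
  rewrite (eq_bigr (fun=> Xc M (shift M (rho ga)) s)); last first.
    move=> c /andP[_ /forallP h]; apply: eq_Xc => i iM.
    by rewrite /shift (eqP (h (Ordinal iM))).
  rewrite sumr_const mulr_natl; congr (_ *+ _); apply: eq_card => c.
  by rewrite !inE.
rewrite (exchange_big_dep (fun c => lat_arr nu lah c)) /=; last first.
  by move=> ga c _ /andP[].
apply: eq_bigr => c cl.
have M0 : (0 < M)%N by rewrite muln_gt0.
have c00 := sum_row0_cells cl.
have [cs /forallP cz _ _] := and4P cl.
have rtot : (\sum_(0 <= r < M) rowsum c r)%N = n.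
  rewrite -[RHS]nun.
  transitivity (\sum_(0 <= k < L) @zcont M L N n c k)%N; last first.
    by apply: eq_big_nat => k /andP[_ kL]; rewrite (eqP (cz (Ordinal kL))).
  rewrite [RHS]exchange_big /=; apply: eq_bigr => r _.
  by rewrite (sum_groups N (av c) r L).
have rdec r : (rowsum c r.+1 <= rowsum c r)%N.
  have [rM|Mr] := ltnP r.+1 M; first exact: ssyt_rowsum.
  rewrite /rowsum /pre big1 // => j _; exact: av_out_row.
pose t := mkseq (fun r => rowsum c r.+1) M.-1.
have t_sorted : sorted geq t.
  apply/(sortedP 0%N) => i; rewrite size_mkseq => iM.
  by rewrite !nth_mkseq ?(ltnW iM) //; apply: rdec.
(* The only possible ga for the array c: its rows other than the first. [sum_row0_cells] bounds its
   size by s0, so it is in the range of summation. *)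
pose ga0 := part_of t.
have ga0E r : nth 0%N ga0 r = rowsum c r.+1.
  have gt : ga0 = filter (leq 1) t :> seq nat.
    exact: (sorted_sort geq_trans (sorted_filter geq_trans _ t_sorted)).
  have tE : t = filter (leq 1) t ++ nseq (size t - size (filter (leq 1) t)) 0%N.
    rewrite -{1}(cat_take_drop (count (leq 1) t) t) take_sorted_geq //; congr (_ ++ _).
    apply: (@eq_from_nth _ 0%N); first by rewrite size_drop size_nseq size_filter.
    move=> i; rewrite size_drop => it; rewrite nth_nseq size_filter it nth_drop.
    apply/eqP; rewrite -leqn0 leqNgt; apply/negP => pos.
    have := erefl (count (leq 1) t).
    rewrite -{1}(cat_take_drop (count (leq 1) t) t) count_cat take_sorted_geq //.
    rewrite count_filter (eq_count (a2 := leq 1)); last by move=> x /=; rewrite andbb.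
    move/eqP; rewrite -[X in _ == X]addn0 eqn_add2l -leqn0 leqNgt -has_count.
    case/negP; apply/hasP; exists (nth 0%N (drop (count (leq 1) t) t) i).
      by apply: mem_nth; rewrite size_drop.
    by rewrite nth_drop.
  have -> : nth 0%N ga0 r = nth 0%N t r.
    rewrite gt tE nth_cat -tE; case: ltnP => // rs.
    by rewrite nth_default // nth_nseq if_same.
  have [rM|Mr] := ltnP r M.-1; first by rewrite nth_mkseq.
  rewrite nth_default ?size_mkseq // /rowsum /pre big1 // => j _.
  by rewrite av_out_row //; lia.
have ga0n : (rowsum c 0 + sumn ga0 = n)%N.
  rewrite sumn_part_of /t sumnE big_map -[X in iota 0 X]subn0 -/(index_iota 0 M.-1).
  by rewrite -[RHS]rtot [RHS]big_ltn // big_add1.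
have c0r : (av c 0 0 <= rowsum c 0)%N by apply: (@leq_sum_nat (av c 0%N)).
have ga0s : (sumn ga0 <= s0)%N by move: ns; lia.
rewrite -big_filter (_ : filter _ G = [:: ga0]) ?big_seq1 //.
have -> : [seq ga <- G | lat_arr nu lah c && Rr ga c] = [seq ga <- G | pred1 ga0 ga].
  apply: eq_in_filter => ga; rewrite mem_filter => /andP[gs _]; rewrite cl /=.
  apply/forallP/eqP => [h|-> [[|r] rM]].
  - apply: intpart_ext => r; rewrite ga0E.
    have [rM|Mr] := ltnP r.+1 M; first by rewrite (eqP (h (Ordinal rM))).
    rewrite nth_default; last by rewrite -ltnS; apply: leq_trans (gaM _ gs) Mr.
    by rewrite /rowsum /pre big1 // => j _; rewrite av_out_row.
  - apply/eqP; change (rowsum c 0 = n - sumn ga0)%N.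
    by rewrite -[X in (X - _)%N]ga0n addnK.
  - by apply/eqP; change (rowsum c r.+1 = nth 0%N ga0 r); rewrite ga0E.
rewrite filter_pred1_uniq // ?filter_uniq ?undup_uniq // mem_filter ga0s.
by rewrite mem_parts.
Qed.

End Expansion.

Theorem mainTheorem4
  (hall : {bilinear symfun -> symfun -> algC | *%R & *%R})
  (hallP : is_hall hall)
  (stilde htilde : intpart -> symfun)
  (stildeP : forall la : intpart, is_stilde la (stilde la))
  (htildeP : forall la : intpart, is_htilde hall la (htilde la))
  (la ga mu : intpart) (al : seq nat)
  (al_comp : 0%N \notin al)
  (mu_sort : mu = sort geq al :> seq nat) :
  exists S : {fset tableau},
    (forall T : tableau,
       T \in S <->
       [/\ is_mct ga la al T, all (all set_label) T & is_lattice T]) /\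
    (forall a : algC,
       coef_in stilde (htilde mu * stilde la) ga a <-> a = #|` S|%:R).
Proof.
pose s0 := (sumn la + sumn al)%N; pose n1 := (3 * s0).+1.
(* One set has to serve every n. The good tableaux do not depend on n, so the numbers of good arrays
   agree for all n above [3 * s0]. *)
have /choice[Sg SgP] : forall x : intpart, exists S : {fset tableau},
    (forall T, T \in S <-> good_tab la x al T) /\
    ((sumn x <= s0)%N -> forall n, (3 * s0 < n)%N ->
      #|` S| = #|[set c : arr (ngroups al * nvars la al) (ngroups al * nvars la al) n
                 | good_arr x c]|).
  move=> x; have [xs|xs] := leqP (sumn x) s0; last first.
    exists fset0; split=> // T; rewrite in_fset0; split=> // /good_tab_small.
    by rewrite leqNgt xs.
  have [S [SP _]] := @tableaux_count la x al n1 xs (ltnSn _).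
  exists S; split=> // _ n nn; have [S' [SP' <-]] := tableaux_count xs nn.
  congr (#|` _|); apply/fsetP => T.
  by apply/idP/idP => [/SP/SP'|/SP'/SP].
pose G := [seq x <- parts s0.+1 | (sumn (part_val x) <= s0)%N].
have mu_al : perm_eq mu al by rewrite mu_sort perm_sort.
have sal : sumn mu = sumn al by apply: perm_sumn.
have expansion : htilde mu * stilde la = \sum_(x <- G) #|` Sg x|%:R *: stilde x.
  apply/eqP; rewrite -subr_eq0; apply/eqP.
  apply: (@sf_separation hall _ n1 hallP) => nu nuP n1nu.
  pose nuI := IntPart nuP; have [s cs] := cycle_type_exists nuI.
  rewrite [part_val _]/= in s cs; set n := sumn nu in s cs n1nu.
  have n0 : (0 < n)%N by exact: leq_trans n1nu.
  have hd (x : intpart) : (sumn x <= s0)%N -> (sumn x + head 0%N x <= n)%N.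
    by move=> xs; have := head_le_sumn x; move: n1nu; rewrite /n1; lia.
  have mus : (sumn mu <= s0)%N by rewrite sal leq_addl.
  have las : (sumn la <= s0)%N by rewrite leq_addr.
  have hv : sf_eval (htilde mu) (Xi nu) =
      Fc (ngroups al) (nth 0%N ((n - sumn al)%N :: al)) s.
    rewrite (htildeP mu n nuI) ?hd //.
    have [m1 m2] := long_part (hd mu mus) n0.
    rewrite -[_ :: _]/(part_val (IntPart m1)) (hall_coef hallP).
    (* [al] is a composition, perhaps unsorted. The monomial coefficient does not depend on the
       order, so the groups may keep the order of [al], as in the tableaux. *)
    have <- : part_of ((n - sumn al)%N :: al) = IntPart m1.
      apply/eqP; rewrite part_of_eq (all_filterP _).
        by rewrite /= sal perm_cons perm_sym.
      apply/allP => x; rewrite inE => /orP[/eqP ->|xal].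
        by move: n1nu; rewrite /n1 /s0; lia.
      by rewrite lt0n; apply: contraNneq al_comp => <-.
    by rewrite -sf_coef_part_of (@psym_coef _ s nuI).
  rewrite sf_evalB sf_evalM hv sf_eval_sum.
  rewrite (stildeP la n nuI s) ?hd // (chi_product n1nu) -/s0.
  apply/eqP; rewrite subr_eq0; apply/eqP; apply: eq_big_seq => x.
  rewrite mem_filter => /andP[xs _]; rewrite sf_evalZ.
  rewrite (stildeP x n nuI s) ?hd //; congr (_%:R * _).
  by have [_ h] := SgP x; rewrite (h xs n n1nu).
have Sg0 x : x \notin G -> #|` Sg x| = 0%N.
  rewrite mem_filter negb_and => xG; apply/eqP; rewrite cardfs_eq0.
  apply/negPn/negP => /fset0Pn[T].
  have [SP _] := SgP x; move/SP/good_tab_small => xs.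
  by case/orP: xG; rewrite ?xs // mem_parts.
pose c0 : {fsfun intpart -> algC with 0} :=
  [fsfun x in [fset x in G]%fset => #|` Sg x|%:R].
have c0E x : c0 x = #|` Sg x|%:R.
  rewrite fsfunE inE; case: ifP => // /negbT /Sg0 ->.
  by [].
have wide (c : {fsfun intpart -> algC with 0}) (A : {fset intpart}) :
    (finsupp c `<=` A)%fset ->
    \sum_(x <- finsupp c) c x *: stilde x = \sum_(x <- A) c x *: stilde x.
  move=> cA; apply: big_fset_incl => // x _ xc.
  by rewrite fsfun_dflt // scale0r.
have sum0 : htilde mu * stilde la = \sum_(x <- finsupp c0) c0 x *: stilde x.
  rewrite (wide _ [fset x in G]%fset); last first.
    apply/fsubsetP => x; rewrite mem_finsupp c0E => h; rewrite inE.
    by apply: contraNT h => /Sg0 ->.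
  rewrite expansion; apply/esym.
  have -> : \sum_(x <- [fset x in G]%fset) c0 x *: stilde x =
      \sum_(x <- G) c0 x *: stilde x.
    apply: perm_big; apply: uniq_perm; rewrite ?fset_uniq ?filter_uniq ?undup_uniq //.
    by move=> x; rewrite inE.
  by apply: eq_bigr => x _; rewrite c0E.
exists (Sg ga); split; first by case: (SgP ga).
move=> a; split=> [[c [cE <-]]|->]; last by exists c0; split; rewrite ?c0E.
pose A := (finsupp c `|` finsupp c0)%fset.
have free : \sum_(x <- A) (c x - c0 x) *: stilde x = 0.
  under eq_bigr => x _ do rewrite scalerBl.
  rewrite sumrB -(wide c) ?fsubsetUl // -(wide c0) ?fsubsetUr //.
  by rewrite -cE -sum0 subrr.
rewrite -c0E; have [gaA|] := boolP (ga \in A).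
  have := stilde_free stildeP (b := fun x => c x - c0 x) (fset_uniq A) free gaA.
  by move/eqP; rewrite subr_eq0 => /eqP.
rewrite inE negb_or => /andP[h1 h2].
by rewrite !fsfun_dflt.
Qed.
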